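(* Let $\mu,\nu$ be probability measures on $\Gamma_X$ satisfying Hypothesis (H), with $\mu(\eta(X)=+\infty)=1$, $\mu$ regular, and $\inf_{\gamma\in\Sigma(\mu,\nu)}\int c\,d\gamma<\infty$. Let $(\Lambda_n)_{n\ge1}$ be an increasing sequence of compact subsets of $X$ with $\bigcup_{n\ge1}\Lambda_n=X$. Then there exist a unique optimal measure $\gamma$ for MKP$(\mu,\nu,c)$ and a unique (up to $\mu$-null sets) measurable map $T:\Gamma_X\to\Gamma_X$ such that $\gamma=(\mathrm{Id}\otimes T)^*\mu$.
   Context: $X=\mathbb{R}^k$; for $Y\subset X$, $\Gamma_Y$ is the set of locally finite subsets of $Y$ identified with counting measures, vague topology; $\eta(B)$ = number of points in $B$. Cost: $c(\eta_1,\eta_2)=\inf\{\int\frac12\|x-y\|^2d\beta:\beta\in\Gamma_{X\times X}$ with marginals $\eta_1,\eta_2\}$, $\inf\emptyset=+\infty$. MKP$(\mu,\nu,c)$: minimize $\int c\,d\gamma$ over couplings $\gamma\in\Sigma(\mu,\nu)$ (probabilities on $\Gamma_X\times\Gamma_X$ with marginals $\mu,\nu$); minimizers are optimal measures. $(\mathrm{Id}\otimes T)^*\mu$ is the image of $\mu$ under $\eta\mapsto(\eta,T(\eta))$. $\pi^\Lambda(\eta)=\eta\cap\Lambda$. Hypothesis (H) on a probability $\mu$ on $\Gamma_X$: (i) $\eta(\{x\})\in\{0,1\}$ for all $x$, $\mu$-a.s.; (ii) either $\mu(\eta(X)<\infty)=1$ or $\mu(\eta(X)=\infty)=1$; (iii)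 for every smooth compactly supported vector field $v$ with flow $\mathcal V^v_t$ and every $t$, $\mu$ is quasi-invariant under $\eta\mapsto\sum_{x\in\eta}\varepsilon_{\mathcal V^v_t(x)}$. The intensity $B\mapsto E_\mu[\eta(B)]$ is a Radon measure. Regularity: for a probability $m$ on $\Gamma_\Lambda$, $\Lambda$ compact, and $n\ge1$, let $\hat m_n$ be the symmetric probability on $\{(x_1,\dots,x_n)\in\Lambda^n:x_i\ne x_j\}$ whose image under $(x_i)\mapsto\sum\varepsilon_{x_i}$ is $m(\cdot\mid\eta(\Lambda)=n)$; $m$ is regular if every $\hat m_n$ is absolutely continuous w.r.t. Lebesgue measure. For $\mu$ on $\Gamma_X$, ''regular'' is taken to mean that $\pi^\Lambda\mu$ is regular for every compact $\Lambda$. *)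

(* Defs.v *)
From HB Require Import structures.
From mathcomp Require Import all_boot all_order all_algebra.
From mathcomp Require Import all_classical all_reals all_analysis.
From mathcomp Require Import fingroup perm.
Import Order.TTheory GRing.Theory Num.Theory.

Set Implicit Arguments.
Unset Strict Implicit.
Unset Printing Implicit Defensive.

Local Open Scope classical_set_scope.
Local Open Scope ring_scope.

Section ConfigurationSpace.
Variables (R : realType) (k : nat).

(** The ambient space X = R^k (row vectors), and (R^k)^n as n x k matrices
    (row i = i-th point). *)
Definition X : normedModType R := 'M[R]_(1, k).
Definition Xn (n : nat) : normedModType R := 'M[R]_(n, k).

Definition sqnorm (x : X) : R := \sum_(j < k) (x ord0 j) ^+ 2.

Definition borelX (B : set X) : Prop := <<s [set U : set X | open U] >> B.

(** eta(B): number of points of the (simple) point configuration S in B,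
    i.e. the integral of the indicator of B against the counting measure of S
    (value +oo if infinite). *)
Definition npts {T : choiceType} (S B : set T) : \bar R := (\esum_(x in S `&` B) 1)%E.

Definition locfin (S : set X) : Prop :=
  forall K : set X, compact K -> finite_set (S `&` K).

Record config := Config { cpts :> set X ; cpts_locfin : locfin cpts }.

Lemma locfin0 : locfin set0.
Proof. by move=> K _; rewrite set0I; exact: finite_set0. Qed.

Definition config0 := Config locfin0.

HB.instance Definition _ := gen_eqMixin config.
HB.instance Definition _ := gen_choiceMixin config.
HB.instance Definition _ := isPointed.Build config config0.

Definition count_gen : set (set config) :=
  [set S | exists (B : set X) (a : \bar R), borelX B /\ S = [set eta : config | npts (cpts eta) B = a]].

Definition Gamma := g_sigma_algebraType count_gen.

Definition XnBorel (n : nat) := g_sigma_algebraType [set U : set (Xn n) | open U].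

Definition leb_null (n : nat) (N : set (Xn n)) : Prop :=
  forall e : R, 0 < e -> exists (a b : nat -> Xn n),
    (forall m i j, a m i j <= b m i j) /\
    N `<=` \bigcup_m [set x : Xn n | forall i j, a m i j <= x i j <= b m i j] /\
    (\sum_(0 <= m <oo) (\prod_(i < n) \prod_(j < k) (b m i j - a m i j))%:E
       <= e%:E)%E.

Definition tuple_pts (n : nat) (x : Xn n) : set X := range (fun i : 'I_n => row i x).

(** Regularity of a probability on Gamma_X: for every compact Lambda and n >= 1,
    the symmetric probability hat m_n on pairwise-distinct n-tuples of Lambda whose
    image under (x_i) |-> sum eps_{x_i} is (pi^Lambda mu)( . | eta(Lambda) = n)
    is absolutely continuous w.r.t. Lebesgue measure. *)
Definition regular (mu : probability Gamma R) : Prop :=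
  forall (Lam : set X), compact Lam ->
  forall n : nat, (0 < n)%N ->
  let En := [set eta : Gamma | npts (cpts eta) Lam = n%:R%:E] in
  (0 < mu En)%E ->
  forall P : probability (XnBorel n) R,
    P [set x : XnBorel n | (forall i, Lam (row i x)) /\
                           injective (fun i : 'I_n => row i x)] = 1%E ->
    (forall (s : 'S_n) (A : set (XnBorel n)), measurable A ->
        P [set x : XnBorel n | A (row_perm s x)] = P A) ->
    (* image = conditional law of pi^Lambda eta given eta(Lambda) = n *)
    (forall A : set Gamma, measurable A ->
        (P [set x : XnBorel n | exists2 eta : Gamma, A eta & cpts eta = tuple_pts x]
           * mu En)%E
        = mu (En `&` [set eta : Gamma |
                      exists2 eta' : Gamma, A eta' & cpts eta' = cpts eta `&` Lam])) ->
    forall N : set (XnBorel n), measurable N -> leb_null N -> P N = 0%E.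

Definition unitv (j : 'I_k) : X := delta_mx ord0 j.

Fixpoint pder (s : seq 'I_k) (f : X -> X) : X -> X :=
  match s with
  | [::] => f
  | j :: s' => fun x => 'D_(unitv j) (pder s' f) x
  end.

Definition smooth (f : X -> X) : Prop :=
  forall s : seq 'I_k,
    (forall j x, derivable (pder s f) x (unitv j)) /\ continuous (pder s f).

Definition compact_support (f : X -> X) : Prop :=
  compact (closure [set x | f x != 0]).

Definition is_flow (v : X -> X) (V : R -> X -> X) : Prop :=
  (forall x, V 0 x = x) /\
  (forall (t : R) (x : X), is_derive t 1 (fun s => V s x) (v (V t x))).

Definition quasi_invariant (mu : probability Gamma R) (f : X -> X) : Prop :=
  forall A : set Gamma, measurable A ->
    (mu A = 0%E <->
     mu [set eta : Gamma | exists2 eta' : Gamma, A eta' & cpts eta' = f @` cpts eta] = 0%E).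

Definition hypH (mu : probability Gamma R) : Prop :=
  [/\ {ae mu, forall eta : Gamma, forall x : X, (npts (cpts eta) [set x] <= 1)%E},
      mu [set eta : Gamma | (npts (cpts eta) setT < +oo)%E] = 1%E \/
      mu [set eta : Gamma | npts (cpts eta) setT = +oo%E] = 1%E &
      forall v : X -> X, smooth v -> compact_support v ->
      forall V : R -> X -> X, is_flow v V ->
      forall t : R, quasi_invariant mu (V t)].

Definition pcouplings (eta1 eta2 : set X) : set (set (X * X)) :=
  [set beta | (forall K1 K2 : set X, compact K1 -> compact K2 ->
                 finite_set (beta `&` (K1 `*` K2))) /\
              (forall A : set X, borelX A ->
                 npts beta (A `*` setT) = npts eta1 A /\
                 npts beta (setT `*` A) = npts eta2 A)].

Definition cost (eta1 eta2 : Gamma) : \bar R :=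
  ereal_inf [set (\esum_(p in beta) (sqnorm (p.1 - p.2) / 2)%:E)%E
            | beta in pcouplings (cpts eta1) (cpts eta2)].

Definition couplings (mu nu : probability Gamma R) :
    set (probability (Gamma * Gamma)%type R) :=
  [set g | forall A : set Gamma, measurable A ->
             g [set z | A z.1] = mu A /\ g [set z | A z.2] = nu A].

Definition mk_cost (g : probability (Gamma * Gamma)%type R) : \bar R :=
  (\int[g]_z cost z.1 z.2)%E.

Definition optimal (mu nu : probability Gamma R)
    (g : probability (Gamma * Gamma)%type R) : Prop :=
  couplings mu nu g /\
  forall g', couplings mu nu g' -> (mk_cost g <= mk_cost g')%E.

Definition graph_image (mu : probability Gamma R) (T : Gamma -> Gamma)
    (g : probability (Gamma * Gamma)%type R) : Prop :=
  forall S : set (Gamma * Gamma), measurable S ->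
    g S = mu [set eta | S (eta, T eta)].

End ConfigurationSpace.

(* Main.v *)
Require Import Defs.
From HB Require Import structures.
From mathcomp Require Import all_boot all_order all_algebra.
From mathcomp Require Import all_classical all_reals all_analysis.
From mathcomp Require Import measurable_realfun.
From mathcomp Require Import ring lra.
Import Order.TTheory GRing.Theory Num.Theory.
Import numFieldNormedType.Exports.
(** Optimal couplings exist because every ultrafilter limit of couplings, taken on the countably
    many box counts, is again a coupling, and because the cost is lower semicontinuous for this
    convergence.

    An optimal coupling is carried by a graph. Suppose that, with positive probability, the
    partner of the only point in a box [b] is not a function of the first configuration. Then
    for some coordinate [j] and levels [a < c], the first marginals of the restrictions of the
    coupling to {partner at level >= c} and to {partner at level <= a} charge a common set [A].
    Flows of vector fields supported in [b] and directed along [e_j] preserve the null sets of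
    [mu]; since uncountably many of their images of [A] cannot be almost disjoint, some positive
    time of the flow moves a part of [A] into [A]. Moving first configurations forward on the
    first event and backward on the second one, with equal masses, keeps both marginals and
    strictly decreases the cost, because the quadratic part of the change only depends on the
    first configuration and hence cancels: a contradiction. The average of two optimal couplings
    is optimal and carried by a graph, which gives uniqueness. *)

Set Implicit Arguments.
Unset Strict Implicit.
Unset Printing Implicit Defensive.

Local Open Scope classical_set_scope.
Local Open Scope ring_scope.

(** * Point counts and boxes *)

(** An optimal matching of two configurations need not be unique, and none is ever selected
    measurably. What is measurable is [costZ Z], the cost of matchings confined to a closed set [Z],
    because it is lower semicontinuous. The event [tight] thus says that some optimal matching obeys
    a constraint, and only such events enter the swap; the partner becomes a function of the first
    configuration at the very end, rebuilt from rational levels. Convergence and measurability are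
    both reduced to digits: does a given rational box contain exactly [m] points? Functions of
    finitely many digits are step functions, and word probabilities always have limits along an
    ultrafilter. The danger is that the limit law charges digit sequences that code no
    configuration; it is excluded because all couplings have the same two marginals. The vector
    fields are built so that their flows have a closed form, which avoids any existence theorem for
    differential equations. *)

Section PointCounts.
Variables (R : realType) (T : choiceType).
Implicit Types (S B : set T) (m : nat).

(** Counts with values in the extended reals are handled through finite lists of points: lists of
    indices range over a countable type, so that they lead to countable unions of measurable
    sets. *)
Definition has_pts m S : Prop :=
  exists s : seq T, [/\ uniq s, size s = m & forall x, x \in s -> S x].

Lemma has_pts0 S : has_pts 0 S.
Proof. by exists [::]. Qed.

Lemma has_pts_le m n S : (m <= n)%N -> has_pts n S -> has_pts m S.
Proof.
move=> mn [s [us ss sS]]; exists (take m s); split.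
- exact: take_uniq.
- by rewrite size_takel// ss.
- by move=> x /mem_take; exact: sS.
Qed.

Lemma has_pts1 S : has_pts 1 S <-> S !=set0.
Proof.
split=> [[[|x s] [_ //= _ sS]]|[x Sx]].
  by exists x; apply: sS; rewrite mem_head.
by exists [:: x]; split=> // y; rewrite inE => /eqP ->.
Qed.

Lemma has_pts2 S : has_pts 2 S <-> exists x y, [/\ S x, S y & x <> y].
Proof.
split=> [[[|x [|y s]] [//= + _ sS]]|[x [y [Sx Sy xy]]]].
  rewrite !inE negb_or -andbA => /and3P[/eqP xy _ _]; exists x, y; split=> //.
    by apply: sS; rewrite mem_head.
  by apply: sS; rewrite !inE eqxx orbT.
exists [:: x; y]; split=> //=; first by rewrite inE andbT; exact/eqP.
by move=> z; rewrite !inE => /orP[] /eqP ->.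
Qed.

Lemma fsum1E (s : seq T) : uniq s ->
  (\sum_(x \in [set` s]) (1 : \bar R))%E = (size s)%:R%:E.
Proof.
move=> us; rewrite -fsbig_seq//= sumEFin; congr EFin.
by rewrite big_const_seq count_predT iter_addr_0.
Qed.

Lemma npts_sup S B :
  npts R S B = ereal_sup [set (m%:R : R)%:E | m in [set m | has_pts m (S `&` B)]].
Proof.
rewrite /npts /esum; congr ereal_sup; apply/seteqP; split=> x /=.
- case=> A [finA AS] <-; exists (size (finmap.enum_fset (fset_set A))); last first.
    by rewrite -fsum1E ?finmap.fset_uniq// -[in RHS](fset_setK finA).
  exists (finmap.enum_fset (fset_set A)); split=> //.
  by move=> y; rewrite in_fset_set// inE => /AS.
- case=> m [s [us <- sS]] <-; exists [set` s]; last by rewrite fsum1E.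
  by split=> //; exact: finite_seq.
Qed.

Lemma npts_ge m S B : ((m%:R : R)%:E <= npts R S B)%E <-> has_pts m (S `&` B).
Proof.
split; last by move=> h; rewrite npts_sup; apply: ereal_sup_ubound; exists m.
apply: contraPP => nh; apply/negP; rewrite -ltNge npts_sup.
case: m nh => [/(_ (has_pts0 _))//|m nh].
apply: (@le_lt_trans _ _ (m%:R : R)%:E); last by rewrite lte_fin ltr_nat.
apply: ge_ereal_sup => _ [n /= hn <-]; rewrite lee_fin ler_nat leqNgt.
by apply/negP => mn; apply: nh; exact: has_pts_le hn.
Qed.

Lemma npts_pinfty S B :
  npts R S B = +oo%E <-> forall m, has_pts m (S `&` B).
Proof.
split=> [h m|h]; first by apply/npts_ge; rewrite h leey.
apply/eqyP => A A0.
apply: (@le_trans _ _ ((Num.truncn A).+1%:R%:E)); last exact/npts_ge.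
by rewrite lee_fin; exact/ltW/truncnS_gt.
Qed.

Lemma npts_natP m S B : npts R S B = (m%:R : R)%:E <->
  has_pts m (S `&` B) /\ ~ has_pts m.+1 (S `&` B).
Proof.
split=> [h|[/npts_ge h1 h2]].
  split; first by apply/npts_ge; rewrite h.
  by move/(npts_ge _ _ _) => /=; rewrite h lee_fin ler_nat ltnn.
apply/eqP; rewrite eq_le h1 andbT npts_sup.
apply: ge_ereal_sup => _ [n /= hn <-]; rewrite lee_fin ler_nat leqNgt.
by apply/negP => mn; apply: h2; exact: has_pts_le hn.
Qed.

Lemma npts_cases S B :
  (exists m, npts R S B = (m%:R : R)%:E) \/ npts R S B = +oo%E.
Proof.
have [h|/existsNP[m0 hm0]] := pselect (forall m, has_pts m (S `&` B)).
  by right; apply/npts_pinfty.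
left; have ex : exists m, ~~ `[< has_pts m (S `&` B) >].
  by exists m0; apply/negP => /asboolP.
case: (ex_minnP ex) => -[/negP[]|m /negP hm min]; first exact/asboolP/has_pts0.
exists m; apply/npts_natP; split; last by move=> h; apply: hm; apply/asboolP.
by apply: contrapT => h; have /asboolPn/min := h; rewrite ltnn.
Qed.

Lemma npts0P S B : npts R S B = (0%:R : R)%:E <-> S `&` B = set0.
Proof.
rewrite npts_natP has_pts1; split=> [[_ /nonemptyPn]//|->].
by split; [exact: has_pts0|case].
Qed.

Lemma npts1P S B : npts R S B = (1%:R : R)%:E <-> exists x, S `&` B = [set x].
Proof.
rewrite npts_natP has_pts1 has_pts2; split=> [[[x Sx] h]|[x ->]].
  exists x; apply/seteqP; split=> [y Sy|_ ->//] /=.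
  by apply: contrapT => yx; apply: h; exists y, x.
by split; [exists x|move=> [y [z [/= -> ->]]]].
Qed.

End PointCounts.


(** Rational corners make the family of boxes countable. Nothing forces the first corner below the
    second one, so a box may be empty; the flows take [b.1 i < b.2 i] as a hypothesis. *)
Definition bidx (k : nat) : countType :=
  ({ffun 'I_k -> rat} * {ffun 'I_k -> rat})%type.

Section Boxes.
Variables (R : realType) (k : nat).
Local Notation X := (X R k).
Implicit Types (b : bidx k) (x : X) (S U : set X).

Definition box b : set X :=
  [set x | forall j, ratr (b.1 j) < x ord0 j < ratr (b.2 j)].

Lemma box_nbhs b x : box b x -> nbhs x (box b).
Proof.
move=> bx; exists (fun _ j => [set y : R | ratr (b.1 j) < y < ratr (b.2 j)]) => /=.
  move=> i j; rewrite !ord1; have /andP[lx xr] := bx j.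
  by near=> y; apply/andP; split; near: y; [exact: lt_nbhsr|exact: lt_nbhsl].
by move=> y h j; exact: h.
Unshelve. all: end_near. Qed.

Lemma box_open b : open (box b).
Proof. by rewrite openE => x /box_nbhs. Qed.

Lemma box_borel b : borelX (box b).
Proof. by apply: sub_sigma_algebra; exact: box_open. Qed.

Lemma itv_rat_nbhs (y : R) (P : set R) : nbhs y P ->
  exists q : rat * rat, ratr q.1 < y < ratr q.2 /\
    forall z, ratr q.1 < z < ratr q.2 -> P z.
Proof.
move=> /nbhs_ballP[e /= e0 yP].
have /rat_in_itvoo[l] : y - e < y by rewrite ltrBlDr ltrDl.
have /rat_in_itvoo[r] : y < y + e by rewrite ltrDl.
rewrite !in_itv /= => /andP[yr re] /andP[el ly].
exists (l, r) => /=; split; first by rewrite ly yr.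
move=> z /andP[lz zr]; apply: yP; rewrite /ball/= ltr_norml.
by apply/andP; split; lra.
Qed.

Lemma box_basis x U : nbhs x U -> exists b, box b x /\ box b `<=` U.
Proof.
case=> P Px PU.
have /choice[f fP] : forall j, exists q : rat * rat,
    ratr q.1 < x ord0 j < ratr q.2 /\
    forall z, ratr q.1 < z < ratr q.2 -> P ord0 j z.
  by move=> j; exact: itv_rat_nbhs.
exists ([ffun j => (f j).1], [ffun j => (f j).2]); split.
  by move=> j; rewrite !ffunE; have [] := fP j.
move=> y by_; apply: PU => i j; rewrite ord1.
by have [_] := fP j; apply; have := by_ j; rewrite !ffunE.
Qed.

Lemma open_bigcup_box U : open U ->
  U = \bigcup_(b in [set b | box b `<=` U]) box b.
Proof.
move=> oU; apply/seteqP; split=> x; last by case=> b bU /bU.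
by move=> Ux; have [b [bx bU]] := box_basis (open_nbhs_nbhs (conj oU Ux)); exists b.
Qed.

Definition cbox b : set X :=
  [set x | forall j, ratr (b.1 j) <= x ord0 j <= ratr (b.2 j)].

Lemma cbox_compact b : compact (cbox b).
Proof.
pose A (j : 'I_k) := `[ratr (b.1 j) : R, ratr (b.2 j)]%classic.
suff -> : cbox b = [set v : 'rV[R]_k | forall j, A j (v ord0 j)].
  by apply: rV_compact => j; exact: segment_compact.
by apply/seteqP; split=> x h j; have := h j; rewrite /A /= in_itv.
Qed.

Lemma box_sub_cbox b : box b `<=` cbox b.
Proof. by move=> x bx j; have /andP[/ltW -> /ltW ->] := bx j. Qed.

Lemma locfin_cbox S b : locfin S -> finite_set (S `&` cbox b).
Proof. by apply; exact: cbox_compact. Qed.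

Lemma X_hausdorff : hausdorff_space X.
Proof. exact: norm_hausdorff. Qed.

(** A closed box holds finitely many points of [S], and finite sets are closed, so the points other
    than [x] can be kept out of a smaller box. *)
Lemma locfin_nbhs S x U : locfin S -> nbhs x U ->
  exists b, [/\ box b x, box b `<=` U & S `&` box b `<=` [set x]].
Proof.
move=> Sf Ux; have [b0 [b0x b0U]] := box_basis Ux.
pose F := (S `&` cbox b0) `\ x.
have oF : open (~` F).
  apply: closed_openC; have /accessible_finite_set_closed := hausdorff_accessible X_hausdorff.
  by apply; exact/finite_setD/locfin_cbox.
have nF : nbhs x (~` F) by apply: open_nbhs_nbhs; split=> // -[_]; apply.
have [b [bx bU]] := box_basis (filterI nF (box_nbhs b0x)).
exists b; split=> //; first by move=> y /bU[_ /b0U].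
move=> y [Sy /bU[nFy b0y]] /=; apply: contrapT => yx; apply: nFy.
by split=> //; split=> //; exact: box_sub_cbox.
Qed.

Lemma locfin_iso S x U : locfin S -> S x -> nbhs x U ->
  exists b, [/\ box b x, box b `<=` U & S `&` box b = [set x]].
Proof.
move=> Sf Sx Ux; have [b [bx bU Sb]] := locfin_nbhs Sf Ux.
by exists b; split=> //; apply/seteqP; split=> // _ ->.
Qed.

Lemma locfin_out S x U : locfin S -> ~ S x -> nbhs x U ->
  exists b, [/\ box b x, box b `<=` U & S `&` box b = set0].
Proof.
move=> Sf Sx Ux; have [b [bx bU Sb]] := locfin_nbhs Sf Ux.
exists b; split=> //; apply/seteqP; split=> // y [Sy by_].
by apply: Sx; rewrite -(Sb y).
Qed.

End Boxes.


Lemma fmap_ultra (S T : Type) (f : S -> T) (F : set_system S) :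
  UltraFilter F -> UltraFilter (f @ F).
Proof.
move=> FU; split; first exact: fmap_proper_filter.
move=> G GF FG; apply/seteqP; split=> A; last exact: FG.
move=> GA; have [//|FnA] := in_ultra_setVsetC (f @^-1` A) FU.
have /FG GnA : (f @ F) (~` A) by [].
by have /filter_ex[? []] : G (A `&` ~` A) by exact: filterI.
Qed.

Lemma filter_seq (S : eqType) (T : Type) (F : set_system T) (s : seq S)
    (P : S -> T -> Prop) : Filter F ->
  (forall i, i \in s -> F (P i)) -> F [set t | forall i, i \in s -> P i t].
Proof.
move=> FF; elim: s => [_|a s IHs h]; first exact: filterS filterT.
have h1 := h a (mem_head _ _).
have h2 : F [set t | forall i, i \in s -> P i t].
  by apply: IHs => i si; apply: h; rewrite inE si orbT.
apply: filterS (filterI h1 h2) => t [/= Pa Ps] i; rewrite inE.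
by case/orP => [/eqP ->//|]; exact: Ps.
Qed.

(** * The cost as a minimum over matchings *)

Section Matchings.
Variables (R : realType) (k : nat).
Local Notation X := (X R k).
Implicit Types (b : set (X * X)) (e o : config R k).

(** Configurations carry no multiplicities, so a coupling of two counting measures is the graph of a
    bijection. This combinatorial form is the one on which limits and moves of a single point
    act. *)
Definition matching (S S' : set X) b : Prop :=
  [/\ forall p, b p -> S p.1 /\ S' p.2,
      forall x, S x -> exists y, b (x, y),
      forall y, S' y -> exists x, b (x, y),
      forall x y y', b (x, y) -> b (x, y') -> y = y' &
      forall x x' y, b (x, y) -> b (x', y) -> x = x'].

Definition swapX (p : X * X) := (p.2, p.1).

Lemma matchingC S S' b : matching S S' b -> matching S' S (swapX @^-1` b).
Proof.
case=> h1 h2 h3 h4 h5; split.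
- by move=> [x y] /h1[].
- by move=> x /h3.
- by move=> y /h2.
- by move=> x y y'; exact: h5.
- by move=> x x' y; exact: h4.
Qed.

Lemma borelX1 x : borelX [set x : X].
Proof.
rewrite -[X in borelX X]setCK -setTD; apply: sigma_algebraCD.
apply: sub_sigma_algebra; apply: closed_openC.
have /accessible_finite_set_closed := hausdorff_accessible (@X_hausdorff R k).
move=> acc; apply: acc; exact: finite_set1.
Qed.

Lemma finite_functional (S K1 : set X) b : finite_set (S `&` K1) ->
  (forall p, b p -> S p.1) ->
  (forall x y y', b (x, y) -> b (x, y') -> y = y') ->
  finite_set [set p | b p /\ K1 p.1].
Proof.
move=> fS bS bfun.
apply: (@sub_finite_set _ _ ((fun x => (x, xget 0 [set y | b (x, y)])) @` (S `&` K1))).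
  move=> [x y] [/= bxy K1x]; exists x; first by split=> //; exact: (bS _ bxy).
  have bx : b (x, xget 0 [set y | b (x, y)]) by apply: (@xgetPex _ 0 [set y | b (x, y)]); exists y.
  by rewrite (bfun _ _ _ bxy bx).
exact: finite_image.
Qed.

(** Testing the marginals on singletons is enough: at least one pair over each point gives totality,
    never two gives functionality. Conversely, both projections are injective on a matching and
    reindex the sums. *)
Lemma pcouplingsP e o b : pcouplings e o b <-> matching e o b.
Proof.
split=> [[_ h]|[h1 h2 h3 h4 h5]]; last split.
- have hx m x : has_pts m (b `&` ([set x] `*` setT)) <-> has_pts m (e `&` [set x]).
    by have [+ _] := h _ (borelX1 x); rewrite -!(npts_ge R) => ->.
  have hy m y : has_pts m (b `&` (setT `*` [set y])) <-> has_pts m (o `&` [set y]).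
    by have [_ +] := h _ (borelX1 y); rewrite -!(npts_ge R) => ->.
  split.
  + move=> [x y] bxy; split.
      suff /has_pts1[z []] : has_pts 1 (e `&` [set x]) by move=> + /= zx; rewrite zx.
      by apply/hx/has_pts1; exists (x, y).
    suff /has_pts1[z []] : has_pts 1 (o `&` [set y]) by move=> + /= zx; rewrite zx.
    by apply/hy/has_pts1; exists (x, y).
  + move=> x ex; have /hx/has_pts1 : has_pts 1 (e `&` [set x]) by apply/has_pts1; exists x.
    by move=> [[x' y] [bxy [/= <- _]]]; exists y.
  + move=> y oy; have /hy/has_pts1 : has_pts 1 (o `&` [set y]) by apply/has_pts1; exists y.
    by move=> [[x y'] [bxy [_ /= <-]]]; exists x.
  + move=> x y y' bxy bxy'; apply: contrapT => yy'.
    have /hx/has_pts2 : has_pts 2 (b `&` ([set x] `*` setT)).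
      by apply/has_pts2; exists (x, y), (x, y'); split=> // -[].
    by move=> [u [v [[_ /= ->] [_ /= ->]]]].
  + move=> x x' y bxy bxy'; apply: contrapT => yy'.
    have /hy/has_pts2 : has_pts 2 (b `&` (setT `*` [set y])).
      by apply/has_pts2; exists (x, y), (x', y); split=> // -[].
    by move=> [u [v [[_ /= ->] [_ /= ->]]]].
- move=> K1 K2 cK1 cK2.
  apply: (@sub_finite_set _ _ [set p | b p /\ K1 p.1]); first by move=> p [? []].
  apply: (@finite_functional e) => //; first exact: cpts_locfin.
  by move=> p /h1[].
- move=> A _; split; apply: esym; rewrite /npts.
  + rewrite (@reindex_esum R _ _ (b `&` (A `*` setT)) (e `&` A) fst)//; split.
    * by move=> [x y] [/h1[ex _] [/= Ax _]].
    * by move=> [x y] [x' y'] /set_mem[bxy _] /set_mem[bxy' _] /= xx'; subst x';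
         rewrite (h4 _ _ _ bxy bxy').
    * by move=> x [/h2[y bxy] Ax]; exists (x, y).
  + rewrite (@reindex_esum R _ _ (b `&` (setT `*` A)) (o `&` A) snd)//; split.
    * by move=> [x y] [/h1[_ oy] [_ /= Ay]].
    * by move=> [x y] [x' y'] /set_mem[bxy _] /set_mem[bxy' _] /= xx'; subst y';
         rewrite (h5 _ _ _ bxy bxy').
    * by move=> y [/h3[x bxy] Ay]; exists (x, y).
Qed.

Definition pcost (p : X * X) : R := sqnorm (p.1 - p.2) / 2.

Definition tcost b : \bar R := (\esum_(p in b) (pcost p)%:E)%E.

Lemma sqnorm_ge0 (x : X) : 0 <= sqnorm x.
Proof. by apply: sumr_ge0 => j _; exact: sqr_ge0. Qed.

Lemma pcost_ge0 p : 0 <= pcost p.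
Proof. by rewrite divr_ge0// sqnorm_ge0. Qed.

Lemma tcost_ge0 b : (0 <= tcost b)%E.
Proof. by apply: esum_ge0 => p _; rewrite lee_fin pcost_ge0. Qed.

Lemma pcostC p : pcost (swapX p) = pcost p.
Proof.
rewrite /pcost /sqnorm; congr (_ / _); apply: eq_bigr => j _.
by rewrite !mxE -sqrrN opprB.
Qed.

Lemma tcost_ge_seq b (s : seq (X * X)) : uniq s -> (forall p, p \in s -> b p) ->
  ((\sum_(p <- s) pcost p)%:E <= tcost b)%E.
Proof.
move=> us sb; apply: esum_ge; exists [set` s]; first by split=> //; exact: finite_seq.
by rewrite -fsbig_seq//= sumEFin.
Qed.

Lemma tcost_ge b p : b p -> ((pcost p)%:E <= tcost b)%E.
Proof.
move=> bp; rewrite -[pcost p](big_seq1 +%R p pcost).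
by apply: tcost_ge_seq => // q; rewrite inE => /eqP ->.
Qed.

Lemma tcost_le b (q : \bar R) :
  (forall s : seq (X * X), uniq s -> (forall p, p \in s -> b p) ->
     ((\sum_(p <- s) pcost p)%:E <= q)%E) -> (tcost b <= q)%E.
Proof.
move=> h; apply: ge_ereal_sup => _ [A [fA Ab] <-].
rewrite fsbig_finite//= sumEFin; apply: h; first exact: finmap.fset_uniq.
by move=> p; rewrite in_fset_set// inE => /Ab.
Qed.

Lemma coord_cost (x y : X) j : (x ord0 j - y ord0 j) ^+ 2 <= 2 * pcost (x, y).
Proof.
rewrite /pcost mulrC divfK// /sqnorm/= (bigD1 j)//= !mxE lerDl.
by apply: sumr_ge0 => i _; exact: sqr_ge0.
Qed.

(** Confining the pairs to [Z] replaces a measurable choice of an optimal matching: comparing this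
    value with the cost tells whether some optimal matching stays in [Z]. *)
Definition costZ (Z : set (X * X)) (e o : config R k) : \bar R :=
  ereal_inf [set tcost b | b in [set b | matching e o b /\ b `<=` Z]].

Lemma costE e o : cost e o = costZ setT e o.
Proof.
rewrite /cost /costZ; congr ereal_inf; apply/seteqP; split=> _ [b + <-].
  by move=> /pcouplingsP mb; exists b.
by move=> [mb _]; exists b => //; apply/pcouplingsP.
Qed.

Lemma costZ_ge0 Z e o : (0 <= costZ Z e o)%E.
Proof. by apply: le_ereal_inf_tmp => _ [b _ <-]; exact: tcost_ge0. Qed.

Lemma cost_ge0 e o : (0 <= cost e o)%E.
Proof. by rewrite costE costZ_ge0. Qed.

Lemma costZ_le Z e o b : matching e o b -> b `<=` Z -> (costZ Z e o <= tcost b)%E.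
Proof. by move=> mb bZ; apply: ereal_inf_lbound; exists b. Qed.

Lemma cost_le e o b : matching e o b -> (cost e o <= tcost b)%E.
Proof. by move=> mb; rewrite costE; apply: costZ_le. Qed.

End Matchings.


(** * Limits of matchings along an ultrafilter *)

Section VagueLimits.
Variables (R : realType) (k : nat).
Local Notation X := (X R k).
Implicit Types (e o : config R k).

Lemma X_separate (x y : X) : x <> y ->
  exists A B : set X, [/\ nbhs x A, nbhs y B & forall z, A z -> B z -> False].
Proof.
move=> xy; apply: contrapT => nAB; apply: xy; apply: (@X_hausdorff R k) => A B Ax By.
apply: contrapT => /nonemptyPn AB0; apply: nAB; exists A, B; split=> // z Az Bz.
by have : (A `&` B) z by []; rewrite AB0.
Qed.

(** Convergence of all box counts, a zero-dimensional refinement of vague convergence. *)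
Definition box_cvg (e_ : nat -> config R k) e := forall b m,
  npts R e (box b) = m%:R%:E ->
  \forall n \near \oo, npts R (e_ n) (box b) = m%:R%:E.

Variable U : set_system nat.
Hypothesis UU : UltraFilter U.
Hypothesis oU : \oo `<=` U.

Lemma cvg_boxP (f : nat -> X) (x : X) :
  (forall b, box b x -> U [set n | box b (f n)]) <-> f @ U --> x.
Proof.
split=> [h A Ax|h b bx]; last by apply: h; exact: box_nbhs.
have [b [bx bA]] := box_basis Ax.
by apply: filterS (h b bx) => n /bA.
Qed.

Section Limit.
Variables (e_ o_ : nat -> config R k) (e o : config R k).
Variable b_ : nat -> set (X * X).
Hypothesis e_cvg : box_cvg e_ e.
Hypothesis o_cvg : box_cvg o_ o.
Hypothesis b_m : forall n, matching (e_ n) (o_ n) (b_ n).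
Variable M : R.
Hypothesis b_M : forall n p, b_ n p -> pcost p <= M.

(** The vague limit of the matchings [b_ n]: a pair survives when every product of boxes around it
    contains a pair of [b_ n] for [U]-many [n]. The ultrafilter does the work of a diagonal
    extraction. *)
Definition lim_rel : set (X * X) := [set p | [/\ cpts e p.1, cpts o p.2 &
  forall b b', box b p.1 -> box b' p.2 ->
    U [set n | exists q, [/\ b_ n q, box b q.1 & box b' q.2]]]].

Lemma box1_near b x : cpts e `&` box b = [set x] ->
  U [set n | exists x', cpts (e_ n) `&` box b = [set x']].
Proof.
move=> h; have /e_cvg/oU : npts R e (box b) = 1%:R%:E by apply/npts1P; exists x.
by apply: filterS => n /npts1P.
Qed.

(** A box isolating [x] contains exactly one point of [e_ n] for [U]-many [n]. Pairs of [b_ n] close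
    to [(x, y)] and to [(x, y')] then start at the same point, hence end at the same point, which
    cannot lie in two disjoint boxes. *)
Lemma lim_rel_fun x y y' : lim_rel (x, y) -> lim_rel (x, y') -> y = y'.
Proof.
move=> [/= ex oy h] [_ /= oy' h']; apply: contrapT => yy'.
have [b [bx _ eb]] := locfin_iso (@cpts_locfin _ _ e) ex filterT.
have /hausdorff_accessible/accessible_closed_set1 acc := @X_hausdorff R k.
have ny : nbhs y (~` [set y']).
  by apply: open_nbhs_nbhs; split=> //; exact: closed_openC.
have [c [cy _ oc]] := locfin_iso (@cpts_locfin _ _ o) oy ny.
have [c' [cy' cc' oc']] := locfin_iso (@cpts_locfin _ _ o) oy' filterT.
have [d [d' [dy dy' dd']]] : exists d d', [/\ box d y, box d' y' &
    forall z : X, box d z -> box d' z -> False].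
  have [A [B [Ay By' AB]]] := X_separate yy'.
  have [d [dy dA]] := box_basis Ay; have [d' [dy' dB]] := box_basis By'.
  by exists d, d'; split=> // z /dA Az /dB Bz; exact: (AB z).
have [n [[[[x1 y1] [/= b1 bx1 dy1]] [[x2 y2] [/= b2 bx2 dy2]]] [x' ex']]] :=
  filter_ex (filterI (filterI (h _ _ bx dy) (h' _ _ bx dy')) (box1_near eb)).
have [m1 _ _ m4 _] := b_m n.
have E1 : x1 = x' by have : [set x'] x1 by rewrite -ex'; split=> //; have [] := m1 _ b1.
have E2 : x2 = x' by have : [set x'] x2 by rewrite -ex'; split=> //; have [] := m1 _ b2.
by subst x1 x2; rewrite (m4 _ _ _ b2 b1) in dy2; exact: (dd' y1).
Qed.

(** [f n] is the pair of [b_ n] that starts at the only point of [e_ n] in a box isolating the first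
    point of [p]; functionality of [b_ n] forces its second point to be close to that of [p]. *)
Lemma lim_seq (p : X * X) : lim_rel p -> exists f : nat -> X * X,
  [/\ U [set n | b_ n (f n)], (fun n => (f n).1) @ U --> p.1 &
      (fun n => (f n).2) @ U --> p.2].
Proof.
case: p => x y [/= ex oy h].
have [b0 [b0x _ eb0]] := locfin_iso (@cpts_locfin _ _ e) ex filterT.
have /choice[f fP] : forall n, exists q : X * X,
    (exists x', cpts (e_ n) `&` box b0 = [set x']) -> b_ n q /\ box b0 q.1.
  move=> n; have [[x' ex']|nh] := pselect (exists x', cpts (e_ n) `&` box b0 = [set x']).
    have [ex'n bx'] : (cpts (e_ n) `&` box b0) x' by rewrite ex'.
    have [_ /(_ _ ex'n)[y' bxy'] _ _ _] := b_m n.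
    by exists (x', y').
  by exists (x, y) => /nh.
have key b b' : box b x -> box b' y -> U [set n | box b (f n).1 /\ box b' (f n).2].
  move=> bx b'y.
  have [b1 [b1x b1b _]] := locfin_iso (@cpts_locfin _ _ e) ex
    (filterI (box_nbhs bx) (box_nbhs b0x)).
  apply: filterS (filterI (h _ _ b1x b'y) (box1_near eb0)) => n.
  move=> [[[x1 y1] [/= b1n /b1b[bx1 b0x1] b'y1]] [x' ex']].
  have [bfn b0fn] := fP n (ex_intro _ _ ex').
  have [m1 _ _ m4 _] := b_m n.
  have E1 : x1 = x' by have : [set x'] x1 by rewrite -ex'; split=> //; have [] := m1 _ b1n.
  have E2 : (f n).1 = x'.
    by have : [set x'] (f n).1 by rewrite -ex'; split=> //; have [] := m1 _ bfn.
  move: bfn b0fn E2; case: (f n) => u v /= bfn _ E2; subst u x1.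
  by rewrite (m4 _ _ _ bfn b1n).
exists f; split.
- by apply: filterS (box1_near eb0) => n /fP[].
- apply/cvg_boxP => b bx.
  have [b' [b'y _]] := box_basis (@filterT _ (nbhs y) _).
  by apply: filterS (key _ _ bx b'y) => n [].
- by apply/cvg_boxP => b' b'y; apply: filterS (key _ _ b0x b'y) => n [].
Qed.

(** The bound [M] on the cost of a pair keeps the partners of the points near [x] in a compact box,
    so they have a limit [y] along [U]. If [y] were not in [o], a box around it would be empty for
    [o], hence for [o_ n]. *)
Lemma lim_rel_total x : cpts e x -> exists y, lim_rel (x, y).
Proof.
move=> ex.
have [b0 [b0x _ eb0]] := locfin_iso (@cpts_locfin _ _ e) ex filterT.
have /choice[f fP] : forall n, exists q : X * X,
    (exists x', cpts (e_ n) `&` box b0 = [set x']) -> b_ n q /\ box b0 q.1.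
  move=> n; have [[x' ex']|nh] := pselect (exists x', cpts (e_ n) `&` box b0 = [set x']).
    have [ex'n bx'] : (cpts (e_ n) `&` box b0) x' by rewrite ex'.
    have [_ /(_ _ ex'n)[y' bxy'] _ _ _] := b_m n.
    by exists (x', y').
  by exists (x, x) => /nh.
(* Each squared coordinate difference is at most [2 * M < T] with [T = N - 1] a positive integer,
   and [T < (T + 1) ^+ 2], so the partner stays within [N] of the box. A rational margin keeps the
   corners rational. *)
pose N : rat := (Num.truncn (2 * M)).+1%:R + 1.
pose K : bidx k := ([ffun j => b0.1 j - N], [ffun j => b0.2 j + N]).
have UK : U [set n | cbox K (f n).2].
  apply: filterS (box1_near eb0) => n /fP[/b_M cM b0f] j; rewrite !ffunE.
  have := coord_cost (f n).1 (f n).2 j; rewrite -surjective_pairing.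
  have /andP[] := b0f j.
  rewrite rmorphB rmorphD /= /N rmorphD /= ratr_nat rmorph1.
  have := truncnS_gt (2 * M); set T : R := (Num.truncn _).+1%:R.
  set u := (f n).1 ord0 j; set v := (f n).2 ord0 j.
  move=> TM lu ur uv.
  have uvT : (u - v) ^+ 2 <= T by rewrite (le_trans uv)// (le_trans _ (ltW TM))// ler_pM2l.
  have T0 : 0 <= T by rewrite ler0n.
  suff /ltr_normlP[] : `|u - v| < T + 1.
    by move=> *; apply/andP; split; lra.
  rewrite ltNge; apply/negP => h.
  have : (T + 1) ^+ 2 <= `|u - v| ^+ 2 by rewrite lerXn2r ?nnegrE//; lra.
  by rewrite real_normK ?num_real// expr2; nra.
have UF := fmap_ultra (fun n => (f n).2) UU.
have : compact (cbox K : set X) by exact: cbox_compact.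
rewrite compact_ultra => /(_ _ UF UK)[y [_ yP]].
have fy := (cvg_boxP _ _).2 yP.
have m1 n := let: And5 h _ _ _ _ := b_m n in h.
exists y; split=> //=.
  apply: contrapT => noy.
  have [b' [b'y _ ob']] := locfin_out (@cpts_locfin _ _ o) noy filterT.
  have /o_cvg/oU ob0 : npts R o (box b') = 0%:R%:E by apply/npts0P.
  have [n [[/fP[/m1[_ oy'] _] b'n] /npts0P on0]] :=
    filter_ex (filterI (filterI (box1_near eb0) (fy _ b'y)) ob0).
  by have : (cpts (o_ n) `&` box b') (f n).2 by []; rewrite on0.
move=> b b' bx b'y.
have [b1 [b1x b1b eb1]] := locfin_iso (@cpts_locfin _ _ e) ex
  (filterI (box_nbhs bx) (box_nbhs b0x)).
apply: filterS (filterI (filterI (box1_near eb0) (box1_near eb1)) (fy _ b'y)) => n.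
move=> [[[x' ex'] [x1 ex1]] b'n]; exists (f n); split=> //.
  by have [] := fP n (ex_intro _ _ ex').
have [ex1n /b1b[bx1 b0x1]] : (cpts (e_ n) `&` box b1) x1 by rewrite ex1.
have [/m1[exf _] b0f] := fP n (ex_intro _ _ ex').
have <- // : x1 = (f n).1.
have -> : x1 = x' by have : [set x'] x1 by rewrite -ex'.
by have : [set x'] (f n).1 by rewrite -ex'.
Qed.

End Limit.

Lemma lim_relC (e_ o_ : nat -> config R k) e o b_ x y :
  (forall n, matching (e_ n) (o_ n) (b_ n)) ->
  lim_rel e o b_ (x, y) -> lim_rel o e (fun n => swapX (k := k) @^-1` b_ n) (y, x).
Proof.
move=> bm [/= ex oy h]; split=> //= b b' bx b'y.
apply: filterS (h _ _ b'y bx) => n [[u v] [/= bn ? ?]].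
by exists (v, u); split.
Qed.



(** Totality and functionality were shown on one side; exchanging the two configurations gives
    surjectivity and injectivity. *)
Lemma lim_rel_matching (e_ o_ : nat -> config R k) e o b_ (M : R) :
  box_cvg e_ e -> box_cvg o_ o ->
  (forall n, matching (e_ n) (o_ n) (b_ n)) ->
  (forall n p, b_ n p -> pcost p <= M) ->
  matching e o (lim_rel e o b_).
Proof.
move=> ec oc bm bM.
have bm' n := matchingC (bm n).
have bM' n p : (swapX (k := k) @^-1` b_ n) p -> pcost p <= M.
  by rewrite -pcostC; exact: bM.
split.
- by move=> p [].
- by move=> x ex; exact: (lim_rel_total ec oc bm bM).
- move=> y oy; have [x xy] := lim_rel_total oc ec bm' bM' oy.
  exists x; have := lim_relC bm' xy.
  by congr (lim_rel _ _ _ _); apply/funext => n; apply/seteqP; split=> -[].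
- by move=> x y y'; exact: (lim_rel_fun ec bm).
- move=> x x' y xy x'y.
  exact: (lim_rel_fun oc bm' (lim_relC bm xy) (lim_relC bm x'y)).
Qed.

Lemma cvg_pcost (f : nat -> X * X) (p : X * X) :
  (fun n => (f n).1) @ U --> p.1 -> (fun n => (f n).2) @ U --> p.2 ->
  (fun n => pcost (f n)) @ U --> pcost p.
Proof.
move=> f1 f2; apply: cvgMl; apply: (@cvg_big _ _ +%R 0 xpredT add_continuous _ _ _ (fun j n => ((f n).1 - (f n).2) ord0 j ^+ 2)).
move=> j _.
have h : (fun n => ((f n).1 - (f n).2) ord0 j) @ U --> (p.1 - p.2) ord0 j.
  apply: (@cvg_comp _ _ _ (fun n => (f n).1 - (f n).2) (fun z : X => z ord0 j) _ (nbhs (p.1 - p.2))).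
    exact: cvgB.
  exact: coord_continuous.
exact: cvgM.
Qed.

(** A Fatou argument: each finite partial sum of the limit is the limit of partial sums of the costs
    of [b_ n]. *)
Lemma lim_rel_cost (e_ o_ : nat -> config R k) e o b_ (q : R) :
  box_cvg e_ e -> (forall n, matching (e_ n) (o_ n) (b_ n)) ->
  (forall eps, 0 < eps -> U [set n | (tcost (b_ n) <= (q + eps)%:E)%E]) ->
  (tcost (lim_rel e o b_) <= q%:E)%E.
Proof.
move=> ec bm bq; apply: tcost_le => s us sb; rewrite lee_fin.
have /choice[f fP] : forall p : X * X, exists f : nat -> X * X, p \in s ->
  [/\ U [set n | b_ n (f n)], (fun n => (f n).1) @ U --> p.1 &
      (fun n => (f n).2) @ U --> p.2].
  move=> p; have [ps|nps] := boolP (p \in s); last by exists (fun=> p).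
  by have [f hf] := lim_seq ec bm (sb p ps); exists f.
have sumc : (fun n => \sum_(p <- s) pcost (f p n)) @ U --> \sum_(p <- s) pcost p.
  rewrite big_seq; under eq_fun do rewrite big_seq.
  apply: (@cvg_big _ _ +%R 0 (fun p => p \in s) add_continuous _ _ _ (fun p n => pcost (f p n))) => p ps; have [_ h1 h2] := fP p ps; exact: cvg_pcost.
(* Distinct limit pairs have distinct first points, so their approximations are distinct for
   [U]-many [n]; otherwise a pair of [b_ n] could be counted twice. *)
have inj : U [set n | forall i, i \in [seq (p, p') | p <- s, p' <- s] ->
    i.1 != i.2 -> f i.1 n != f i.2 n].
  apply: filter_seq => -[p p'] /allpairsP[[u v] [/= us' vs [-> ->]]].
  have [->|uv] := eqVneq u v; first by apply: filterS (@filterT _ U _) => n _ /eqP.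
  have [_ h1 h2] := fP u us'; have [_ h1' h2'] := fP v vs.
  have u1v1 : u.1 <> v.1.
    move=> E1; move: (sb u us') (sb v vs); rewrite [u]surjective_pairing [v]surjective_pairing -E1.
    move=> h h'; have E2 := lim_rel_fun ec bm h h'; move/eqP: uv; apply.
    by rewrite [u]surjective_pairing [v]surjective_pairing E1 E2.
  have [A [B [Au Bv AB]]] := X_separate u1v1.
  have UA : U [set n | A (f u n).1] by exact: h1.
  have UB : U [set n | B (f v n).1] by exact: h1'.
  apply: filterS (filterI UA UB) => n [/= An Bn] _.
  by apply/eqP => E; apply: (AB (f u n).1) => //; rewrite E.
apply/ler_addgt0Pr => eps eps0.
have PU : ProperFilter U by exact: ultra_proper.
apply: (cvgr_to_le sumc).
have bf : U [set n | forall p, p \in s -> b_ n (f p n)].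
  by apply: filter_seq => p ps; have [] := fP p ps.
apply: filterS (filterI (filterI bf inj) (bq _ eps0)) => n [[/= bfn injn] bqn].
rewrite -lee_fin (le_trans _ bqn)//.
rewrite -(big_map (fun p => f p n) xpredT (@pcost R k)).
apply: tcost_ge_seq; last by move=> _ /mapP[p ps ->]; exact: bfn.
rewrite map_inj_in_uniq// => p p' ps p's /eqP fpp'; apply/eqP.
apply: contraLR fpp' => pp'; apply: (injn (p, p')) => //.
by apply/allpairsP; exists (p, p').
Qed.

End VagueLimits.


Lemma bigcup_measurable_count d (T : sigmaRingType d) (I : countType) (P : set I)
    (F : I -> set T) :
  (forall i, P i -> measurable (F i)) -> measurable (\bigcup_(i in P) F i).
Proof.
move=> mF; rewrite bigcup_mkcond; apply: countable_bigcupT_measurable.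
  exact: countableP.
by move=> i; case: ifPn => [/set_mem/mF//|_]; exact: measurable0.
Qed.

Lemma bigcap_measurable_count d (T : measurableType d) (I : countType) (P : set I)
    (F : I -> set T) :
  (forall i, P i -> measurable (F i)) -> measurable (\bigcap_(i in P) F i).
Proof.
move=> mF; rewrite -[X in measurable X]setCK setC_bigcap; apply: measurableC.
by apply: bigcup_measurable_count => i Pi; exact/measurableC/mF.
Qed.

Lemma measurable_ereal_sup_count d (T : measurableType d) (R : realType)
    (I : countType) (f : I -> T -> \bar R) :
  (forall i, measurable_fun setT (f i)) ->
  measurable_fun setT (fun x => ereal_sup (range (f ^~ x))).
Proof.
move=> mf; apply: (measurability _ (ErealGenOInfty.measurableE R)) => //.
move=> _ [_ [a ->] <-]; rewrite setTI.
rewrite (_ : _ @^-1` _ = \bigcup_(i in setT) (f i @^-1` `]a%:E, +oo[)).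
  apply: bigcup_measurable_count => i _; rewrite -[X in measurable X]setTI.
  by apply: mf => //; exact: emeasurable_itv.
apply/seteqP; split=> x /=; rewrite in_itv /= andbT.
  by move=> /ereal_sup_gt[_ [i _ <-] ai]; exists i => //=; rewrite in_itv /= andbT.
move=> [i _ /=]; rewrite in_itv /= andbT => /lt_le_trans; apply.
by apply: ereal_sup_ubound; exists i.
Qed.

Section Words.
Variables (T : Type) (D : nat -> T -> bool).
Implicit Types t : T.

Definition dword (N : nat) t : seq bool := mkseq (D^~ t) N.

Lemma dwordS N t : dword N.+1 t = rcons (dword N t) (D N t).
Proof. by rewrite /dword mkseqS. Qed.

Lemma size_dword N t : size (dword N t) = N.
Proof. exact: size_mkseq. Qed.

Lemma nth_dword N i t : (i < N)%N -> nth false (dword N t) i = D i t.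
Proof. exact: nth_mkseq. Qed.

Lemma dword_digit N i t t' : (i < N)%N -> dword N t = dword N t' -> D i t = D i t'.
Proof. by move=> iN tt'; rewrite -(nth_dword t iN) tt' nth_dword. Qed.

End Words.

Section MeasurableWords.
Context d (T : measurableType d) (D : nat -> T -> bool).
Hypothesis mD : forall n, measurable [set t | D n t].
Local Notation dword := (dword D).

Lemma measurable_dword N w : measurable [set t | dword N t = w].
Proof.
elim: N w => [|N IHN] w.
  have [->|w0] := eqVneq w [::].
    rewrite (_ : [set _ | _] = setT); first exact: measurableT.
    by apply/seteqP; split.
  rewrite (_ : [set _ | _] = set0); first exact: measurable0.
  by apply/seteqP; split=> // z zw; rewrite -zw eqxx in w0.
case/lastP: w => [|w a].
  rewrite (_ : [set _ | _] = set0); first exact: measurable0.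
  by apply/seteqP; split=> // z zw; have := size_dword D N.+1 z; rewrite zw.
have -> : [set t | dword N.+1 t = rcons w a] =
    [set t | dword N t = w] `&` (if a then [set t | D N t] else ~` [set t | D N t]).
  apply/seteqP; split=> z.
    move=> zw; have : rcons (dword N z) (D N z) = rcons w a by rewrite -dwordS.
    move=> /rcons_inj[<- <-]; split=> //.
    by case: ifP => [//|/negbT/negP].
  move=> [zw za]; suff : rcons (dword N z) (D N z) = rcons w a by rewrite -dwordS.
  by rewrite zw; congr rcons; case: a za => //= /negP/negbTE.
by apply: measurableI => //; case: a; [|apply: measurableC].
Qed.

Lemma measurable_fun_dword d' (V : measurableType d') N (g : seq bool -> V) :
  measurable_fun setT (fun t => g (dword N t)).
Proof.
move=> _ A mA; rewrite setTI.
rewrite (_ : _ @^-1` _ = \bigcup_(w in [set w | A (g w)]) [set t | dword N t = w]).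
  by apply: bigcup_measurable_count => w _; exact: measurable_dword.
by apply/seteqP; split=> [z /= Az|z [w /= Aw ->//]]; exists (dword N z).
Qed.

Lemma measurable_dword_pred N (Q : pred (seq bool)) :
  measurable [set t | Q (dword N t)].
Proof.
rewrite (_ : [set _ | _] = \bigcup_(w in [set w | Q w]) [set t | dword N t = w]).
  by apply: bigcup_measurable_count => w _; exact: measurable_dword.
by apply/seteqP; split=> [z /= Az|z [w /= Aw ->//]]; exists (dword N z).
Qed.

Lemma measure_dword (R : realType) (m : {measure set T -> \bar R}) N (Q : pred (seq bool)) :
  (m [set t | Q (dword N t)] =
   \sum_(w : N.-tuple bool | Q w) m [set t | dword N t = w])%E.
Proof.
pose s := [seq w <- index_enum {: N.-tuple bool} | Q (tval w)].
have us : uniq s by rewrite filter_uniq// index_enum_uniq.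
rewrite (_ : [set _ | _] = \bigcup_(w in [set` s]) [set t | dword N t = tval w]).
  rewrite measure_fin_bigcup//.
  - by rewrite -fsbig_seq//= /s big_filter.
  - by move=> w w' _ _ [t [/= -> /val_inj]].
  - by move=> w _; exact: measurable_dword.
apply/seteqP; split=> t /=.
  move=> Qt; exists (tcast (size_dword D N t) (in_tuple (dword N t))).
    by rewrite /= mem_filter val_tcast /= Qt mem_index_enum.
  by rewrite val_tcast.
by move=> [w /=]; rewrite mem_filter => /andP[Qw _] ->.
Qed.

Lemma integral_dword (R : realType) (m : {measure set T -> \bar R}) N (h : seq bool -> R) :
  (forall w, 0 <= h w) ->
  (\int[m]_t (h (dword N t))%:E =
   \sum_(w : N.-tuple bool) (h w)%:E * m [set t | dword N t = w])%E.
Proof.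
move=> h0.
transitivity (\int[m]_t (\sum_(w : N.-tuple bool) (h w)%:E * (\1_[set t | dword N t = w] t)%:E))%E.
  apply: eq_integral => t _.
  pose w0 := tcast (size_dword D N t) (in_tuple (dword N t)).
  have w0E : tval w0 = dword N t by rewrite val_tcast.
  rewrite (bigD1 w0)//= big1 ?adde0; last first.
    move=> w ww0; rewrite indicE memNset ?mule0//= => tw.
    by move/eqP: ww0; apply; exact: val_inj (etrans (esym tw) (esym w0E)).
  by rewrite indicE mem_set; [rewrite mule1 -w0E|rewrite /= -w0E].
rewrite ge0_integral_sum//.
- apply: eq_bigr => w _; rewrite ge0_integralZl_EFin//.
  + by rewrite integral_indic ?setIT//; exact: measurable_dword.
  + by apply/measurable_EFinP; exact/measurable_indic/measurable_dword.
- move=> w; apply: measurable_funeM; apply/measurable_EFinP.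
  exact/measurable_indic/measurable_dword.
- by move=> w t _; rewrite mule_ge0// lee_fin// h0.
Qed.

End MeasurableWords.

(** * Lower semicontinuity and measurability of the cost *)

Section CostRegularity.
Variables (R : realType) (k : nat).
Local Notation X := (X R k).
Local Notation Gamma := (Gamma R k).
Implicit Types (e o : config R k) (Z : set (X * X)).

(** The bound on the total cost also bounds the cost of each pair, by [q + 1], which is the
    compactness required for the limit of the matchings to exist; closedness of [Z] passes the
    constraint to the limit. *)
Lemma lsc_matching (e_ o_ : nat -> config R k) e o b_ Z (q : R) : closed Z ->
  box_cvg e_ e -> box_cvg o_ o ->
  (forall n, [/\ matching (e_ n) (o_ n) (b_ n), b_ n `<=` Z &
     (tcost (b_ n) <= (q + n.+1%:R^-1)%:E)%E]) ->
  exists b, [/\ matching e o b, b `<=` Z & (tcost b <= q%:E)%E].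
Proof.
move=> cZ ec oc h.
have [U [UU oU]] := @ultraFilterLemma nat \oo _.
have PU : ProperFilter U by exact: ultra_proper.
have bm n : matching (e_ n) (o_ n) (b_ n) by have [] := h n.
have bM n p : b_ n p -> pcost p <= q + 1.
  move=> /tcost_ge h1; have [_ _ h2] := h n.
  rewrite -lee_fin (le_trans h1)// (le_trans h2)// lee_fin lerD2l.
  by rewrite invf_le1 ?ltr0n// ler1n.
exists (lim_rel U e o b_); split.
- exact: (lim_rel_matching UU oU ec oc bm bM).
- move=> [x y] [/= ex oy lxy]; apply: cZ => A [[A1 A2] [/= A1x A2y] A12].
  have [d [dx dA1]] := box_basis A1x; have [d' [d'y dA2]] := box_basis A2y.
  have [n [p [bnp dp1 dp2]]] := filter_ex (lxy _ _ dx d'y).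
  have [_ bZ _] := h n.
  by exists p; split; [exact: bZ|apply: A12; split; [exact: dA1|exact: dA2]].
- apply: (lim_rel_cost UU oU _ ec bm) => eps eps0.
  have : \forall n \near \oo, n.+1%:R^-1 < (PosNum eps0)%:num.
    exact: near_infty_natSinv_lt.
  move=> /oU; apply: filterS => n /= neps; have [_ _ h1] := h n.
  by rewrite (le_trans h1)// lee_fin lerD2l ltW.
Qed.

Lemma box_cvg_cst e : box_cvg (fun=> e) e.
Proof. by move=> b m h; exact: nearW. Qed.

Lemma costZ_attained Z e o : closed Z -> (costZ Z e o < +oo)%E ->
  exists b, [/\ matching e o b, b `<=` Z & tcost b = costZ Z e o].
Proof.
move=> cZ coo; have cfin : costZ Z e o \is a fin_num.
  by rewrite ge0_fin_numE// costZ_ge0.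
have /choice[b_ bP] : forall n : nat, exists b, [/\ matching e o b, b `<=` Z &
    (tcost b <= (fine (costZ Z e o) + n.+1%:R^-1)%:E)%E].
  move=> n; have : (costZ Z e o < (fine (costZ Z e o) + n.+1%:R^-1)%:E)%E.
    by rewrite EFinD fineK// lteDl// lte_fin invr_gt0.
  by move=> /ereal_inf_lt[_ [b [bm bZ] <-] /ltW h]; exists b; split.
have [b [bm bZ bc]] := lsc_matching cZ (@box_cvg_cst e) (@box_cvg_cst o) bP.
exists b; split=> //; apply/eqP; rewrite eq_le costZ_le// andbT.
by rewrite -[leRHS]fineK.
Qed.

Lemma cost_attained e o : (cost e o < +oo)%E ->
  exists b, matching e o b /\ tcost b = cost e o.
Proof.
rewrite costE => /(costZ_attained closedT)[b [bm _ bc]].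
by exists b.
Qed.

(** One elementary question about a pair of configurations: the flag [c] selects the configuration,
    and the question is whether a box contains exactly [m] of its points. Numbers that decode to no
    question answer [false]. *)
Definition digit (n : nat) (z : config R k * config R k) : bool :=
  if @unpickle (bool * bidx k * nat)%type n is Some (c, b, m) then
    `[< npts R (cpts (if c then z.1 else z.2)) (box b) = m%:R%:E >] else false.

Definition word := dword digit.

Lemma digit_pickle c b m z : digit (pickle (c, b, m)) z =
  `[< npts R (cpts (if c then z.1 else z.2)) (box b) = m%:R%:E >].
Proof. by rewrite /digit pickleK. Qed.

Lemma measurable_count (B : set X) (a : \bar R) : borelX B ->
  measurable [set e : Gamma | npts R (cpts e) B = a].
Proof. by move=> BB; apply: sub_sigma_algebra; exists B, a. Qed.

Lemma measurable_digit n : measurable [set z : Gamma * Gamma | digit n z].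
Proof.
rewrite /digit; case: unpickle => [[[c b] m]|]; last first.
  rewrite [X in measurable X](_ : _ = set0); first exact: measurable0.
  by apply/seteqP; split=> z.
have mB := measurable_count m%:R%:E (box_borel (R := R) b).
rewrite [X in measurable X](_ : _ = (if c then fst else snd : Gamma * Gamma -> Gamma) @^-1`
   [set e : Gamma | npts R (cpts e) (box b) = m%:R%:E]); last first.
  by case: c; apply/seteqP; split=> z /= => [/asboolP|h] //; apply/asboolP.
rewrite -[X in measurable X]setTI.
by case: c; [exact: measurable_fst|exact: measurable_snd].
Qed.

Lemma measurable_word N w : measurable [set z : Gamma * Gamma | word N z = w].
Proof. by apply: measurable_dword => n; exact: measurable_digit. Qed.

Lemma measurable_fun_word d (V : measurableType d) N (g : seq bool -> V) :
  measurable_fun setT (fun z : Gamma * Gamma => g (word N z)).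
Proof. by apply: measurable_fun_dword => n; exact: measurable_digit. Qed.

(** The best lower bound on the constrained cost that can be deduced from the first [N] digits. *)
Definition cyl_cost Z N (w : seq bool) : \bar R :=
  ereal_inf [set costZ Z z.1 z.2 | z in [set z | word N z = w]].

Lemma cyl_cost_ge0 Z N w : (0 <= cyl_cost Z N w)%E.
Proof. by apply: le_ereal_inf_tmp => _ [z _ <-]; exact: costZ_ge0. Qed.

Lemma cyl_cost_le Z N z : (cyl_cost Z N (word N z) <= costZ Z z.1 z.2)%E.
Proof. by apply: ereal_inf_lbound; exists z. Qed.

Lemma cyl_cost_nd Z N N' z : (N <= N')%N ->
  (cyl_cost Z N (word N z) <= cyl_cost Z N' (word N' z))%E.
Proof.
move=> NN'; apply: ereal_inf_le_tmp => _ [z' /= h <-]; exists z' => //=.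
have E y : word N y = take N (word N' y).
  by rewrite /word /dword /mkseq -map_take take_iota (minn_idPl NN').
by rewrite !E h.
Qed.

(** Take almost optimal pairs that agree with [(e, o)] on the first [n] digits. Agreement on longer
    and longer words is convergence of all box counts, so lower semicontinuity gives a matching of
    [(e, o)] that costs no more than the supremum. Measurability of the cost follows, each word
    function being a step function. *)
Lemma cyl_cost_sup Z e o : closed Z ->
  costZ Z e o = ereal_sup (range (fun N => cyl_cost Z N (word N (e, o)))).
Proof.
move=> cZ; apply/eqP; rewrite eq_le; apply/andP; split; last first.
  by apply: ge_ereal_sup => _ [N _ <-]; exact: (cyl_cost_le Z N (e, o)).
set q := ereal_sup _.
have q0 : (0 <= q)%E.
  by apply: (le_trans (cyl_cost_ge0 Z 0 (word 0 (e, o)))); apply: ereal_sup_ubound; exists 0.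
case: (leP +oo%E q) => [|qoo]; first by apply: le_trans; rewrite leey.
have qfin : q \is a fin_num by rewrite ge0_fin_numE.
have /choice[f fP] : forall n : nat, exists zb : (config R k * config R k) * set (X * X),
    word n zb.1 = word n (e, o) /\ [/\ matching zb.1.1 zb.1.2 zb.2, zb.2 `<=` Z &
    (tcost zb.2 <= (fine q + n.+1%:R^-1)%:E)%E].
  move=> n; have : (cyl_cost Z n (word n (e, o)) < (fine q + n.+1%:R^-1)%:E)%E.
    apply: (@le_lt_trans _ _ q); first by apply: ereal_sup_ubound; exists n.
    by rewrite EFinD fineK// lteDl// lte_fin invr_gt0.
  move=> /ereal_inf_lt[_ [z wz <-] /ereal_inf_lt[_ [b [bm bZ] <-] /ltW h]].
  by exists (z, b); split.
have cvgf (c : bool) : box_cvg (fun n => if c then (f n).1.1 else (f n).1.2)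
    (if c then e else o).
  (* The digit of number [i] is visible in words of length at least [i.+1]. *)
  move=> b m h; exists (pickle (c, b, m)).+1 => // n /= ln.
  have [wf _] := fP n; have := dword_digit ln wf.
  rewrite !digit_pickle => dE; apply/asboolP; move: dE.
  by case: c h {ln} => h dE; rewrite dE; exact/asboolP.
have [b [bm bZ bq]] := lsc_matching cZ (cvgf true) (cvgf false) (fun n => (fP n).2).
by rewrite -[q]fineK// (le_trans (costZ_le bm bZ)).
Qed.

Lemma measurable_costZ Z : closed Z ->
  measurable_fun setT (fun z : Gamma * Gamma => costZ Z z.1 z.2).
Proof.
move=> cZ.
rewrite (_ : (fun _ => _) =
    fun z => ereal_sup (range (fun N => cyl_cost Z N (word N z)))); last first.
  by apply/funext => -[e o]; rewrite /= (cyl_cost_sup _ _ cZ).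
by apply: measurable_ereal_sup_count => N; exact: measurable_fun_word.
Qed.

Lemma measurable_cost : measurable_fun setT (fun z : Gamma * Gamma => cost z.1 z.2).
Proof.
under eq_fun do rewrite costE.
exact: (measurable_costZ closedT).
Qed.

End CostRegularity.


(** * Measurability of configuration-valued maps *)

Section ConfigurationValuedMaps.
Variables (R : realType) (k : nat).
Local Notation X := (X R k).
Local Notation Gamma := (Gamma R k).

Lemma measurable_coord d (O : measurableType d) (F : O -> X) :
  (forall j, measurable_fun setT (fun y => F y ord0 j)) ->
  forall B, borelX B -> measurable (F @^-1` B).
Proof.
move=> mF; suff : @borelX R k `<=` [set B | measurable (F @^-1` B)] by [].
apply: smallest_sub.
  split=> /=; first by rewrite preimage_set0; exact: measurable0.
    by move=> A mA; rewrite setTD preimage_setC; exact: measurableC.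
  by move=> A mA; rewrite preimage_bigcup; exact: bigcupT_measurable.
move=> U oU /=; rewrite (open_bigcup_box oU) preimage_bigcup.
apply: bigcup_measurable_count => b _.
rewrite (_ : _ @^-1` _ = \bigcap_(j in setT) ((fun y => F y ord0 j) @^-1`
    `]ratr (b.1 j), ratr (b.2 j)[%classic)).
  apply: bigcap_measurable_count => j _; rewrite -[X in measurable X]setTI.
  by apply: mF => //; exact: measurable_itv.
apply/seteqP; split=> y /= h j; first by move=> _; rewrite /= in_itv; exact: h.
by have := h j Logic.I; rewrite /= in_itv.
Qed.

Lemma measurable_coord_eq d (O : measurableType d) (F G : O -> X) :
  (forall j, measurable_fun setT (fun y => F y ord0 j)) ->
  (forall j, measurable_fun setT (fun y => G y ord0 j)) ->
  measurable [set y | F y = G y].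
Proof.
move=> mF mG.
rewrite (_ : [set _ | _] = \bigcap_(j in setT)
    ((fun y => F y ord0 j - G y ord0 j) @^-1` [set 0])).
  apply: bigcap_measurable_count => j _; rewrite -[X in measurable X]setTI.
  by apply: measurable_funB => //; exact: measurable_set1.
apply/seteqP; split=> y /= h; first by move=> j _ /=; rewrite h subrr.
by apply/rowP => j; have /eqP := h j Logic.I; rewrite subr_eq0 => /eqP.
Qed.

Lemma compact_sub_box (K : set X) : compact K -> exists b, K `<=` box b.
Proof.
move=> /compact_bounded[M [_ /(_ (M + 1))]]; rewrite ltrDl ltr01 => /(_ isT) KM.
pose N : rat := (Num.truncn (M + 1)).+1%:R.
exists ([ffun=> - N], [ffun=> N]) => x /KM xM j; rewrite !ffunE.
rewrite rmorphN /= /N ratr_nat -ltr_norml.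
apply: le_lt_trans (truncnS_gt (M + 1)); apply: le_trans xM.
rewrite [leRHS]mx_normrE.
by apply: (le_bigmax _ (fun i : 'I_1 * 'I_k => `|x i.1 i.2|) (ord0, j)).
Qed.

Lemma finite_has_pts (T : choiceType) (S : set T) :
  finite_set S <-> exists m, ~ has_pts m S.
Proof.
split=> [fS|[m hm]]; last first.
  apply: contrapT => /(infinite_set_fset m)[B BS mB]; apply: hm.
  by apply: has_pts_le mB _; exists (finmap.enum_fset B); split=> //; exact: finmap.fset_uniq.
exists (size (finmap.enum_fset (fset_set S))).+1 => -[s [us ss sS]].
suff : (size s <= size (finmap.enum_fset (fset_set S)))%N by rewrite ss ltnn.
by apply: uniq_leq_size => // x /sS Sx; rewrite in_fset_set// inE.
Qed.

Lemma locfin_boxP (S : set X) : locfin S <-> forall b, finite_set (S `&` box b).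
Proof.
split=> [Sf b|h K /compact_sub_box[b Kb]].
  apply: sub_finite_set (locfin_cbox b Sf).
  by move=> x [Sx bx]; split=> //; exact: box_sub_cbox.
by apply: sub_finite_set (h b) => x [Sx /Kb].
Qed.

Lemma measurable_npts d (O : measurableType d) (S : O -> set X) (B : set X) a :
  (forall m, measurable [set y | has_pts m (S y `&` B)]) ->
  measurable [set y | npts R (S y) B = a].
Proof.
move=> mS.
have [[m am]|nam] := pselect (exists m, a = m%:R%:E).
  rewrite (_ : [set _ | _] = [set y | has_pts m (S y `&` B)] `&`
      ~` [set y | has_pts m.+1 (S y `&` B)]).
    by apply: measurableI => //; exact: measurableC.
  by apply/seteqP; split=> y /=; rewrite am npts_natP.
have [aoo|naoo] := pselect (a = +oo%E).
  rewrite (_ : [set _ | _] = \bigcap_(m in setT) [set y | has_pts m (S y `&` B)]).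
    exact: bigcap_measurable_count.
  apply/seteqP; split=> y /=; rewrite aoo npts_pinfty => h m; first by move=> _; exact: h.
  exact: (h m Logic.I).
rewrite (_ : [set _ | _] = set0); first exact: measurable0.
apply/seteqP; split=> // y /= h; have [[m hm]|hoo] := npts_cases R (S y) B.
  by apply: nam; exists m; rewrite -h.
by apply: naoo; rewrite -h.
Qed.

Section Atoms.
Context d (O : measurableType d) (I : countType) (E : I -> set O) (F : I -> O -> X).
Hypothesis mE : forall i, measurable (E i).
Hypothesis mF : forall i j, measurable_fun setT (fun y => F i y ord0 j).

(** Each index lists a point that is present on an event only, and several indices may list the same
    point. Both the decoding of digits and the transport map are built in this way. *)
Definition atoms y : set X := [set x | exists2 i, E i y & F i y = x].

Definition atoms_config (y : O) : Gamma :=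
  if pselect (locfin (atoms y)) is left h then Config h else @config0 R k.

Lemma atoms_configE y : locfin (atoms y) -> cpts (atoms_config y) = atoms y.
Proof. by rewrite /atoms_config; case: pselect. Qed.

Lemma measurable_uniq_atoms (s : seq I) :
  measurable [set y | uniq [seq F i y | i <- s]].
Proof.
elim: s => [|i s IHs].
  by rewrite (_ : [set _ | _] = setT); [exact: measurableT|apply/seteqP; split].
rewrite (_ : [set _ | _] = [set y | uniq [seq F i y | i <- s]] `&`
    \bigcap_(i' in [set` s]) ~` [set y | F i y = F i' y]).
  apply: measurableI => //; apply: bigcap_measurable_count => i' _.
  by apply: measurableC; exact: measurable_coord_eq.
apply/seteqP; split=> y.
  move=> /= /andP[/negP is_ us]; split=> // i' si' ii'; apply: is_.
  by rewrite ii'; apply: map_f.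
move=> [us h] /=; rewrite us andbT; apply/negP => /mapP[i' si' ii'].
exact: (h i' si').
Qed.

(** A list of [m] indices whose points are distinct and lie in [B] is a witness, and there are
    countably many lists. *)
Lemma measurable_has_atoms m (B : set X) : borelX B ->
  measurable [set y | has_pts m (atoms y `&` B)].
Proof.
move=> BB.
rewrite (_ : [set _ | _] = \bigcup_(s in [set s : seq I | size s = m])
    ([set y | uniq [seq F i y | i <- s]] `&`
     \bigcap_(i in [set` s]) (E i `&` F i @^-1` B))).
  apply: bigcup_measurable_count => s _; apply: measurableI.
    exact: measurable_uniq_atoms.
  apply: bigcap_measurable_count => i _; apply: measurableI => //.
  exact: measurable_coord.
apply/seteqP; split=> y.
  move=> [s [us ss sS]].
  have [t [ts tE]] : exists t : seq I, [seq F i y | i <- t] = s /\ forall i, i \in t -> E i y.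
    elim: s sS {us ss} => [|x s IHs] sS; first by exists [::].
    have [[i Ei Fi] _] := sS x (mem_head _ _).
    have [|t [ts tE]] := IHs; first by move=> z zs; apply: sS; rewrite inE zs orbT.
    exists (i :: t) => /=; rewrite Fi ts; split=> // i'.
    by rewrite inE => /orP[/eqP ->//|/tE].
  exists t; first by rewrite /= -ss -ts size_map.
  split; first by rewrite /= ts.
  move=> i /= it; split; first exact: tE.
  by rewrite /preimage /=; have [] := sS (F i y); rewrite -?ts ?map_f.
move=> [s /= ss [us h]]; exists [seq F i y | i <- s]; split=> //; first by rewrite size_map.
by move=> _ /mapP[i si ->]; have [Ei Bi] := h i si; split=> //; exists i.
Qed.

Lemma measurable_locfin_atoms : measurable [set y | locfin (atoms y)].
Proof.
rewrite (_ : [set _ | _] = \bigcap_(b in [set: bidx k]) \bigcup_(m in [set: nat])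
    ~` [set y | has_pts m (atoms y `&` box b)]).
  apply: bigcap_measurable_count => b _; apply: bigcup_measurable_count => m _.
  by apply: measurableC; apply: measurable_has_atoms; exact: box_borel.
apply/seteqP; split=> y.
  by move=> /locfin_boxP h b _; have /finite_has_pts[m hm] := h b; exists m.
by move=> h; apply/locfin_boxP => b; have [m _ hm] := h b Logic.I; apply/finite_has_pts; exists m.
Qed.

Lemma measurable_atoms_config : measurable_fun setT atoms_config.
Proof.
apply: (@measurability _ _ O Gamma setT atoms_config (@count_gen R k)) => //.
move=> _ [_ [B [a [BB ->]]] <-].
rewrite setTI.
rewrite (_ : _ @^-1` _ =
    ([set y | locfin (atoms y)] `&` [set y | npts R (atoms y) B = a]) `|`
    (~` [set y | locfin (atoms y)] `&` [set y | npts R (@set0 X) B = a])).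
  have mL := measurable_locfin_atoms.
  apply: measurableU; apply: measurableI => //; last 2 first.
  - exact: measurableC.
  - have [h|h] := pselect (npts R (@set0 X) B = a).
      by rewrite (_ : [set _ | _] = setT); [exact: measurableT|apply/seteqP; split].
    by rewrite (_ : [set _ | _] = set0); [exact: measurable0|apply/seteqP; split].
  by apply: measurable_npts => m; exact: measurable_has_atoms.
apply/seteqP; split=> y /=; rewrite /atoms_config; case: pselect => h /=.
- by move=> ?; left.
- by move=> ?; right.
- by move=> [[_]|[]].
- by move=> [[]|[_]].
Qed.

End Atoms.

(** Rebuilds a real number from the rational levels below it: only decisions about countably many
    levels can be combined measurably. *)
Definition rat_sup (P : rat -> Prop) : R :=
  fine (ereal_sup (range (fun q : rat => if `[< P q >] then (ratr q : R)%:E else -oo%E))).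

Lemma measurable_rat_sup d (O : measurableType d) (P : rat -> set O) :
  (forall q, measurable (P q)) ->
  measurable_fun setT (fun y => rat_sup (fun q => P q y)).
Proof.
move=> mP; rewrite /rat_sup; apply: (@measurableT_comp _ _ _ _ _ _ fine) => //.
apply: (@measurable_ereal_sup_count _ O R rat
  (fun q y => if `[< P q y >] then (ratr q : R)%:E else -oo%E)) => q.
apply: measurable_fun_ifT => //; apply: (@measurable_fun_bool _ _ _ _ true).
rewrite setTI (_ : _ @^-1` _ = P q)//.
by apply/seteqP; split=> y /asboolP.
Qed.

(** Nothing is asked of [P] at a rational equal to [x], where strict and wide inequalities would
    differ. *)
Lemma rat_sup_eq (P : rat -> Prop) (x : R) :
  (forall q, ratr q < x -> P q) -> (forall q, x < ratr q -> ~ P q) -> rat_sup P = x.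
Proof.
move=> h1 h2; rewrite /rat_sup (_ : ereal_sup _ = x%:E)//.
apply/eqP; rewrite eq_le; apply/andP; split.
  apply: ge_ereal_sup => _ [q _ <-]; case: asboolP => Pq; last exact: leNye.
  by rewrite lee_fin leNgt; apply/negP => /h2.
apply/lee_addgt0Pr => e e0; have /rat_in_itvoo[q] : x - e < x by rewrite ltrBlDr ltrDl.
rewrite in_itv /= => /andP[xq qx].
rewrite -leeBlDr// -EFinB; apply: (@le_trans _ _ (ratr q)%:E); first by rewrite lee_fin ltW.
by apply: ereal_sup_ubound; exists q => //; rewrite asboolT//; exact: h1.
Qed.

End ConfigurationValuedMaps.


Lemma config_ext (R : realType) (k : nat) (e o : config R k) : cpts e = cpts o -> e = o.
Proof.
by case: e => E hE; case: o => O hO /= EO; subst O; congr Config; exact: Prop_irrelevance.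
Qed.

Section MeasureToProbability.
Context d (T : measurableType d) (R : realType) (m : {measure set T -> \bar R}).

(** An alias of [m] that carries the proof of total mass one, so that a structure of probability can
    be attached to it. *)
Definition prob_of (_ : m setT = 1%E) : set T -> \bar R := m.

Hypothesis m1 : m setT = 1%E.

HB.instance Definition _ := isMeasure.Build _ _ _ (prob_of m1)
  (measure0 m) (measure_ge0 m) (@measure_semi_sigma_additive _ _ _ m).
HB.instance Definition _ := Measure_isProbability.Build _ _ _ (prob_of m1) m1.

Lemma exists_probability : exists P : probability T R, forall A, P A = m A.
Proof. by exists (prob_of m1). Qed.

End MeasureToProbability.

Lemma exists_pushforward d d' (T : measurableType d) (T' : measurableType d')
    (R : realType) (m : {measure set T -> \bar R}) (f : T -> T') :
  measurable_fun setT f ->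
  exists m' : {measure set T' -> \bar R}, forall A, m' A = m (f @^-1` A).
Proof.
move=> mf; unshelve refine (ex_intro _ (pushforward m f : {measure set T' -> \bar R}) _).
  exact: mf.
by [].
Qed.

Lemma exists_prob_pushforward d d' (T : measurableType d) (T' : measurableType d')
    (R : realType) (m : {measure set T -> \bar R}) (f : T -> T') :
  measurable_fun setT f -> m setT = 1%E ->
  exists P : probability T' R, forall A, P A = m (f @^-1` A).
Proof.
move=> mf m1; have [m' m'E] := exists_pushforward m mf.
have [P PE] : exists P : probability T' R, forall A, P A = m' A.
  by apply: exists_probability; rewrite m'E preimage_setT; exact: m1.
by exists P => A; rewrite PE m'E.
Qed.

(** * Coding configurations by countably many digits *)

Section Coding.
Variables (R : realType) (k : nat).
Local Notation X := (X R k).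
Local Notation Gamma := (Gamma R k).

Definition digits : Type := (bidx k * nat)%type -> bool.
HB.instance Definition _ := Pointed.on digits.

(** Only positive answers are prescribed. These sets generate the sigma-algebra and are stable under
    intersection, by concatenation of lists, so they determine finite measures. *)
Definition cyl (s : seq (bidx k * nat)%type) : set digits := [set d : digits | all (fun i => d i) s].

Definition Digits := g_sigma_algebraType (range cyl).

Lemma measurable_cyl s : measurable (cyl s : set Digits).
Proof. by apply: sub_sigma_algebra; exists s. Qed.

Lemma cylI s t : cyl s `&` cyl t = cyl (s ++ t).
Proof. by apply/seteqP; split=> d; rewrite /cyl /= all_cat => /andP. Qed.

Lemma measurable_dig i : measurable [set d : Digits | d i].
Proof.
rewrite (_ : [set _ | _] = cyl [:: i]); first exact: measurable_cyl.
by apply/seteqP; split=> d; rewrite /cyl /= andbT.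
Qed.

Lemma Digits_prob_unique (m m' : {measure set Digits -> \bar R}) :
  (m setT < +oo)%E -> (forall s, m (cyl s) = m' (cyl s)) ->
  forall A, measurable A -> m A = m' A.
Proof.
move=> moo h A mA.
have cylT : cyl [::] = setT by apply/seteqP; split.
apply: (@measure_unique _ R Digits (range cyl) (fun=> cyl [::]) erefl _ _ _ m m') => //.
- by move=> _ _ [s _ <-] [t _ <-]; rewrite cylI; exists (s ++ t).
- by rewrite cylT bigcup_const//; exists 0%N.
- by move=> _ [s _ <-].
- by move=> _; rewrite cylT.
Qed.

Lemma measurable_to_Digits d (T : measurableType d) (f : T -> Digits) :
  (forall i, measurable [set y | f y i]) -> measurable_fun setT f.
Proof.
move=> mf; apply: (@measurability _ _ T Digits setT f (range cyl)) => //.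
move=> _ [_ [s _ <-] <-]; rewrite setTI.
rewrite (_ : _ @^-1` _ = \bigcap_(i in [set` s]) [set y | f y i]).
  by apply: bigcap_measurable_count => i _; exact: mf.
by apply/seteqP; split=> y /=; rewrite /cyl /= => h; [move=> i /= /(allP h)|apply/allP].
Qed.

Definition code (e : Gamma) : Digits := fun i => `[< npts R (cpts e) (box i.1) = i.2%:R%:E >].

Lemma measurable_code : measurable_fun setT code.
Proof.
apply: measurable_to_Digits => -[b m].
rewrite (_ : [set _ | _] = [set e : Gamma | npts R (cpts e) (box b) = m%:R%:E]).
  by apply: measurable_count; exact: box_borel.
by apply/seteqP; split=> e /= /asboolP.
Qed.

Definition cut_box (b : bidx k) (j : 'I_k) (q : rat) : bidx k :=
  ([ffun i => if i == j then Num.max (b.1 i) q else b.1 i], b.2).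

Lemma cut_boxE b j q (x : X) : box (cut_box b j q) x <-> box b x /\ ratr q < x ord0 j.
Proof.
split=> [h|[bx qx] i].
  split=> [i|]; last by have := h j; rewrite /= ffunE eqxx maxr_rat gt_max => /andP[/andP[]].
  have := h i; rewrite /= ffunE; case: ifP => // _.
  by rewrite maxr_rat gt_max => /andP[/andP[-> _] ->].
rewrite /= ffunE; have := bx i; case: ifP => // /eqP -> /andP[l r].
by rewrite maxr_rat gt_max l qx.
Qed.

(** For the code of a configuration with a single point in [b], the box cut at level [q] still
    contains one point exactly when [q] is below the coordinate of that point. *)
Definition dig_point (b : bidx k) (d : Digits) : X :=
  \row_j rat_sup R (fun q => d (cut_box b j q, 1%N)).

Lemma measurable_dig_point b j : measurable_fun setT (fun d => dig_point b d ord0 j).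
Proof.
rewrite (_ : (fun _ => _) = fun d : Digits => rat_sup R (fun q => d (cut_box b j q, 1%N))); last first.
  by apply/funext => d; rewrite mxE.
apply: (@measurable_rat_sup R _ Digits (fun q => [set d | d (cut_box b j q, 1%N)])) => q.
exact: measurable_dig.
Qed.

Lemma dig_pointE b (e : Gamma) x : cpts e `&` box b = [set x] -> dig_point b (code e) = x.
Proof.
move=> ebx; apply/rowP => j; rewrite mxE.
have [ex bx] : (cpts e `&` box b) x by rewrite ebx.
apply: rat_sup_eq => q qx.
  apply/asboolP/npts1P; exists x; apply/seteqP; split=> [y [ey /cut_boxE[by_ _]]|_ ->].
    by rewrite -ebx.
  by split=> //; apply/cut_boxE.
move=> /asboolP/npts1P[y ey]; have [/= ey1 /cut_boxE[by1 qy]] : (cpts e `&` box (cut_box b j q)) y by rewrite ey.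
have yx : [set x] y by rewrite -ebx.
by rewrite /= in yx; subst y; rewrite ltNge (ltW qx) in qy.
Qed.

(** Defined for every digit sequence, coherent or not. It is a left inverse of [code], because each
    point of a configuration is alone in some box and can be located from the digits of the cut
    boxes. *)
Definition decode : Digits -> Gamma :=
  atoms_config (fun b => [set d : Digits | d (b, 1%N)]) dig_point.

Lemma measurable_decode : measurable_fun setT decode.
Proof.
apply: measurable_atoms_config => [b|b j]; first exact: measurable_dig.
exact: measurable_dig_point.
Qed.

Lemma atoms_code e :
  atoms (fun b => [set d : Digits | d (b, 1%N)]) dig_point (code e) = cpts e.
Proof.
apply/seteqP; split=> x.
  move=> [b /= /asboolP/npts1P[y eby]]; rewrite (dig_pointE eby) => <-.
  by have [] : (cpts e `&` box b) y by rewrite eby.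
move=> ex; have [b [bx _ ebx]] := locfin_iso (@cpts_locfin _ _ e) ex filterT.
by exists b; [apply/asboolP/npts1P; exists x|exact: dig_pointE].
Qed.

Lemma decode_code e : decode (code e) = e.
Proof.
apply: config_ext; rewrite atoms_configE atoms_code//.
exact: cpts_locfin.
Qed.

End Coding.


(** * Existence of optimal couplings *)

Section NestedIntervals.
Variables (R : realType) (p : seq bool -> R).
Hypothesis p_nil : p [::] = 1.
Hypothesis p_ge0 : forall w, 0 <= p w.
Hypothesis p_rcons : forall w, p w = p (rcons w false) + p (rcons w true).

(** Words grow at their right end, hence the recursion on the reversed word. A digit [true] skips
    the interval of the sibling that ends in [false]. *)
Fixpoint left_rev (r : seq bool) : R :=
  if r is a :: r' then left_rev r' + (if a then p (rcons (rev r') false) else 0) else 0.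

(** The interval of the word [w] is [left w, left w + p w[. *)
Definition left (w : seq bool) : R := left_rev (rev w).

Lemma left_rcons w a : left (rcons w a) = left w + (if a then p (rcons w false) else 0).
Proof. by rewrite /left rev_rcons /= revK. Qed.

Lemma left_bounds w : 0 <= left w /\ left w + p w <= 1.
Proof.
elim/last_ind: w => [|w a [IH1 IH2]]; first by rewrite /left /= p_nil add0r.
rewrite left_rcons; have := p_rcons w.
have := p_ge0 (rcons w true); have := p_ge0 (rcons w false).
by case: a => h1 h2 h3; split; lra.
Qed.

Fixpoint itv_word (N : nat) (u : R) : seq bool :=
  if N is N'.+1 then
    let w := itv_word N' u in rcons w (left w + p (rcons w false) <= u)
  else [::].

Definition itv_digit (N : nat) (u : R) : bool :=
  left (itv_word N u) + p (rcons (itv_word N u) false) <= u.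

Lemma itv_wordE N u : itv_word N u = dword itv_digit N u.
Proof. by elim: N => //= N IH; rewrite dwordS -IH. Qed.

Lemma itv_wordP N w u : size w = N -> 0 <= u < 1 ->
  itv_word N u = w <-> left w <= u < left w + p w.
Proof.
move=> + u01; elim: N w => [|N IH] w.
  by move=> /size0nil ->; rewrite /left /= p_nil add0r; split=> // _.
case/lastP: w => [//|w a]; rewrite size_rcons => -[sw] /=.
have := IH w sw; rewrite left_rcons; have := p_rcons w.
have := p_ge0 (rcons w true); have := p_ge0 (rcons w false).
set pf := p (rcons w false); set pt := p (rcons w true) => h1 h2 h3 [IH1 IH2]; split.
  move=> /rcons_inj[wE]; rewrite wE -/pf => <-; have /andP[l r] := IH1 wE.
  by case: (leP (left w + pf) u) => h; rewrite -/pf -/pt; apply/andP; split; lra.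
move=> /andP[l r]; have wE : itv_word N u = w.
  by apply: IH2; case: (a) l r; rewrite -/pf -/pt => l r; apply/andP; split; lra.
rewrite wE -/pf; congr rcons.
by case: a l r; rewrite -/pf -/pt => l r; [|apply/negbTE; rewrite -ltNge]; lra.
Qed.

Lemma measurable_itv_word N w :
  measurable [set u : measurableTypeR R | itv_word N u = w].
Proof.
elim: N w => [|N IHN] w.
  have [->|w0] := eqVneq w [::].
    by rewrite (_ : [set _ | _] = setT); [exact: measurableT|apply/seteqP; split].
  rewrite (_ : [set _ | _] = set0); first exact: measurable0.
  by apply/seteqP; split=> // z zw; rewrite -zw eqxx in w0.
case/lastP: w => [|w a].
  rewrite (_ : [set _ | _] = set0); first exact: measurable0.
  by apply/seteqP; split=> // z /= /(congr1 size); rewrite size_rcons.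
have -> : [set u : measurableTypeR R | itv_word N.+1 u = rcons w a] =
    [set u | itv_word N u = w] `&`
    (if a then `[left w + p (rcons w false), +oo[%classic
     else `]-oo, left w + p (rcons w false)[%classic).
  apply/seteqP; split=> u /=.
    move=> /rcons_inj[<-]; case: a => /=; rewrite in_itv /= ?andbT => h; split=> //.
    by rewrite ltNge h.
  move=> [-> ua]; congr rcons; case: a ua; rewrite /= in_itv /= ?andbT //.
  by rewrite ltNge => /negbTE.
by apply: measurableI => //; case: a; exact: measurable_itv.
Qed.

(** A Kolmogorov extension done by hand: consistent weights [p w] cut [[0, 1[] into nested intervals
    of these lengths, and the digits of a uniform point, which record the interval containing it,
    have the prescribed law. *)
Lemma exists_digit_law : exists (lam : {measure set (measurableTypeR R) -> \bar R})
    (D : nat -> measurableTypeR R -> bool),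
  [/\ lam setT = 1%E, forall n, measurable [set u | D n u] &
      forall N w, size w = N -> lam [set u | dword D N u = w] = (p w)%:E].
Proof.
have mI : measurable (`[0%R, 1%R[%classic : set (measurableTypeR R)) by exact: measurable_itv.
exists (mrestr (@lebesgue_measure R) mI), itv_digit; split.
- by rewrite /= /mrestr setTI lebesgue_measure_itv /= lte_fin ltr01 sube0.
- move=> n; rewrite (_ : [set _ | _] = \bigcup_w [set u | itv_word n.+1 u = rcons w true]).
    by apply: bigcup_measurable_count => w _; exact: measurable_itv_word.
  apply/seteqP; split=> u /=; first by move=> h; exists (itv_word n u); rewrite //= -/(itv_digit n u) h.
  by move=> [w _ /= /rcons_inj[_]].
- move=> N w sw; rewrite /= /mrestr.
  rewrite (_ : _ `&` _ = `[left w, left w + p w[%classic).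
    rewrite lebesgue_measure_itv /= lte_fin ltrDl -EFinB addrAC subrr add0r.
    by case: ltP => // pw; congr EFin; apply/le_anti/andP.
  have [l0 l1] := left_bounds w.
  apply/seteqP; split=> u /=; rewrite !in_itv /= -itv_wordE.
    by move=> [/itv_wordP h /h]; exact.
  move=> lu; have u01 : 0 <= u < 1 by case/andP: lu => ? ?; apply/andP; split; lra.
  by split=> //; apply/itv_wordP.
Qed.

End NestedIntervals.


(** * The limit of a sequence of couplings *)

Section LimitCoupling.
Variables (R : realType) (k : nat).
Local Notation Gamma := (Gamma R k).
Variables (mu nu : probability Gamma R).

Lemma coupling_fst g A : couplings mu nu g -> measurable A -> g [set z | A z.1] = mu A.
Proof. by move=> cg mA; have [] := cg A mA. Qed.

Lemma coupling_snd g A : couplings mu nu g -> measurable A -> g [set z | A z.2] = nu A.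
Proof. by move=> cg mA; have [] := cg A mA. Qed.

Variable U : set_system nat.
Hypothesis UU : UltraFilter U.
Let PU : ProperFilter U := @ultra_proper _ _ UU.
Variable g_ : nat -> probability (Gamma * Gamma)%type R.
Hypothesis g_c : forall n, couplings mu nu (g_ n).

Lemma ultra_cvg_prob (A : nat -> set (Gamma * Gamma)) : (forall n, measurable (A n)) ->
  exists l : R, (fun n => fine (g_ n (A n))) @ U --> l.
Proof.
move=> mA; have UF := fmap_ultra (fun n => fine (g_ n (A n))) UU.
have : compact (`[0, 1]%classic : set R) by exact: segment_compact.
rewrite compact_ultra => /(_ _ UF)[|l [_ hl]]; last by exists l.
have h n : 0 <= fine (g_ n (A n)) <= 1.
  rewrite fine_ge0 ?measure_ge0//= -lee_fin fineK ?probability_le1//.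
  exact: fin_num_measure.
by apply: (@filterS _ U _ setT); [move=> n _; have := h n; rewrite /= in_itv|exact: filterT].
Qed.

(** Probabilities lie in the compact interval [[0, 1]], so limits along [U] exist for all words at
    once, and they keep the additive relation between a word and its two extensions. *)
Lemma exists_limit_word_law : exists p : seq bool -> R, [/\ p [::] = 1, forall w, 0 <= p w,
  forall w, p w = p (rcons w false) + p (rcons w true) &
  forall N w, size w = N ->
    (fun n => fine (g_ n [set z | word N z = w])) @ U --> p w].
Proof.
have /choice[p pP] : forall w, exists l : R,
    (fun n => fine (g_ n [set z | word (size w) z = w])) @ U --> l.
  by move=> w; apply: ultra_cvg_prob => n; exact: measurable_word.
have uniq_lim (f : nat -> R) (a b : R) : f @ U --> a -> f @ U --> b -> a = b.
  by move=> fa fb; apply: (cvg_unique _ fa fb); exact: Rhausdorff.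
exists p; split.
- apply: uniq_lim (pP [::]) _; rewrite (_ : (fun _ => _) = fun=> 1); first exact: cvg_cst.
  apply/funext => n; rewrite (_ : [set _ | _] = setT) ?probability_setT//.
  by apply/seteqP; split.
- move=> w; apply: (cvgr_to_ge (pP w)); apply: nearW => n.
  by rewrite fine_ge0.
- move=> w; apply: uniq_lim (pP w) _.
  have pf := pP (rcons w false); have pt := pP (rcons w true).
  rewrite size_rcons in pf; rewrite size_rcons in pt.
  rewrite (_ : (fun _ => _) = fun n => fine (g_ n [set z | word (size w).+1 z = rcons w false]) +
     fine (g_ n [set z | word (size w).+1 z = rcons w true])); first exact: cvgD.
  apply/funext => n; rewrite -fineD; [|exact: (fin_num_measure _ _ (@measurable_word R k _ _))..].
  rewrite -measureU; [|exact: measurable_word..|]; last first.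
    by apply/seteqP; split=> // z [wf]; rewrite /= wf => /rcons_inj[].
  congr (fine (g_ n _)); apply/seteqP; split=> z.
    move=> wz; rewrite /setU /= /word !dwordS; rewrite /= /word in wz; rewrite wz.
    by case: (digit _ z); [right|left].
  by rewrite /setU /= /word !dwordS => -[] /rcons_inj[].
- by move=> N w <-.
Qed.

(** The limit weights give a law [lam] on digit sequences. Each half of its digits has exactly the
    law of [code] under [mu] or [nu], since these marginals do not depend on [n]; hence almost every
    sequence is a pair of genuine codes, and decoding gives the coupling. *)
Lemma exists_limit_coupling : exists g, couplings mu nu g /\ forall N w, size w = N ->
  (fun n => fine (g_ n [set z | word N z = w])) @ U -->
    fine (g [set z | word N z = w]).
Proof.
have [p [p_nil p_ge0 p_rcons p_lim]] := exists_limit_word_law.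
have [lam [D [lam1 mD lamD]]] := exists_digit_law p_nil p_ge0 p_rcons.
have uniq_lim (f : nat -> R) (a b : R) : f @ U --> a -> f @ U --> b -> a = b.
  by move=> fa fb; apply: (cvg_unique _ fa fb); exact: Rhausdorff.
have lam_fin A : measurable A -> lam A \is a fin_num.
  move=> mA; rewrite ge0_fin_numE//; apply: (@le_lt_trans _ _ (lam setT)).
    by apply: le_measure; rewrite ?inE//; exact: measurableT.
  by rewrite lam1 ltry.
have limQ N (Q : pred (seq bool)) : (fun n => fine (g_ n [set z | Q (word N z)])) @ U -->
    fine (lam [set u | Q (dword D N u)]).
  rewrite (measure_dword mD).
  rewrite (_ : (fun _ => _) = fun n => \sum_(w : N.-tuple bool | Q w)
      fine (g_ n [set z | word N z = w])); last first.
    apply/funext => n; rewrite (measure_dword (@measurable_digit R k)) sum_fine//.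
    by move=> w _; exact: (fin_num_measure _ _ (@measurable_word R k _ _)).
  rewrite -sum_fine; last by move=> w _; rewrite lamD ?size_tuple.
  apply: (@cvg_big _ _ +%R 0 _ add_continuous) => w _.
  by rewrite lamD ?size_tuple//=; apply: p_lim; rewrite size_tuple.
(* A relation between finitely many digits that no pair of configurations satisfies has probability
   zero all along the sequence, hence under [lam]. *)
have lam_sure N (Q : pred (seq bool)) : (forall z : Gamma * Gamma, ~~ Q (word N z)) ->
    lam [set u | Q (dword D N u)] = 0%E.
  move=> nQ; have mQ : measurable [set u | Q (dword D N u)] by exact: measurable_dword_pred.
  rewrite -[LHS]fineK ?lam_fin//; congr EFin; apply: uniq_lim (limQ N Q) _.
  rewrite (_ : (fun _ => _) = fun=> 0); first exact: cvg_cst.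
  apply/funext => n; rewrite (_ : [set _ | _] = set0) ?measure0//.
  by apply/seteqP; split=> // z; apply/negP.
pose dc (c : bool) (u : measurableTypeR R) : Digits k :=
  fun i => D (pickle (c, i.1, i.2)) u.
have mdc c : measurable_fun setT (dc c).
  by apply: measurable_to_Digits => i; exact: mD.
pose muc (c : bool) := if c then mu else nu.
(* It suffices to compare on cylinders, where the left side is the limit of a constant sequence:
   each [g_ n] has the marginals [mu] and [nu]. *)
have lawE c A : measurable A -> lam (dc c @^-1` A) = muc c (@code R k @^-1` A).
  have [m1 m1E] := exists_pushforward lam (mdc c).
  have [m2 m2E] := exists_pushforward (muc c) (@measurable_code R k).
  rewrite -m1E -m2E; apply: Digits_prob_unique; first by rewrite m1E preimage_setT lam1 ltry.
  move=> s; rewrite m1E m2E.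
  pose N := (\max_(i <- s) pickle (c, i.1, i.2)).+1.
  have iN i : i \in s -> (pickle (c, i.1, i.2) < N)%N.
    by move=> si; rewrite ltnS (big_rem i)//= leq_maxl.
  pose Q (w : seq bool) := all (fun i : bidx k * nat => nth false w (pickle (c, i.1, i.2))) s.
  have -> : dc c @^-1` cyl s = [set u | Q (dword D N u)].
    apply/seteqP; split=> u /=; rewrite /cyl /Q /= => h.
      by apply/allP => i si; rewrite nth_dword ?iN//; exact: (allP h i si).
    by apply/allP => i si; have := allP h i si; rewrite nth_dword ?iN.
  have mQ : measurable [set u | Q (dword D N u)] by exact: measurable_dword_pred.
  have mC : measurable (@code R k @^-1` cyl s).
    by rewrite -[X in measurable X]setTI; apply: measurable_code => //; exact: measurable_cyl.
  rewrite -[LHS]fineK ?lam_fin// -[RHS]fineK ?fin_num_measure//; congr EFin.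
  apply: uniq_lim (limQ N Q) _.
  rewrite (_ : (fun _ => _) = fun=> fine (muc c (@code R k @^-1` cyl s))); first exact: cvg_cst.
  apply/funext => n; congr fine.
  have -> : [set z | Q (word N z)] =
      [set z : Gamma * Gamma | (@code R k @^-1` cyl s) (if c then z.1 else z.2)].
    have E z i : i \in s -> nth false (word N z) (pickle (c, i.1, i.2)) =
        code (if c then z.1 else z.2) i.
      by move=> si; rewrite nth_dword ?iN// digit_pickle.
    apply/seteqP; split=> z /=; rewrite /cyl /Q /= => h; apply/allP => i si.
      by rewrite -E//; exact: (allP h i si).
    by rewrite E//; exact: (allP h i si).
  by rewrite /muc; case: (c); [exact: coupling_fst|exact: coupling_snd].
pose Psi (u : measurableTypeR R) : Gamma * Gamma :=
  (decode R (dc true u), decode R (dc false u)).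
have mPsi : measurable_fun setT Psi.
  by apply: measurable_fun_pair; apply: measurableT_comp => //; exact: measurable_decode.
have [g gE] := exists_prob_pushforward mPsi lam1.
have decE c A : measurable A ->
    lam [set u | A (decode R (dc c u))] = muc c A.
  move=> mA; have mA' : measurable (@decode R k @^-1` A).
    by rewrite -[X in measurable X]setTI; exact: measurable_decode.
  rewrite (lawE c _ mA'); congr (muc c _).
  by apply/seteqP; split=> e; rewrite /= decode_code.
exists g; split; first by move=> A mA; rewrite !gE; split; [exact: (decE true)|exact: (decE false)].
(* Decoding and reading the digits again changes nothing almost surely, since [code \o decode] is
   the identity on genuine codes. *)
have dig_ae i : lam.-negligible [set u | D i u != digit i (Psi u)].
  have nQ N (Q : pred (seq bool)) : (forall z : Gamma * Gamma, ~~ Q (word N z)) ->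
      lam.-negligible [set u | Q (dword D N u)].
    by move=> /lam_sure h; apply/negligibleP => //; exact: measurable_dword_pred.
  case E: (@unpickle (bool * bidx k * nat)%type i) => [[[c b] m]|]; last first.
    apply: negligibleS (nQ i.+1 (fun w => nth false w i) _).
      by move=> u; rewrite /= nth_dword// /digit E; case: (D i u).
    by move=> z; rewrite nth_dword// /digit E.
  (* [i] decodes to the question [(c, b, m)] but need not be its number [i']; both digits ask the
     same question, hence agree almost surely. *)
  pose i' := pickle (c, b, m); pose N := (maxn i i').+1.
  have iN : (i < N)%N by rewrite ltnS leq_maxl.
  have i'N : (i' < N)%N by rewrite ltnS leq_maxr.
  pose Bad := [set d : Digits k | d (b, m) != code (decode R d) (b, m)].
  have mBad : measurable Bad.
    pose f1 (d : Digits k) := d (b, m); pose f2 (d : Digits k) := code (decode R d) (b, m).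
    have mf1 : measurable [set d | f1 d] by exact: measurable_dig.
    have mf2 : measurable [set d | f2 d].
      rewrite -[X in measurable X]setTI.
      have mc := measurableT_comp (@measurable_code R k) (@measurable_decode R k).
      by apply: (mc measurableT [set d : Digits k | d (b, m)]); exact: measurable_dig.
    rewrite (_ : Bad = ([set d | f1 d] `\` [set d | f2 d]) `|` ([set d | f2 d] `\` [set d | f1 d])).
      by apply: measurableU; exact: measurableD.
    apply/seteqP; split=> d; rewrite /Bad /setD /setU /= -/(f1 d) -/(f2 d).
      by case: (f1 d); case: (f2 d) => //= _; [left|right].
    by case: (f1 d); case: (f2 d) => //=; case=> -[].
  have Bad0 : lam.-negligible (dc c @^-1` Bad).
    apply/negligibleP; first by rewrite -[X in measurable X]setTI; exact: mdc.
    apply: etrans (lawE c _ mBad) _; rewrite (_ : _ @^-1` _ = set0) ?measure0//.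
    by apply/seteqP; split=> // e; rewrite /Bad /= decode_code eqxx.
  have Q0 : lam.-negligible [set u | D i u != D i' u].
    apply: negligibleS (nQ N (fun w => nth false w i != nth false w i') _).
      by move=> u; rewrite /= !nth_dword.
    by move=> z; rewrite !nth_dword// negbK /i' digit_pickle /digit E.
  apply: negligibleS (negligibleU Q0 Bad0) => u /=.
  rewrite /digit E => h.
  have [h1|h1] := eqVneq (D i u) (D i' u); last by left.
  right; move: h; rewrite h1 /i' /Bad /preimage /code /Psi /dc /mkset.
  by case: (c).
move=> N w sw.
suff -> : g [set z | word N z = w] = (p w)%:E by apply: p_lim.
rewrite gE -(lamD N w sw).
pose Bad := \bigcup_i [set u | D i u != digit i (Psi u)].
have [B [mB B0 BB]] : lam.-negligible Bad by exact: negligible_bigcup.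
have EB u : ~ B u -> word N (Psi u) = dword D N u.
  move=> nBu; apply/eq_map => i; apply/esym/eqP/negPn/negP => h; apply: nBu.
  by apply: BB; exists i.
have mA1 : measurable (Psi @^-1` [set z | word N z = w]).
  by rewrite -[X in measurable X]setTI; apply: mPsi => //; exact: measurable_word.
have mA2 : measurable [set u | dword D N u = w] by exact: measurable_dword.
have le12 (A1 A2 : set (measurableTypeR R)) : measurable A1 -> measurable A2 ->
    (forall u, ~ B u -> A1 u -> A2 u) -> (lam A1 <= lam A2)%E.
  move=> m1 m2 h; apply: (@le_trans _ _ (lam (A2 `|` B))).
    apply: le_measure; rewrite ?inE//; first exact: measurableU.
    by move=> u A1u; have [Bu|nBu] := pselect (B u); [right|left; exact: h].
  by rewrite measureU0.
by apply/eqP; rewrite eq_le; apply/andP; split; apply: le12 => // u /EB; rewrite /= => ->.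
Qed.

End LimitCoupling.


Section ExistenceOptimal.
Variables (R : realType) (k : nat).
Local Notation Gamma := (Gamma R k).
Implicit Types (z : Gamma * Gamma).

Local Notation all_cyl_cost := (cyl_cost (R := R) (k := k) setT).

(** The cap makes the value finite, so that the integral is a finite combination of word
    probabilities and passes to the limit. Word length and cap grow together, which recovers the
    cost as a monotone limit. *)
Definition cap_cost N (w : seq bool) : R :=
  fine (mine (all_cyl_cost N w) N%:R%:E).

Lemma cap_costE N w : (cap_cost N w)%:E = mine (all_cyl_cost N w) N%:R%:E.
Proof.
rewrite /cap_cost fineK// ge0_fin_numE; last by rewrite le_min cyl_cost_ge0 lee_fin ler0n.
by rewrite gt_min ltry orbT.
Qed.

Lemma cap_cost_ge0 N w : 0 <= cap_cost N w.
Proof. by rewrite -lee_fin cap_costE le_min cyl_cost_ge0 lee_fin ler0n. Qed.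

Lemma cap_cost_nd z N N' : (N <= N')%N ->
  ((cap_cost N (word N z))%:E <= (cap_cost N' (word N' z))%:E)%E.
Proof.
move=> NN'; rewrite !cap_costE le_min !ge_min cyl_cost_nd//= lee_fin ler_nat NN' orbT.
by [].
Qed.

Lemma cap_cost_le N z : ((cap_cost N (word N z))%:E <= cost z.1 z.2)%E.
Proof. by rewrite cap_costE ge_min costE cyl_cost_le. Qed.

Lemma cap_cost_sup z :
  cost z.1 z.2 = ereal_sup (range (fun N => (cap_cost N (word N z))%:E)).
Proof.
apply/eqP; rewrite eq_le; apply/andP; split; last first.
  by apply: ge_ereal_sup => _ [N _ <-]; exact: cap_cost_le.
case: z => e o /=; rewrite costE (cyl_cost_sup _ _ closedT).
apply: ge_ereal_sup => _ [N _ <-]; set S := ereal_sup _.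
have key (A : R) : (A%:E <= all_cyl_cost N (word N (e, o)))%E -> (A%:E <= S)%E.
  (* [M] is so large that the cap does not fall below [A]. *)
  move=> Ac; pose M := maxn N (Num.truncn A).+1.
  apply: (@le_trans _ _ (cap_cost M (word M (e, o)))%:E); last first.
    by apply: ereal_sup_ubound; exists M.
  rewrite cap_costE le_min; apply/andP; split.
    apply: (@le_trans _ _ (all_cyl_cost N (word N (e, o)))) => //.
    exact: (@cyl_cost_nd R k setT N M (e, o) (leq_maxl _ _)).
  by rewrite lee_fin (le_trans (ltW (truncnS_gt A)))// ler_nat leq_maxr.
case E : (all_cyl_cost N (word N (e, o))) => [r| |].
- by apply: key; rewrite E.
- rewrite leye_eq; apply/eqP/eqyP => A _; apply: key; rewrite E; exact: leey.
- exact: leNye.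
Qed.

Lemma mk_cost_ge0 (g : probability (Gamma * Gamma)%type R) : (0 <= mk_cost g)%E.
Proof. by apply: integral_ge0 => z _; exact: cost_ge0. Qed.

Lemma measurable_cap_cost N : measurable_fun setT (fun z => (cap_cost N (word N z))%:E).
Proof. exact: (@measurable_fun_word R k _ _ N (fun w => (cap_cost N w)%:E)). Qed.

Lemma mk_cost_le (g : probability (Gamma * Gamma)%type R) (I : \bar R) :
  (forall N, (\int[g]_z (cap_cost N (word N z))%:E <= I)%E) -> (mk_cost g <= I)%E.
Proof.
move=> h; rewrite /mk_cost.
have -> : (\int[g]_z cost z.1 z.2 = \int[g]_z limn (fun N => (cap_cost N (word N z))%:E))%E.
  apply: eq_integral => z _; apply/esym/cvg_lim => //; rewrite cap_cost_sup.
  by apply: ereal_nondecreasing_cvgn => N N'; exact: cap_cost_nd.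
rewrite monotone_convergence//.
- apply: lime_le; last by apply: nearW => N; exact: h.
  apply: ereal_nondecreasing_is_cvgn => N N' NN'; apply: ge0_le_integral => //.
  + by move=> z _; rewrite lee_fin cap_cost_ge0.
  + exact: measurable_cap_cost.
  + exact: measurable_cap_cost.
  + by move=> z _; exact: cap_cost_nd.
- by move=> N; exact: measurable_cap_cost.
- by move=> N z _; rewrite lee_fin cap_cost_ge0.
- by move=> z _ N N'; exact: cap_cost_nd.
Qed.

(** For the limit of a minimizing sequence, the integral of each capped cost is at most the infimum;
    monotone convergence then bounds the full cost. *)
Lemma exists_optimal (mu nu : probability Gamma R) :
  (ereal_inf [set mk_cost g | g in couplings mu nu] < +oo)%E ->
  exists g, optimal mu nu g.
Proof.
set I := ereal_inf _ => Ioo.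
have I0 : (0 <= I)%E by apply: le_ereal_inf_tmp => _ [g _ <-]; exact: mk_cost_ge0.
have Ifin : I \is a fin_num by rewrite ge0_fin_numE.
have /choice[g_ gP] : forall n : nat, exists g, couplings mu nu g /\
    (mk_cost g <= (fine I + n.+1%:R^-1)%:E)%E.
  move=> n; have : (I < (fine I + n.+1%:R^-1)%:E)%E.
    by rewrite EFinD fineK// lteDl// lte_fin invr_gt0.
  by move=> /ereal_inf_lt[_ [g cg <-] /ltW h]; exists g.
have [U [UU oU]] := @ultraFilterLemma nat \oo _.
have PU : ProperFilter U by exact: ultra_proper.
have [g [cg glim]] := exists_limit_coupling UU (fun n => (gP n).1).
exists g; split=> // g' cg'; apply: (@le_trans _ _ I); last by apply: ereal_inf_lbound; exists g'.
apply: mk_cost_le => N.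
have mw w : measurable [set z : Gamma * Gamma | word N z = w] by exact: measurable_word.
have intE (m : probability (Gamma * Gamma)%type R) : (\int[m]_z (cap_cost N (word N z))%:E =
    (\sum_(w : N.-tuple bool) cap_cost N w * fine (m [set z | word N z = w]))%:E)%E.
  rewrite (integral_dword (@measurable_digit R k) m N (cap_cost_ge0 N)) -sumEFin.
  by apply: eq_bigr => w _; rewrite EFinM; congr (_ * _)%E; apply/esym/fineK/fin_num_measure.
rewrite intE -[I]fineK// lee_fin; apply/ler_addgt0Pr => eps eps0.
have clim : (fun n => \sum_(w : N.-tuple bool)
      cap_cost N w * fine (g_ n [set z | word N z = w])) @ U -->
    \sum_(w : N.-tuple bool) cap_cost N w * fine (g [set z | word N z = w]).
  apply: (@cvg_big _ _ +%R 0 xpredT add_continuous) => w _.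
  by apply: cvgMr; apply: glim; rewrite size_tuple.
apply: (cvgr_to_le clim).
have : \forall n \near \oo, n.+1%:R^-1 < (PosNum eps0)%:num.
  exact: near_infty_natSinv_lt.
move=> /oU; apply: filterS => n /= neps.
have [_ h1] := gP n; rewrite -lee_fin -intE.
apply: (@le_trans _ _ (mk_cost (g_ n))).
  apply: ge0_le_integral => //.
  - by move=> z _; rewrite lee_fin cap_cost_ge0.
  - exact: measurable_cap_cost.
  - exact: measurable_cost.
  - by move=> z _; exact: cap_cost_le.
by rewrite (le_trans h1)// lee_fin lerD2l ltW.
Qed.

End ExistenceOptimal.


(** * Flows supported in a box *)

Section SmoothFunctions.
Variable R : realType.
Implicit Types (f g : R -> R) (n : nat).

(** [n] successive derivatives exist, with no continuity asked of the last one. Continuity comes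
    from the next order, so nothing is lost in [smooth1]. *)
Fixpoint Cn n g : Prop :=
  if n is n'.+1 then exists g', (forall x : R, is_derive x 1 g (g' x)) /\ Cn n' g' else True.

Definition smooth1 g := forall n, Cn n g.

Lemma Cn_pred n g : Cn n.+1 g -> Cn n g.
Proof.
elim: n g => // n IH g [g' [dg cg']]; exists g'; split=> //.
exact: IH.
Qed.

Lemma CnD n f g : Cn n f -> Cn n g -> Cn n (fun x => f x + g x).
Proof.
elim: n f g => // n IH f g [f' [df cf]] [g' [dg cg]].
exists (fun x => f' x + g' x); split; last exact: IH.
by move=> x; exact: is_deriveD.
Qed.

Lemma CnM n f g : Cn n f -> Cn n g -> Cn n (fun x => f x * g x).
Proof.
elim: n f g => // n IH f g cf cg.
have cf0 := Cn_pred cf; have cg0 := Cn_pred cg.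
case: cf => f' [df cf]; case: cg => g' [dg cg].
exists (fun x => f x * g' x + g x * f' x); split; last by apply: CnD; exact: IH.
by move=> x; exact: is_deriveM.
Qed.

Lemma Cn_cst n (c : R) : Cn n (fun=> c).
Proof.
elim: n c => // n IH c; exists (fun=> 0); split; last exact: IH.
by move=> x; exact: is_derive_cst.
Qed.

Lemma Cn_affine n f (a c : R) : Cn n f -> Cn n (fun x => f (a * x + c)).
Proof.
elim: n f => // n IH f [f' [df cf]].
exists (fun x => f' (a * x + c) * a); split; last by apply: CnM; [exact: IH|exact: Cn_cst].
move=> x; apply: (@is_derive1_comp _ f (fun x => a * x + c)).
have h : is_derive x 1 ((a \*: id) + cst c : R -> R) (a *: 1 + 0) by apply: is_deriveD.
by move: h; rewrite addr0 /GRing.scale /= mulr1.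
Qed.

Lemma CnV n f : (forall x, f x != 0) -> Cn n f -> Cn n (fun x => (f x)^-1).
Proof.
move=> f0; elim: n => // n IH cf; have /IH cV := Cn_pred cf.
case: cf => f' [df cf].
exists (fun x => -1 * (((f x)^-1 * (f x)^-1) * f' x)); split; last first.
  by apply: CnM; [exact: Cn_cst|apply: CnM => //; exact: CnM].
move=> x; have h := is_deriveV (f0 x) (df x); apply: is_derive_eq h _.
by rewrite /GRing.scale /= mulN1r mulNr expr2 invfM.
Qed.

Lemma smooth1_continuous f : smooth1 f -> continuous f.
Proof.
move=> /(_ 1%N)[f' [df _]] x; apply: differentiable_continuous.
by apply/derivable1_diffP; have [] := df x.
Qed.

(** [flat n y = y^-n exp(-1/y)] for [y > 0]; these functions are stable under derivation. *)
Definition flat n (y : R) : R := if 0 < y then y ^- n * expR (- y^-1) else 0.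

Lemma flat_ge0 n y : 0 <= flat n y.
Proof.
by rewrite /flat; case: ifP => // y0; rewrite mulr_ge0 ?expR_ge0// invr_ge0 exprn_ge0// ltW.
Qed.

Lemma flat_gt0 n y : 0 < y -> 0 < flat n y.
Proof. by move=> y0; rewrite /flat y0 mulr_gt0 ?expR_gt0// invr_gt0 exprn_gt0. Qed.

(** With [t = 1/y], the number [expR t] is the power [n.+1] of [expR (t / n.+1)], which is at least
    [t / n.+1]. The bound serves for the derivative at 0. *)
Lemma flat_le n y : flat n y <= (n.+1%:R ^+ n.+1) * `|y|.
Proof.
rewrite /flat; case: ifPn => [y0|_]; last by rewrite mulr_ge0// exprn_ge0.
rewrite (gtr0_norm y0) expRN; set t := y^-1; have t0 : 0 < t by rewrite invr_gt0.
have -> : y ^- n = t ^+ n by rewrite exprVn.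
have h : t ^+ n.+1 <= n.+1%:R ^+ n.+1 * expR t.
  have -> : expR t = expR (t / n.+1%:R) ^+ n.+1.
    by rewrite -expRM_natl mulrC divfK// pnatr_eq0.
  rewrite -exprMn lerXn2r ?nnegrE ?mulr_ge0 ?expR_ge0 ?(ltW t0)//.
  rewrite mulrC -ler_pdivrMr ?ltr0n//.
  by apply: le_trans (expR_ge1Dx _); rewrite lerDr.
rewrite ler_pdivrMr ?expR_gt0//.
have -> : t ^+ n = t ^+ n.+1 * y by rewrite exprSr -mulrA mulVf ?mulr1// gt_eqF.
by rewrite mulrAC ler_pM2r.
Qed.

Lemma flatS n y : flat n y = flat n.+1 y * y.
Proof.
rewrite /flat; case: ifP => [y0|_]; last by rewrite mul0r.
have y0' : y != 0 by rewrite gt_eqF.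
have Y0 : y ^+ n != 0 by rewrite expf_neq0.
by rewrite exprS; field; rewrite y0' Y0.
Qed.

Lemma is_derive_flat n (x : R) : is_derive x 1 (flat n) (flat n.+2 x - n%:R * flat n.+1 x).
Proof.
have [x0|x0|->] := ltgtP x 0.
- have -> : flat n.+2 x - n%:R * flat n.+1 x = 0.
    by rewrite /flat ltNge (ltW x0) mulr0 subr0.
  apply: (@near_eq_is_derive _ _ _ (cst (0 : R))).
  by near=> y; rewrite /flat ltNge ltW//; near: y; exact: lt_nbhsl.
- have h : is_derive x 1 ((fun y : R => (y ^+ n)^-1) * (fun y => expR (- y^-1)))
      (flat n.+2 x - n%:R * flat n.+1 x).
    have xn0 : x != 0 by rewrite gt_eqF.
    have h1 : is_derive x 1 (fun y : R => (y ^+ n)^-1) (- (x ^+ n) ^- 2 *: ((n%:R * x ^+ n.-1) *: 1)).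
      apply: (@is_deriveV _ (fun y : R => y ^+ n)); first by rewrite expf_neq0.
      have hX := @is_deriveX _ _ (id : R -> R) n x 1 1 (is_derive_id _ _).
      rewrite exprfctE in hX; exact: hX.
    have h2 : is_derive x 1 (fun y : R => - y^-1) (- (- x ^- 2 *: 1)).
      apply: (@is_deriveN _ _ _ (fun y : R => y^-1)).
      exact: (@is_deriveV _ id).
    have h3 : is_derive x 1 (expR \o (fun y : R => - y^-1)) (expR (- x^-1) * (- (- x ^- 2 *: 1))).
      exact: is_derive1_comp.
    apply: is_derive_eq (is_deriveM h1 h3) _.
    rewrite /flat x0 /GRing.scale /= !mulr1 !opprK.
    case: n {h1} => [|n].
      rewrite !expr0 !mul0r mulr0 mulr0 subr0 addr0 invr1 mul1r mulrC.
      by [].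
    rewrite /= !exprS; set Y := x ^+ n; set e := expR _.
    have Y0 : Y != 0 by rewrite expf_neq0.
    by field; rewrite xn0 Y0.
  apply: near_eq_is_derive h; near=> y.
  by rewrite /flat ifT//; near: y; exact: lt_nbhsr.
- have -> : flat n.+2 0 - n%:R * flat n.+1 0 = 0 by rewrite /flat ltxx mulr0 subr0.
  (* By [flatS] the difference quotient of [flat n] at 0 is [flat n.+1], which tends to 0. *)
  apply/is_derive1_caratheodory; exists (flat n.+1); split.
  + by move=> z; rewrite subr0 -flatS /flat ltxx subr0.
  + suff : flat n.+1 @ (0 : R) --> (0 : R) by rewrite -[X in _ --> X -> _](_ : flat n.+1 0 = 0)// /flat ltxx.
    apply/cvgr0Pnorm_lt => e e0; near=> z; rewrite ger0_norm ?flat_ge0//.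
    apply: le_lt_trans (flat_le _ _) _; rewrite mulrC -ltr_pdivlMr ?exprn_gt0//.
    by near: z; apply: (@pseudometric_normed_Zmodule.nbhs0_lt R R); rewrite divr_gt0// exprn_gt0.
  + by rewrite /flat ltxx.
Unshelve. all: by end_near. Qed.

Lemma smooth1_flat n : smooth1 (flat n).
Proof.
move=> m; elim: m n => // m IH n.
exists (fun x => flat n.+2 x + (- n%:R) * flat n.+1 x); split.
  by move=> x; rewrite mulNr; exact: is_derive_flat.
by apply: CnD => //; apply: CnM => //; exact: Cn_cst.
Qed.

End SmoothFunctions.


(** * An explicit compactly supported flow on the line *)

Section LineFlow.
Variables (R : realType) (l r : R).
Hypothesis lr : l < r.

(** The factor [y * y] is there so that, for [y > 0], the reciprocal of [edge] is [exp(1/y) / y^2],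
    the derivative of [- exp(1/y)]. *)
Definition edge (y : R) : R := y * y * flat 0 y.

Lemma edge_gt0 y : 0 < y -> 0 < edge y.
Proof. by move=> y0; rewrite /edge mulr_gt0 ?flat_gt0// mulr_gt0. Qed.

Lemma edge0 y : y <= 0 -> edge y = 0.
Proof. by move=> y0; rewrite /edge /flat ltNge y0 mulr0. Qed.

Lemma edge_ge0 y : 0 <= edge y.
Proof. by case: (ltP 0 y) => [/edge_gt0/ltW//|/edge0 ->]. Qed.

Lemma edgeE y : 0 < y -> edge y = y ^+ 2 / expR (y^-1).
Proof. by move=> y0; rewrite /edge /flat y0 expr0 invr1 mul1r expRN expr2. Qed.

Lemma edge_sum_gt0 y : 0 < edge (r - y) + edge (y - l).
Proof.
case: (ltP y r) => yr.
  by rewrite ltr_wpDr ?edge_ge0// edge_gt0// subr_gt0.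
by rewrite ltr_wpDl ?edge_ge0// edge_gt0// subr_gt0 (lt_le_trans lr).
Qed.

(** A bump function whose reciprocal has the elementary primitive [slope] on ]l, r[. *)
Definition bump (y : R) : R := edge (r - y) * edge (y - l) * (edge (r - y) + edge (y - l))^-1.

Lemma bump_gt0 y : l < y < r -> 0 < bump y.
Proof.
move=> /andP[ly yr]; rewrite /bump mulr_gt0 ?invr_gt0 ?edge_sum_gt0//.
by rewrite mulr_gt0 ?edge_gt0 ?subr_gt0.
Qed.

Lemma bump0 y : ~~ (l < y < r) -> bump y = 0.
Proof.
rewrite negb_and -!leNgt => /orP[yl|ry]; rewrite /bump.
  by rewrite (edge0 (y := y - l)) ?subr_le0// mulr0 mul0r.
by rewrite (edge0 (y := r - y)) ?subr_le0// !mul0r.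
Qed.

Lemma smooth1_bump : smooth1 bump.
Proof.
move=> n.
have ce : Cn n edge.
  apply: CnM; last exact: smooth1_flat.
  have := Cn_affine 1 0 (Cn_cst n (0 : R)).
  have cid : Cn n (fun y : R => y).
    case: n => // n; exists (fun=> 1); split; first by move=> x; exact: is_derive_id.
    exact: Cn_cst.
  by move=> _; exact: CnM.
have c1 : Cn n (fun y => edge (r - y)).
  have := Cn_affine (-1) r ce; congr (Cn _ _); apply/funext => y.
  by rewrite mulN1r addrC.
have c2 : Cn n (fun y => edge (y - l)).
  have := Cn_affine 1 (- l) ce; congr (Cn _ _); apply/funext => y.
  by rewrite mul1r.
apply: CnM; first exact: CnM.
by apply: CnV; [move=> y; rewrite gt_eqF// edge_sum_gt0|exact: CnD].
Qed.

(** The coordinate that straightens the flow: a solution of [y' = bump y] inside []l, r[] satisfies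
    [slope (y t) = slope (y 0) + t]. *)
Definition slope (y : R) : R := expR (r - y)^-1 - expR (y - l)^-1.

Lemma is_derive_slope y : l < y < r -> is_derive y 1 slope (bump y)^-1.
Proof.
move=> /andP[ly yr].
have ry0 : r - y != 0 by rewrite gt_eqF// subr_gt0.
have yl0 : y - l != 0 by rewrite gt_eqF// subr_gt0.
have d1 : is_derive y 1 (fun z : R => r - z) (-1).
  have h := @is_deriveB _ _ _ (cst r) id y 1 0 1 (is_derive_cst _ _ _) (is_derive_id _ _).
  by rewrite sub0r in h; exact: h.
have d2 : is_derive y 1 (fun z : R => z - l) 1.
  have h := @is_deriveB _ _ _ id (cst l) y 1 1 0 (is_derive_id _ _) (is_derive_cst _ _ _).
  by rewrite subr0 in h; exact: h.
have d1' : is_derive y 1 (fun z : R => (r - z)^-1) (- (r - y) ^- 2 *: (-1)).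
  exact: (@is_deriveV _ (fun z => r - z)).
have d2' : is_derive y 1 (fun z : R => (z - l)^-1) (- (y - l) ^- 2 *: 1).
  exact: (@is_deriveV _ (fun z => z - l)).
have e1 : is_derive y 1 (expR \o (fun z : R => (r - z)^-1)) (expR (r - y)^-1 * (- (r - y) ^- 2 *: (-1))).
  exact: is_derive1_comp.
have e2 : is_derive y 1 (expR \o (fun z : R => (z - l)^-1)) (expR (y - l)^-1 * (- (y - l) ^- 2 *: 1)).
  exact: is_derive1_comp.
apply: is_derive_eq (is_deriveB e1 e2) _.
rewrite /bump !edgeE ?subr_gt0// /GRing.scale /=.
set A := expR _; set B := expR _.
have A0 : A != 0 by rewrite gt_eqF// expR_gt0.
have B0 : B != 0 by rewrite gt_eqF// expR_gt0.
have S0 : (r - y) ^+ 2 * B + (y - l) ^+ 2 * A != 0.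
  rewrite gt_eqF// addr_gt0// mulr_gt0 ?expR_gt0// exprn_even_gt0//.
by field; rewrite A0 B0 S0 ry0 yl0.
Qed.

Lemma slope_lt y z : l < y -> y < z -> z < r -> slope y < slope z.
Proof.
move=> ly yz zr; apply: ltrB.
  by rewrite ltr_expR ltf_pV2 ?posrE; lra.
by rewrite ltr_expR ltf_pV2 ?posrE; lra.
Qed.

Lemma slope_inj y z : l < y < r -> l < z < r -> slope y = slope z -> y = z.
Proof.
move=> /andP[ly yr] /andP[lz zr] yz; case: (ltgtP y z) => // h.
  by have := slope_lt ly h zr; rewrite yz ltxx.
by have := slope_lt lz h yr; rewrite yz ltxx.
Qed.

Lemma slope_continuous y : l < y < r -> {for y, continuous slope}.
Proof.
move=> /is_derive_slope[dy _]; apply: differentiable_continuous.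
exact/derivable1_diffP.
Qed.

Lemma slope_surj t : exists y, l < y < r /\ slope y = t.
Proof.
have rl0 : 0 < r - l by rewrite subr_gt0.
pose K := expR (2 / (r - l)); have K0 : 0 < K by exact: expR_gt0.
have w0 : 0 < 2 / (r - l) by rewrite divr_gt0.
have n0 := normr_ge0 t.
(* At [r - d] the first exponential is [expR D >= 1 + D] and the second one is at most [K], because
   [d <= (r - l) / 2]; so [slope (r - d)] is at least the absolute value of [t]. Antisymmetry about
   the midpoint handles [l + d]. *)
pose D := 2 / (r - l) + `|t| + K; pose d := D^-1.
have D0 : 0 < D by rewrite /D; lra.
have d0 : 0 < d by rewrite invr_gt0.
have dl : d <= (r - l) / 2.
  by rewrite -[leRHS]invrK lef_pV2 ?posrE ?invr_gt0 ?divr_gt0// invf_div /D; lra.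
have h1 : `|t| <= slope (r - d).
  rewrite /slope opprB addrCA subrr addr0 invrK.
  have : 1 + D <= expR D by exact: expR_ge1Dx.
  have : expR (r - d - l)^-1 <= K.
    rewrite ler_expR -[leRHS]invrK lef_pV2 ?posrE ?invr_gt0 ?divr_gt0//; last lra.
    by rewrite invf_div; lra.
  by rewrite /D; lra.
have h2 : slope (l + d) = - slope (r - d).
  by rewrite /slope opprB; congr (expR _^-1 - expR _^-1); ring.
have : Num.min (slope (l + d)) (slope (r - d)) <= t <= Num.max (slope (l + d)) (slope (r - d)).
  have /andP[? ?] : - `|t| <= t <= `|t| by rewrite -ler_norml.
  by rewrite ge_min le_max h2; apply/andP; split; apply/orP; [left|right]; lra.
move=> /IVT[||c]; first lra.
  apply: continuous_in_subspaceT => y; rewrite inE /= in_itv /= => /andP[? ?].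
  by apply: slope_continuous; apply/andP; split; lra.
rewrite in_itv /= => /andP[? ?] ct; exists c; split=> //.
by apply/andP; split; lra.
Qed.

(** With [P] the inverse of [slope], the flow inside the interval is [P (slope y + t)]. Joint
    continuity in time and position is included because, in a box, the time will depend on the other
    coordinates. *)
Lemma exists_line_flow : exists F : R -> R -> R,
  [/\ [/\ forall y, F 0 y = y, forall t s y, F (t + s) y = F t (F s y),
          forall t y, ~~ (l < y < r) -> F t y = y &
          forall t y, l < y < r -> l < F t y < r],
      forall (t : R) y, is_derive t 1 (F ^~ y) (bump (F t y)),
      forall t y, 0 < t -> l < y < r -> y < F t y &
      forall t y, l < y < r -> {for (t, y), continuous (fun q : R * R => F q.1 q.2)}].
Proof.
have /choice[P PP] := slope_surj.
have Pitv t : l < P t < r by have [] := PP t.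
have Pslope t : slope (P t) = t by have [] := PP t.
have slopeP y : l < y < r -> P (slope y) = y.
  by move=> ly; apply: slope_inj; rewrite ?Pslope.
have dP (t : R) : is_derive t 1 P (bump (P t)).
  have ly := Pitv t.
  have nearitv : \forall z \near P t, l < z < r.
    by case/andP: ly => ? ?; near=> z; apply/andP; split; near: z; [exact: lt_nbhsr|exact: lt_nbhsl].
  rewrite -[X in is_derive X _ _ _](Pslope t) -[bump _]invrK.
  apply: is_derive_inverse.
  - by apply: filterS nearitv => z; exact: slopeP.
  - by apply: filterS nearitv => z; exact: slope_continuous.
  - exact: is_derive_slope.
  - by rewrite invr_eq0 gt_eqF// bump_gt0.
have cP : continuous P.
  by move=> t; apply: differentiable_continuous; apply/derivable1_diffP; have [] := dP t.
exists (fun t y => if l < y < r then P (slope y + t) else y); split.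
- split.
  + by move=> y; case: ifP => // ly; rewrite addr0 slopeP.
  + move=> t s y; case: ifP => [ly|->//]; rewrite Pitv Pslope.
    by rewrite [t + s]addrC addrA.
  + by move=> t y /negbTE ->.
  + by move=> t y ly; rewrite ly.
- move=> t y; case: ifPn => ly; last by rewrite bump0//; exact: is_derive_cst.
  have h : is_derive t 1 (P \o (fun s => slope y + s)) (bump (P (slope y + t)) * 1).
    apply: is_derive1_comp.
    have h := @is_deriveD _ _ _ (cst (slope y)) id t 1 0 1 (is_derive_cst _ _ _) (is_derive_id _ _).
    by rewrite add0r in h; exact: h.
  by rewrite mulr1 in h; exact: h.
- move=> t y t0 ly; rewrite ly ltNge; apply/negP => h.
  have /andP[lP Pr] := Pitv (slope y + t); have /andP[? ?] := ly.
  have : slope (P (slope y + t)) <= slope y.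
    move: h; rewrite le_eqVlt => /orP[/eqP ->//|h].
    exact/ltW/slope_lt.
  by rewrite Pslope; lra.
- move=> t y ly; rewrite /prop_for /continuous_at /= ly.
  have nearitv : \forall z \near y, l < z < r.
    by case/andP: ly => ? ?; near=> z; apply/andP; split; near: z; [exact: lt_nbhsr|exact: lt_nbhsl].
  have cE : (fun q : R * R => P (slope q.2 + q.1)) @ (t, y) --> P (slope y + t).
    apply: (@cvg_comp _ _ _ (fun q : R * R => slope q.2 + q.1) P _ (nbhs (slope y + t))); last exact: cP.
    apply: cvgD; last exact: cvg_fst.
    apply: (@cvg_comp _ _ _ (fun q : R * R => q.2) slope _ (nbhs y)); first exact: cvg_snd.
    exact: slope_continuous.
  apply: cvg_trans cE; apply: near_eq_cvg.
  have : \forall q \near (t, y), l < q.2 < r.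
    exact: (cvg_snd nearitv).
  by apply: filterS => q ->.
Unshelve. all: by end_near. Qed.

End LineFlow.


Lemma smooth1_derive (R : realType) (g : R -> R) : smooth1 g ->
  exists g', (forall x : R, is_derive x 1 g (g' x)) /\ smooth1 g'.
Proof.
move=> sg; have [g' [dg _]] := sg 1%N; exists g'; split=> // n.
have [g'' [dg2 cg2]] := sg n.+1; suff -> : g' = g'' by [].
by apply/funext => x; have [_ <-] := dg x; have [_ <-] := dg2 x.
Qed.

Section BoxFlow.
Variables (R : realType) (k : nat) (b : bidx k) (j : 'I_k).
Hypothesis b_ne : forall i, b.1 i < b.2 i.
Local Notation X := (X R k).

Let lr i : (ratr (b.1 i) : R) < ratr (b.2 i).
Proof. by rewrite ltr_rat. Qed.

Definition tens (g : 'I_k -> R -> R) (x : X) : X := (\prod_i g i (x ord0 i)) *: unitv R j.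

Lemma is_derive_tens (g : 'I_k -> R -> R) i (x : X) (d : R) :
  is_derive (x ord0 i) 1 (g i) d ->
  is_derive x (unitv R i) (tens g)
    ((d * \prod_(i' | i' != i) g i' (x ord0 i')) *: unitv R j).
Proof.
set C := \prod_(i' | _) _ => -[dg gd].
have cg : (fun h : R => h^-1 *: ((g i \o shift (x ord0 i)) (h *: (1 : R)) - g i (x ord0 i))) @ 0^' --> d.
  by rewrite -gd; exact: dg.
have c : (fun h : R => h^-1 *: ((tens g \o shift x) (h *: unitv R i) - tens g x)) @ 0^'
    --> (d * C) *: unitv R j.
  rewrite (_ : (fun _ => _) = fun h : R =>
      (h^-1 *: ((g i \o shift (x ord0 i)) (h *: (1 : R)) - g i (x ord0 i)) * C) *: unitv R j).
    by apply: cvgZr_tmp; apply: cvgMl.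
  apply/funext => h; rewrite /tens /= -scalerBl scalerA; congr (_ *: _).
  rewrite (bigD1 i)//= [X in _ - X](bigD1 i)//= -/C.
  have -> : \prod_(i' < k | i' != i) g i' ((h *: unitv R i + x) ord0 i') = C.
    apply: eq_bigr => i' i'i; rewrite !mxE /= (negbTE i'i) ?andbF mulr0 add0r.
    by [].
  by rewrite !mxE !eqxx /= -mulrBl /GRing.scale /= mulrA.
split; first by apply/cvg_ex; eexists; exact: c.
by apply: cvg_lim c; exact: norm_hausdorff.
Qed.

(** A partial derivative differentiates a single factor, so products of one-variable functions along
    a fixed direction form a stable class, and all orders follow by induction. *)
Lemma pder_tens g s : (forall i, smooth1 (g i)) ->
  exists g', (forall i, smooth1 (g' i)) /\ pder s (tens g) = tens g'.
Proof.
elim: s => [|i s IH] sg; first by exists g.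
have [g1 [sg1 pE]] := IH sg.
have [d [dg sd]] := smooth1_derive (sg1 i).
exists (fun i' => if i' == i then d else g1 i'); split; first by move=> i'; case: ifP.
apply/funext => x /=; rewrite pE.
have [_ ->] := is_derive_tens (dg (x ord0 i)); rewrite /tens; congr (_ *: _).
rewrite [RHS](bigD1 i)//= eqxx; congr (_ * _).
by apply: eq_bigr => i' /negbTE ->.
Qed.

Lemma tens_continuous g : (forall i, smooth1 (g i)) -> continuous (tens g).
Proof.
move=> sg x.
have h : (fun y : X => \prod_i g i (y ord0 i)) @ x --> \prod_i g i (x ord0 i).
  have mc : continuous (fun z : R * R => z.1 * z.2) by exact: mul_continuous.
  apply: (cvg_big mc (Ff := fun i (y : X) => g i (y ord0 i)) (F := nbhs x)) => i _.
  apply: (@cvg_comp _ _ _ (fun y : X => y ord0 i) (g i) _ (nbhs (x ord0 i))).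
    exact: coord_continuous.
  exact: smooth1_continuous.
exact: cvgZr_tmp h.
Qed.

Lemma tens_derivable g : (forall i, smooth1 (g i)) ->
  forall i x, derivable (tens g) x (unitv R i).
Proof.
move=> sg i x; have [d [dg _]] := smooth1_derive (sg i).
by have [] := is_derive_tens (dg (x ord0 i)).
Qed.

Lemma smooth_tens g : (forall i, smooth1 (g i)) -> smooth (tens g).
Proof.
move=> sg s; have [g' [sg' ->]] := pder_tens s sg.
by split; [exact: tens_derivable|exact: tens_continuous].
Qed.

Definition box_bump (i : 'I_k) : R -> R := bump (ratr (b.1 i)) (ratr (b.2 i)).

Definition box_field : X -> X := tens box_bump.

Lemma smooth_box_field : smooth box_field.
Proof. by apply: smooth_tens => i; apply: smooth1_bump; exact: lr. Qed.

Lemma box_field0 x : ~ box b x -> box_field x = 0.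
Proof.
move=> /existsNP[i /negP nb]; rewrite /box_field /tens (bigD1 i)//= /box_bump bump0 ?mul0r ?scale0r//.
Qed.

Lemma compact_support_box_field : compact_support box_field.
Proof.
have cb : compact (cbox b : set X) by exact: cbox_compact.
have clb : closed (cbox b : set X) :=  (compact_closed (@X_hausdorff R k) cb).
apply: (subclosed_compact (@closed_closure _ _) cb).
rewrite [X in _ `<=` X](closure_id _).1//; apply: closure_subset => x /= /eqP nx.
by apply: box_sub_cbox; apply: contrapT => /box_field0.
Qed.

End BoxFlow.


Section BoxFlowExistence.
Variables (R : realType) (k : nat) (b : bidx k) (j : 'I_k).
Hypothesis b_ne : forall i, b.1 i < b.2 i.
Local Notation X := (X R k).

Let lr i : (ratr (b.1 i) : R) < ratr (b.2 i).
Proof. by rewrite ltr_rat. Qed.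

(** Only coordinate [j] moves, so the product [s] of the other bumps is constant along a trajectory.
    On each line the field is a constant [s x] times a one-dimensional bump, and its flow is the
    line flow at time [t * s x]. *)
Lemma exists_box_flow : exists V : R -> X -> X,
  [/\ [/\ is_flow (@box_field R k b j) V, forall t s x, V (t + s) x = V t (V s x),
          forall t x, ~ box b x -> V t x = x & forall t x, box b x -> box b (V t x)],
      forall t x, 0 < t -> box b x -> exists d, 0 < d /\ V t x = x + d *: unitv R j &
      forall t B, borelX B -> borelX (V t @^-1` B)].
Proof.
have [F [[F0 FD Fout Fin] dF Fpos Fcont]] := exists_line_flow (lr j).
pose s (x : X) : R := \prod_(i | i != j) box_bump b i (x ord0 i).
pose V (t : R) (x : X) : X :=
  if `[< box b x >] then x + (F (t * s x) (x ord0 j) - x ord0 j) *: unitv R j else x.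
have Vin t x : box b x -> V t x = x + (F (t * s x) (x ord0 j) - x ord0 j) *: unitv R j.
  by move=> bx; rewrite /V asboolT.
have Vout t x : ~ box b x -> V t x = x by move=> bx; rewrite /V asboolF.
have Vj t x : box b x -> (V t x) ord0 j = F (t * s x) (x ord0 j).
  by move=> bx; rewrite Vin// !mxE !eqxx mulr1 addrC subrK.
have Vi t x i : i != j -> (V t x) ord0 i = x ord0 i.
  move=> ij; have [bx|bx] := pselect (box b x); last by rewrite Vout.
  by rewrite Vin// !mxE /= (negbTE ij) ?andbF mulr0 addr0.
have sV t x : s (V t x) = s x by apply: eq_bigr => i ij; rewrite Vi.
have Vbox t x : box b x -> box b (V t x).
  move=> bx i; have [->|ij] := eqVneq i j; last by rewrite Vi.
  by rewrite Vj//; apply: Fin; exact: bx.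
have s_gt0 x : box b x -> 0 < s x.
  by move=> bx; apply: prodr_gt0 => i _; apply: bump_gt0; [exact: lr|exact: bx].
have VD t u x : V (t + u) x = V t (V u x).
  have [bx|bx] := pselect (box b x); last by rewrite !Vout.
  apply/rowP => i; have [->|ij] := eqVneq i j; last by rewrite !Vi.
  by rewrite !Vj//; [rewrite sV mulrDl FD|exact: Vbox].
exists V; split; [split=> // | |].
- split=> [x|t x].
    have [bx|bx] := pselect (box b x); last by rewrite Vout.
    by rewrite Vin// mul0r F0 subrr scale0r addr0.
  have [bx|bx] := pselect (box b x); last first.
    rewrite Vout// box_field0// (_ : (fun _ => _) = cst x); first exact: is_derive_cst.
    by apply/funext => u; rewrite Vout.
  pose e (u : R) : R := F (u * s x) (x ord0 j).
  have de : is_derive t 1 e (bump (ratr (b.1 j)) (ratr (b.2 j)) (F (t * s x) (x ord0 j)) * s x).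
    have h1 : is_derive t 1 (fun u : R => u * s x) (s x).
      have h := @is_deriveZ _ _ _ (id : R -> R) (s x) t 1 1 (is_derive_id _ _).
      have -> : (fun u : R => u * s x) = s x \*: id by apply/funext => u; rewrite mulrC.
      by rewrite -[X in is_derive _ _ _ X]mulr1; exact: h.
    exact: (@is_derive1_comp _ (F ^~ (x ord0 j)) (fun u => u * s x) t _ _ (dF _ _) h1).
  have Ve : (fun u => V u x) = fun u => x + (e u - x ord0 j) *: unitv R j.
    by apply/funext => u; rewrite Vin.
  have fE : box_field b j (V t x) =
      (bump (ratr (b.1 j)) (ratr (b.2 j)) (F (t * s x) (x ord0 j)) * s x) *: unitv R j.
    rewrite /box_field /tens (bigD1 j)//= Vj//; congr ((_ * _) *: _).
    exact: (sV t x).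
  rewrite Ve fE; move: de; set D := _ * s x => -[de eD].
  have ce : (fun h : R => h^-1 *: ((e \o shift t) (h *: (1 : R)) - e t)) @ 0^' --> D.
    by rewrite -eD; exact: de.
  have c : (fun h : R => h^-1 *: (((fun u => x + (e u - x ord0 j) *: unitv R j) \o shift t)
      (h *: (1 : R)) - (x + (e t - x ord0 j) *: unitv R j))) @ 0^' --> D *: unitv R j.
    rewrite (_ : (fun _ => _) = fun h : R =>
      (h^-1 *: ((e \o shift t) (h *: (1 : R)) - e t)) *: unitv R j).
      by apply: cvgZr_tmp; exact: ce.
    apply/funext => h /=; rewrite opprD addrACA subrr add0r -scalerBl opprB scalerA.
    congr ((_ * _) *: _); rewrite addrA subrK; by [].
  split; first by apply/cvg_ex; eexists; exact: c.
  by apply: cvg_lim c; exact: norm_hausdorff.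
- move=> t x t0 bx; exists (F (t * s x) (x ord0 j) - x ord0 j); split; last exact: Vin.
  by rewrite subr_gt0; apply: Fpos; [rewrite mulr_gt0// s_gt0|exact: bx].
move=> t; suff : @borelX R k `<=` [set B | borelX (V t @^-1` B)] by [].
have sX : sigma_algebra setT (@borelX R k) by exact: smallest_sigma_algebra.
have bC A : borelX A -> borelX (~` A) by move=> ?; rewrite -setTD; exact: sigma_algebraCD.
have bU (A : nat -> set X) : (forall n, borelX (A n)) -> borelX (\bigcup_n A n).
  by move=> ?; exact: sigma_algebra_bigcup.
have b0 : borelX (set0 : set X) by exact: sigma_algebra0.
have bU2 (A B : set X) : borelX A -> borelX B -> borelX (A `|` B).
  by move=> ? ?; rewrite -bigcup2E; apply: bU => -[|[|n]].
apply: smallest_sub.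
  split=> /=; first by rewrite preimage_set0.
    by move=> A mA; rewrite setTD preimage_setC; exact: bC.
  by move=> A mA; rewrite preimage_bigcup; exact: bU.
move=> U oU /=; have bop A : open A -> borelX (A : set X) by exact: sub_sigma_algebra.
(* [V t] is continuous in the open box and the identity outside: the preimage is an open set
   together with [U] minus the box. *)
have -> : V t @^-1` U = (box b `&` V t @^-1` U) `|` (~` (~` U `|` box b)).
  apply/seteqP; split=> x /=.
    move=> Ux; have [bx|bx] := pselect (box b x); [left|right] => //.
    by rewrite Vout// in Ux; case.
  by move=> [[_ //]|/not_orP[/contrapT Ux bx]]; rewrite /preimage /= Vout.
apply: (bU2); last by apply: (bC); apply: (bU2); [apply: (bC); exact: bop|exact: box_borel].
apply: bop; rewrite openE => x [bx Ux].
have cV : V t @ x --> V t x.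
  have near_b : \forall y \near x, box b y by exact: box_nbhs.
  have cs : s @ x --> s x.
    have mc : continuous (fun z : R * R => z.1 * z.2) by exact: mul_continuous.
    apply: (cvg_big mc (Ff := fun i (y : X) => box_bump b i (y ord0 i)) (F := nbhs x)) => i _.
    apply: (@cvg_comp _ _ _ (fun y : X => y ord0 i) (box_bump b i) _ (nbhs (x ord0 i))).
      exact: coord_continuous.
    exact/smooth1_continuous/smooth1_bump/lr.
  have cj : (fun y : X => y ord0 j) @ x --> x ord0 j by exact: coord_continuous.
  have cF : (fun y : X => F (t * s y) (y ord0 j)) @ x --> F (t * s x) (x ord0 j).
    apply: (@cvg_comp _ _ _ (fun y : X => (t * s y, y ord0 j)) (fun q : R * R => F q.1 q.2)
      _ (nbhs (t * s x, x ord0 j))).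
      have cts : (fun y : X => t * s y) @ x --> t * s x by exact: (cvgM (cvg_cst t) cs).
      exact: (cvg_pair cts cj).
    exact: (Fcont (t * s x) (x ord0 j) (bx j)).
  have cE : (fun y : X => y + (F (t * s y) (y ord0 j) - y ord0 j) *: unitv R j) @ x --> V t x.
    have c1 : (fun y : X => (F (t * s y) (y ord0 j) - y ord0 j) *: unitv R j) @ x -->
        (F (t * s x) (x ord0 j) - x ord0 j) *: unitv R j.
      have c0 : (fun y : X => F (t * s y) (y ord0 j) - y ord0 j) @ x -->
        F (t * s x) (x ord0 j) - x ord0 j by exact: (cvgB cF cj).
      exact: (cvgZr_tmp c0).
    rewrite (Vin t x bx); exact: (cvgD (@cvg_id _ (nbhs x)) c1).
  apply: cvg_trans cE.
  apply: (@near_eq_cvg _ _ (nbhs x) _); near=> y; have ybx : box b y by near: y.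
  by rewrite Vin.
have nU : nbhs x (V t @^-1` U) by apply: cV; exact: open_nbhs_nbhs.
exact: filterI (box_nbhs bx) nU.
Unshelve. all: by end_near. Qed.

End BoxFlowExistence.


Section ConfigFlow.
Variables (R : realType) (k : nat).
Local Notation X := (X R k).
Local Notation Gamma := (Gamma R k).
Implicit Types (e : config R k).

(** Collects what the swap uses of the flow. Images of configurations stay locally finite because
    the points outside a bounded box do not move, and the group law makes the image of a set under
    time [t] a preimage under time [- t]. *)
Lemma exists_config_flow (b : bidx k) (j : 'I_k) : (forall i, b.1 i < b.2 i) ->
  exists W : R -> Gamma -> Gamma,
  [/\ [/\ forall t, measurable_fun setT (W t), forall e, W 0 e = e &
          forall t s e, W (t + s) e = W t (W s e)],
      forall t e x, cpts e `&` box b = [set x] ->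
        exists x', cpts (W t e) `&` box b = [set x'],
      forall t e x, 0 < t -> cpts e `&` box b = [set x] ->
        exists d, [/\ 0 < d, box b (x + d *: unitv R j) &
          cpts (W t e) = (cpts e `\ x) `|` [set x + d *: unitv R j]] &
      forall mu : probability Gamma R, hypH mu -> forall t A, measurable A ->
        mu A = 0%E <-> mu (W t @^-1` A) = 0%E].
Proof.
move=> b_ne; have [V [[flowV VD Vout Vin] Vpos Vbor]] := exists_box_flow R j b_ne.
have [V0 _] := flowV.
have VK t x : V t (V (- t) x) = x by rewrite -VD subrr V0.
have VNK t x : V (- t) (V t x) = x by rewrite -VD addNr V0.
have VinE t x : box b (V t x) -> box b x by move=> h; rewrite -(VNK t x); exact: Vin.
have lf t e : locfin (V t @` cpts e).
  apply/locfin_boxP => c.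
  have fU : finite_set (cpts e `&` (cbox b `|` cbox c)).
    by rewrite setIUr finite_setU; split; apply: locfin_cbox; exact: cpts_locfin.
  apply: (@sub_finite_set _ _ (V t @` (cpts e `&` (cbox b `|` cbox c)))); last exact: finite_image.
  move=> _ [[x ex <-] cVx]; exists x => //; split=> //.
  have [bx|bx] := pselect (box b x); first by left; exact: box_sub_cbox.
  by right; rewrite Vout// in cVx; exact: box_sub_cbox.
pose W (t : R) (e : Gamma) : Gamma := Config (lf t e).
have WE t e : cpts (W t e) = V t @` cpts e by [].
have WK t e : W t (W (- t) e) = e.
  apply: config_ext; rewrite !WE; apply/seteqP; split=> x.
    by move=> [_ [z ez <-] <-]; rewrite VK.
  by move=> ex; exists (V (- t) x); [exists x|rewrite VK].
have W0 e : W 0 e = e.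
  apply: config_ext; rewrite WE; apply/seteqP; split=> x; first by move=> [y ey <-]; rewrite V0.
  by move=> ex; exists x.
have WD t s e : W (t + s) e = W t (W s e).
  apply: config_ext; rewrite !WE image_comp; apply: eq_imagel => x _; exact: VD.
have WNK t e : W (- t) (W t e) = e by rewrite -WD addNr W0.
have mW t : measurable_fun setT (W t).
  apply: (@measurability _ _ Gamma Gamma setT (W t) (@count_gen R k)) => //.
  move=> _ [_ [B [a [BB ->]]] <-]; rewrite setTI.
  rewrite (_ : _ @^-1` _ = [set e : Gamma | npts R (cpts e) (V t @^-1` B) = a]).
    by apply: measurable_count; exact: Vbor.
  have E e : npts R (cpts (W t e)) B = npts R (cpts e) (V t @^-1` B).
    rewrite /npts (@reindex_esum R _ _ (cpts e `&` V t @^-1` B) (cpts (W t e) `&` B) (V t))//.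
    split.
    - by move=> x [ex Bx]; split=> //; exists x.
    - by move=> x y _ _ /(congr1 (V (- t))); rewrite !VNK.
    - by move=> _ [[x ex <-] Bx]; exists x.
  by apply/seteqP; split=> e /=; rewrite E.
have Wbox t e x : cpts e `&` box b = [set x] -> cpts (W t e) `&` box b = [set V t x].
  move=> ebx; have [ex bx] : (cpts e `&` box b) x by rewrite ebx.
  apply/seteqP; split=> [_ [[y ey <-] /VinE by_]|_ ->] /=.
    have yx : [set x] y by rewrite -ebx.
    by rewrite yx.
  by split; [exists x|exact: Vin].
exists W; split.
- by split.
- by move=> t e x /(Wbox t) h; exists (V t x).
- move=> t e x t0 ebx; have [ex bx] : (cpts e `&` box b) x by rewrite ebx.
  have [d [d0 Vx]] := Vpos t x t0 bx; exists d; split=> //; first by rewrite -Vx; exact: Vin.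
  rewrite WE -Vx; apply/seteqP; split=> y.
    move=> [z ez <-]; have [->|zx] := pselect (z = x); first by right.
    left; rewrite Vout//; move=> bz; apply: zx.
    by have : [set x] z by rewrite -ebx.
  move=> [[ey yx]|->]; last by exists x.
  exists y => //; rewrite Vout// => by_; apply: yx.
  by have : [set x] y by rewrite -ebx.
- move=> mu [_ _ qi] t A mA.
  have h := qi _ (smooth_box_field R j b_ne)
    (@compact_support_box_field R k b j) V flowV t A mA.
  rewrite (_ : W t @^-1` A = [set eta : Gamma | exists2 eta' : Gamma, A eta' &
      cpts eta' = V t @` cpts eta]); first exact: h.
  apply/seteqP; split=> e /=; first by move=> AW; exists (W t e).
  by move=> [e' Ae' ee']; suff -> : W t e = e' by []; exact: config_ext.
Qed.

End ConfigFlow.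


(** * Image measures and supports *)

Section WeightedImage.
Local Open Scope ereal_scope.

Import HBNNSimple.

Lemma ge0_measurable_ind d (T : measurableType d) (R : realType)
    (P : (T -> \bar R) -> Prop) :
  (forall A, measurable A -> P (fun x => (\1_A x)%:E)) ->
  P (fun=> 0) ->
  (forall f g, measurable_fun setT f -> measurable_fun setT g ->
     (forall x, 0 <= f x) -> (forall x, 0 <= g x) -> P f -> P g -> P (fun x => f x + g x)) ->
  (forall (c : R) f, (0 <= c)%R -> measurable_fun setT f -> (forall x, 0 <= f x) ->
     P f -> P (fun x => c%:E * f x)) ->
  (forall f_ : nat -> T -> \bar R, (forall n, measurable_fun setT (f_ n)) ->
     (forall n x, 0 <= f_ n x) -> (forall x, nondecreasing_seq (f_ ^~ x)) ->
     (forall n, P (f_ n)) -> P (fun x => limn (f_ ^~ x))) ->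
  forall f, measurable_fun setT f -> (forall x, 0 <= f x) -> P f.
Proof.
move=> P1 P0 PD PZ Plim f mf f0.
pose f_ := nnsfun_approx measurableT mf.
have fE : f = (fun x => limn (fun n => (f_ n x)%:E)).
  apply/funext => x; apply/esym/cvg_lim => //.
  exact: (@cvg_nnsfun_approx _ _ _ _ measurableT _ mf (fun x _ => f0 x) x Logic.I).
rewrite fE; apply: (Plim (fun n x => (f_ n x)%:E)).
- by move=> n; apply/measurable_EFinP.
- by move=> n x; rewrite lee_fin.
- by move=> x m n mn; rewrite lee_fin; exact/lefP/nd_nnsfun_approx.
move=> n; have -> : (fun x => (f_ n x)%:E) = fun x =>
    \sum_(y <- finmap.enum_fset (fset_set (range (f_ n)))) y%:E * (\1_(f_ n @^-1` [set y]) x)%:E.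
  apply/funext => x; rewrite [in LHS]fimfunE fsbig_finite//= -sumEFin.
  by apply: eq_bigr => y _; rewrite EFinM.
have : forall y, y \in finmap.enum_fset (fset_set (range (f_ n))) -> (0 <= y)%R.
  by move=> y; rewrite in_fset_set// inE => -[x _ <-].
have mI (y : R) : measurable_fun setT (fun x => (\1_(f_ n @^-1` [set y]) x)%:E : \bar R).
  by apply/measurable_EFinP/measurable_indic; exact: measurable_sfunP.
have I0 (y : R) x : 0 <= (\1_(f_ n @^-1` [set y]) x)%:E :> \bar R by rewrite lee_fin.
elim: (finmap.enum_fset _) => [|y s IH] ys.
  by under eq_fun do rewrite big_nil.
under eq_fun do rewrite big_cons.
have y0 : (0 <= y)%R by apply: ys; rewrite mem_head.
have ss z : z \in s -> (0 <= z)%R by move=> zs; apply: ys; rewrite inE zs orbT.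
apply: PD.
- exact: measurable_funeM.
- by apply: emeasurable_sum => z; exact: measurable_funeM.
- by move=> x; rewrite mule_ge0.
- move=> x; rewrite big_seq; apply: sume_ge0 => z zs.
  by rewrite mule_ge0// lee_fin ss.
- apply: PZ => //; apply: P1; exact: measurable_sfunP.
- exact: IH.
Qed.

Context d d' (T : measurableType d) (T' : measurableType d') (R : realType).
Variables (m : {measure set T -> \bar R}) (w : T -> R) (th : T -> T').

(** The image under [th] of the measure with density [w] with respect to [m]. *)
Definition wimg (A : set T') : \bar R := \int[m]_(x in th @^-1` A) (w x)%:E.

Hypothesis mw : measurable_fun setT w.
Hypothesis w0 : forall x, (0 <= w x)%R.
Hypothesis mth : measurable_fun setT th.

Let mpre A : measurable A -> measurable (th @^-1` A).
Proof. by move=> mA; rewrite -[X in measurable X]setTI; exact: mth. Qed.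

Let wimg0 : wimg set0 = 0.
Proof. by rewrite /wimg preimage_set0 integral_set0. Qed.

Let wimg_ge0 A : 0 <= wimg A.
Proof. by apply: integral_ge0 => x _; rewrite lee_fin. Qed.

Let wimg_sigma_additive : semi_sigma_additive wimg.
Proof.
move=> F mF tF mUF; rewrite /wimg preimage_bigcup ge0_integral_bigcup//.
- apply: is_cvg_ereal_nneg_natsum_cond => n _ _; exact: wimg_ge0.
- by move=> n; exact: mpre.
- by apply: measurable_funTS; exact/measurable_EFinP.
- by move=> x _; rewrite lee_fin.
- apply/trivIsetP => i j _ _ ij; rewrite -preimage_setI.
  by move/trivIsetP : tF => ->//; rewrite preimage_set0.
Qed.

HB.instance Definition _ := isMeasure.Build _ _ _ wimg wimg0 wimg_ge0 wimg_sigma_additive.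

Lemma exists_wimg : exists m' : {measure set T' -> \bar R},
  forall f, measurable_fun setT f -> (forall y, 0 <= f y) ->
    \int[m']_y f y = \int[m]_x ((w x)%:E * f (th x)).
Proof.
have wE0 x : 0 <= (w x)%:E by rewrite lee_fin.
have mwE : measurable_fun setT (fun x => (w x)%:E) by exact/measurable_EFinP.
exists wimg; apply: ge0_measurable_ind.
- move=> A mA; rewrite integral_indic// setIT /= /wimg integral_mkcond.
  apply: eq_integral => x _; rewrite patchE indicE.
  have -> : (x \in th @^-1` A) = (th x \in A) by apply/idP/idP; rewrite !inE.
  by case: ifP => _; rewrite ?mule1 ?mule0.
- by rewrite integral0; under eq_integral do rewrite mule0; rewrite integral0.
- move=> f g mf mg f0 g0 If Ig; rewrite ge0_integralD// If Ig -ge0_integralD//.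
  + by apply: eq_integral => x _; rewrite muleDr// ge0_adde_def// inE.
  + by move=> x _; rewrite mule_ge0.
  + by apply: emeasurable_funM => //; exact: measurableT_comp.
  + by move=> x _; rewrite mule_ge0.
  + by apply: emeasurable_funM => //; exact: measurableT_comp.
- move=> c f c0 mf f0 If; rewrite ge0_integralZl_EFin// If -ge0_integralZl_EFin//.
  + by apply: eq_integral => x _; rewrite muleCA.
  + by move=> x _; rewrite mule_ge0.
  + by apply: emeasurable_funM => //; exact: measurableT_comp.
- move=> f_ mf_ f0 fnd If; rewrite monotone_convergence//.
  rewrite (_ : (fun n => _) = fun n => \int[m]_x ((w x)%:E * f_ n (th x))); last first.
    by apply/funext => n; rewrite If.
  rewrite -monotone_convergence//.
  + apply: eq_integral => x _; rewrite limeMl//.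
    by apply: ereal_nondecreasing_is_cvgn; exact: fnd.
  + by move=> n; apply: emeasurable_funM => //; exact: measurableT_comp.
  + by move=> n x _; rewrite mule_ge0.
  + by move=> x _ a b ab; apply: lee_wpmul2l => //; exact: fnd.
Qed.

End WeightedImage.


(** * Densities, supports and common parts of finite measures *)

Section FiniteMeasures.
Context d (T : measurableType d) (R : realType).

Section MeasureToFinite.
Variable m : {measure set T -> \bar R}.

Definition finite_of (_ : (m setT < +oo)%E) : set T -> \bar R := m.

Hypothesis moo : (m setT < +oo)%E.

HB.instance Definition _ := isMeasure.Build _ _ _ (finite_of moo)
  (measure0 m) (measure_ge0 m) (@measure_semi_sigma_additive _ _ _ m).

Let finite_of_fin : fin_num_fun (finite_of moo).
Proof.
move=> A mA; rewrite ge0_fin_numE ?measure_ge0//; apply: le_lt_trans moo.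
by apply: le_measure; rewrite ?inE//; exact: measurableT.
Qed.

HB.instance Definition _ := Measure_isFinite.Build _ _ _ (finite_of moo) finite_of_fin.

Lemma exists_finite_measure :
  exists m' : {finite_measure set T -> \bar R}, forall A, m' A = m A.
Proof. by exists (finite_of moo). Qed.

End MeasureToFinite.

Lemma exists_density (m1 m2 : {measure set T -> \bar R}) :
  (m1 setT < +oo)%E -> (m2 setT < +oo)%E ->
  (forall A, measurable A -> m2 A = 0%E -> m1 A = 0%E) ->
  exists f : T -> R, [/\ measurable_fun setT f, forall x, 0 <= f x &
    forall phi : T -> \bar R, measurable_fun setT phi -> (forall x, (0 <= phi x)%E) ->
      (\int[m1]_x phi x = \int[m2]_x ((f x)%:E * phi x))%E].
Proof.
move=> m1oo m2oo dom.
have [n1 n1E] := exists_finite_measure m1oo.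
have [n2 n2E] := exists_finite_measure m2oo.
have n12 : n1 `<< n2.
  apply/null_content_dominatesP => A mA A0.
  by rewrite n1E; apply: dom => //; rewrite -n2E.
pose F := Radon_Nikodym_SigmaFinite.f n1 n2.
have F0 x : (0 <= F x)%E by exact: Radon_Nikodym_SigmaFinite.f_ge0.
have Ffin x : F x \is a fin_num by exact: Radon_Nikodym_SigmaFinite.f_fin_num.
have mF : measurable_fun setT F.
  exact: measurable_int (Radon_Nikodym_SigmaFinite.f_integrable n12).
exists (fun x => fine (F x)); split.
- exact: (@measurableT_comp _ _ _ _ _ _ fine).
- by move=> x; exact: fine_ge0.
- move=> phi mphi phi0.
  have E1 : (\int[m1]_x phi x = \int[n1]_x phi x)%E.
    by apply: eq_measure_integral => A _ _; exact/esym/n1E.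
  have E2 : (\int[m2]_x ((fine (F x))%:E * phi x) = \int[n2]_x ((fine (F x))%:E * phi x))%E.
    by apply: eq_measure_integral => A _ _; exact/esym/n2E.
  rewrite E1 E2 -(Radon_Nikodym_SigmaFinite.change_of_variables n12)//.
  by apply: eq_integral => x _; rewrite fineK// muleC.
Qed.

(** [A] is the set where the density of [m1] with respect to [m2] is positive. *)
Lemma exists_support (m1 m2 : {measure set T -> \bar R}) :
  (m1 setT < +oo)%E -> (m2 setT < +oo)%E ->
  (forall A, measurable A -> m2 A = 0%E -> m1 A = 0%E) ->
  exists A, measurable A /\ forall B, measurable B -> m1 B = 0%E <-> m2 (B `&` A) = 0%E.
Proof.
move=> m1oo m2oo dom; have [f [mf f0 fE]] := exists_density m1oo m2oo dom.
pose A := [set x | 0 < f x].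
have mA : measurable A.
  rewrite (_ : A = f @^-1` `]0, +oo[%classic).
    by rewrite -[X in measurable X]setTI; apply: mf => //; exact: measurable_itv.
  by apply/seteqP; split=> x; rewrite /A /= in_itv /= andbT.
exists A; split=> // B mB.
have m1E : (m1 B = \int[m2]_(x in B) (f x)%:E)%E.
  rewrite -[X in m1 X](setIT B) -integral_indic// fE.
  - rewrite [RHS]integral_mkcond; apply: eq_integral => x _.
    by rewrite patchE indicE; case: ifP => _; rewrite ?mule1 ?mule0.
  - exact/measurable_EFinP/measurable_indic.
  - by move=> x; rewrite lee_fin.
have absE : (\int[m2]_(x in B) (f x)%:E = \int[m2]_(x in B) `|(f x)%:E|)%E.
  by apply: eq_integral => x _; rewrite gee0_abs// lee_fin.
have mfB : measurable_fun B (fun x => (f x)%:E) by apply: measurable_funTS; exact/measurable_EFinP.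
rewrite m1E absE (ae_eq_integral_abs m2 mB mfB); split.
- move=> [N [mN N0 NB]]; apply/eqP; rewrite eq_le measure_ge0 andbT -N0.
  apply: le_measure; rewrite ?inE//; first exact: measurableI.
  move=> x [Bx Ax]; apply: NB => /= h; have [] := h Bx => fx0.
  by move: Ax; rewrite /A /= fx0 ltxx.
- move=> BA0; exists (B `&` A); split=> //; first exact: measurableI.
  move=> x /= /not_implyP[Bx fx]; split=> //; rewrite /A /= lt_neqAle f0 andbT eq_sym.
  by apply/eqP => h; apply: fx; rewrite h.
Qed.

(** Let [f] be the density of [m1] restricted to [E]. The choice [h1 = 1 / (2 max(f, 1))] on [E] and
    [h2 = f h1] gives the same measure from both sides and bounds both weights by one half, so that
    two moved fractions never exceed the available mass. *)
Lemma common_part (m1 m2 : {measure set T -> \bar R}) (E : set T) :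
  (m1 setT < +oo)%E -> (m2 setT < +oo)%E -> measurable E ->
  (forall A, measurable A -> A `<=` E -> m2 A = 0%E -> m1 A = 0%E) ->
  exists h1 h2 : T -> R, [/\ measurable_fun setT h1 /\ measurable_fun setT h2,
    forall x, 0 <= h1 x <= 2^-1, forall x, 0 <= h2 x <= 2^-1,
    forall x, E x -> 0 < h1 x &
    forall phi : T -> \bar R, measurable_fun setT phi -> (forall x, (0 <= phi x)%E) ->
      (\int[m1]_x ((h1 x)%:E * phi x) = \int[m2]_x ((h2 x)%:E * phi x))%E].
Proof.
move=> m1oo m2oo mE dom.
have E_ge0 x : (0 <= \1_E x :> R) by rewrite indicE.
have [n1 n1E] := exists_wimg m1 (@measurable_indic _ T R setT E mE)
  E_ge0 (@measurable_id _ T setT).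
have n1A A : measurable A -> n1 A = m1 (A `&` E).
  move=> mA; rewrite -[X in n1 X](setIT A) -integral_indic// n1E.
  - rewrite -[X in m1 X](setIT (A `&` E)) -integral_indic//; last exact: measurableI.
    by apply: eq_integral => x _; rewrite !indicE -EFinM -natrM mulnb andbC in_setI.
  - exact/measurable_EFinP/measurable_indic.
  - by move=> x; rewrite lee_fin.
have n1oo : (n1 setT < +oo)%E.
  rewrite n1A// setTI; apply: le_lt_trans m1oo.
  by apply: le_measure; rewrite ?inE//; exact: measurableT.
have ndom A : measurable A -> m2 A = 0%E -> n1 A = 0%E.
  move=> mA A0; rewrite n1A//; apply: dom; [exact: measurableI|by move=> x []|].
  apply/eqP; rewrite eq_le measure_ge0 andbT -A0.
  by apply: le_measure; rewrite ?inE//; exact: measurableI.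
have [f [mf f0 fE]] := exists_density n1oo m2oo ndom.
pose M x := Num.max (f x) 1.
have M1 x : 1 <= M x by rewrite /M le_max lexx orbT.
have M0 x : 0 < M x by apply: lt_le_trans (M1 x).
have mM : measurable_fun setT (fun x => (M x)^-1).
  rewrite (_ : (fun _ => _) = (fun y : R => y `^ (-1)) \o M); last first.
    by apply/funext => x /=; rewrite powR_inv1// ltW.
  apply: measurableT_comp; first exact: measurable_powR.
  by apply: measurable_maxr => //; exact: measurable_cst.
pose h1 x := \1_E x * (2^-1 * (M x)^-1).
pose h2 x := f x * h1 x.
have mh1 : measurable_fun setT h1.
  by apply: measurable_funM; [exact: measurable_indic|exact: measurable_funM].
have h10 x : 0 <= h1 x.
  by rewrite /h1 !mulr_ge0// invr_ge0 ltW.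
exists h1, h2; split.
- by split=> //; exact: measurable_funM.
- move=> x; rewrite h10 /= /h1 indicE; case: (x \in E); rewrite ?mul0r ?mul1r//.
  by rewrite ler_piMr// invf_le1.
- move=> x; rewrite /h2 mulr_ge0//= /h1 indicE; case: (x \in E); rewrite ?mul0r ?mulr0// mul1r.
  rewrite mulrCA ler_piMr// ler_pdivrMr// mul1r /M le_max lexx//.
- move=> x Ex; rewrite /h1 indicE mem_set// mul1r mulr_gt0// invr_gt0//.
- move=> phi mphi phi0.
  have mp : measurable_fun setT (fun x => (h1 x)%:E * phi x)%E.
    by apply: emeasurable_funM => //; exact/measurable_EFinP.
  have p0 x : (0 <= (h1 x)%:E * phi x)%E by rewrite mule_ge0// lee_fin.
  transitivity (\int[n1]_x ((h1 x)%:E * phi x))%E.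
    rewrite n1E//; apply: eq_integral => x _; rewrite muleA -EFinM; congr (_%:E * _)%E.
    by rewrite /h1 indicE; case: (x \in E); rewrite ?mul0r ?mul1r.
  rewrite fE//; apply: eq_integral => x _.
  by rewrite /h2 EFinM muleA.
Qed.

End FiniteMeasures.


Section SwapCoupling.
Local Open Scope ereal_scope.
Context d d' (T : measurableType d) (T' : measurableType d') (R : realType).

(** [w1] of the mass at [z] is moved along [t], [w2] along [t'], the rest stays. *)
Lemma swap_coupling (g : probability (T * T')%type R) (t t' : T -> T)
    (w1 w2 : T * T' -> R) :
  measurable_fun setT t -> measurable_fun setT t' -> (forall x, t (t' x) = x) ->
  measurable_fun setT w1 -> measurable_fun setT w2 ->
  (forall z, 0 <= w1 z <= 2^-1)%R -> (forall z, 0 <= w2 z <= 2^-1)%R ->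
  (forall phi : T -> \bar R, measurable_fun setT phi -> (forall x, 0 <= phi x) ->
     \int[g]_z ((w1 z)%:E * phi z.1) = \int[g]_z ((w2 z)%:E * phi (t' z.1))) ->
  exists g' : probability (T * T')%type R,
  [/\ forall A, measurable A -> g' [set z | A z.1] = g [set z | A z.1],
      forall A, measurable A -> g' [set z | A z.2] = g [set z | A z.2] &
      forall f : T * T' -> \bar R, measurable_fun setT f -> (forall z, 0 <= f z) ->
        \int[g']_z f z = \int[g]_z ((1 - w1 z - w2 z)%:E * f z +
          (w1 z)%:E * f (t z.1, z.2) + (w2 z)%:E * f (t' z.1, z.2))].
Proof.
move=> mt mt' tt' mw1 mw2 w1b w2b bal.
pose w0 z : R := (1 - w1 z - w2 z)%R.
have w10 z : (0 <= w1 z)%R by have /andP[] := w1b z.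
have w20 z : (0 <= w2 z)%R by have /andP[] := w2b z.
have w00 z : (0 <= w0 z)%R.
  have /andP[_ h1] := w1b z; have /andP[_ h2] := w2b z.
  by rewrite /w0; move: h1 h2; lra.
have mw0 : measurable_fun setT w0.
  by apply: measurable_funB => //; apply: measurable_funB => //; exact: measurable_cst.
pose th (s : T -> T) (z : T * T') := (s z.1, z.2).
have mth s : measurable_fun setT s -> measurable_fun setT (th s).
  move=> ms; apply: measurable_fun_pair; last exact: measurable_snd.
  by apply: measurableT_comp => //; exact: measurable_fst.
have [m0 m0E] := exists_wimg g mw0 w00 (@measurable_id _ _ setT).
have [m1 m1E] := exists_wimg g mw1 w10 (mth t mt).
have [m2 m2E] := exists_wimg g mw2 w20 (mth t' mt').
pose m : {measure set (T * T') -> \bar R} := measure_add (measure_add m0 m1) m2.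
have mE f : measurable_fun setT f -> (forall z, 0 <= f z) ->
    \int[m]_z f z = \int[g]_z ((w0 z)%:E * f z +
          (w1 z)%:E * f (t z.1, z.2) + (w2 z)%:E * f (t' z.1, z.2)).
  move=> mf f0; rewrite /m ge0_integral_measure_add// ge0_integral_measure_add//.
  rewrite m0E// m1E// m2E// -ge0_integralD//; last 4 first.
  - by move=> z _; rewrite mule_ge0// lee_fin.
  - by apply: emeasurable_funM => //; exact/measurable_EFinP.
  - by move=> z _; rewrite mule_ge0// lee_fin.
  - apply: emeasurable_funM; first exact/measurable_EFinP.
    by apply: (measurableT_comp mf); exact: mth.
  rewrite -ge0_integralD//.
  - by move=> z _; rewrite adde_ge0// mule_ge0// lee_fin.
  - apply: emeasurable_funD.
      by apply: emeasurable_funM => //; exact/measurable_EFinP.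
    apply: emeasurable_funM; first exact/measurable_EFinP.
    by apply: (measurableT_comp mf); exact: mth.
  - by move=> z _; rewrite mule_ge0// lee_fin.
  - apply: emeasurable_funM; first exact/measurable_EFinP.
    by apply: (measurableT_comp mf); exact: mth.
have mA A : measurable A -> m A = \int[m]_z (\1_A z)%:E.
  by move=> mA; rewrite integral_indic// setIT.
have gA A : measurable A -> g A = \int[g]_z (\1_A z)%:E.
  by move=> mA'; rewrite integral_indic// setIT.
have mI A : measurable A -> measurable_fun setT (fun z : T * T' => (\1_A z)%:E : \bar R).
  by move=> ?; exact/measurable_EFinP/measurable_indic.
have I0 (A : set (T * T')) z : 0 <= (\1_A z)%:E :> \bar R by rewrite lee_fin indicE.
have snd_m A : measurable A -> m [set z | A z.2] = g [set z | A z.2].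
  move=> mA'; have mB : measurable [set z : T * T' | A z.2].
    by rewrite -[X in measurable X]setTI; exact: measurable_snd.
  rewrite mA// gA// mE//; last exact: mI.
  apply: eq_integral => z _; rewrite !indicE.
  have E s : ((s, z.2) \in [set z : T * T' | A z.2]) = (z \in [set z : T * T' | A z.2]).
    by apply/idP/idP; rewrite !inE.
  by rewrite !E -!EFinM -!EFinD -!mulrDl /w0; congr (_%:E); ring.
have fst_m A : measurable A -> m [set z | A z.1] = g [set z | A z.1].
  move=> mA'; have mB : measurable [set z : T * T' | A z.1].
    by rewrite -[X in measurable X]setTI; exact: measurable_fst.
  pose phi (x : T) : \bar R := (\1_A x)%:E.
  have mphi : measurable_fun setT phi by exact/measurable_EFinP/measurable_indic.
  have phi0 x : 0 <= phi x by rewrite /phi lee_fin indicE.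
  have IE (s : T) (y : T') : (\1_[set z : T * T' | A z.1] (s, y))%:E = phi s.
    by rewrite /phi !indicE; congr (_%:R%:E); apply/idP/idP; rewrite !inE.
  rewrite mA// gA// mE//; last exact: mI.
  have mphi1 : measurable_fun setT (fun z : T * T' => phi z.1).
    by apply: (measurableT_comp mphi); exact: measurable_fst.
  have mphi2 s : measurable_fun setT s -> measurable_fun setT (fun z : T * T' => phi (s z.1)).
    move=> ms; apply: (measurableT_comp mphi); apply: (measurableT_comp ms).
    exact: measurable_fst.
  have mwphi (w : T * T' -> R) (s : T -> T) : measurable_fun setT w -> measurable_fun setT s ->
      measurable_fun setT (fun z : T * T' => (w z)%:E * phi (s z.1)).
    by move=> ? ?; apply: emeasurable_funM; [exact/measurable_EFinP|exact: mphi2].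
  have wphi0 (w : T * T' -> R) (s : T -> T) : (forall z, 0 <= w z)%R -> forall z : T * T', 0 <= (w z)%:E * phi (s z.1).
    by move=> ? z; rewrite mule_ge0// lee_fin.
  transitivity (\int[g]_z ((w0 z)%:E * phi z.1 + (w1 z)%:E * phi (t z.1) + (w2 z)%:E * phi (t' z.1))).
    by apply: eq_integral => -[x y] _; rewrite !IE.
  have mid := @measurable_id _ T setT.
  rewrite ge0_integralD//; last 4 first.
  - by move=> z _; apply: adde_ge0; [exact: (wphi0 w0 id)|exact: (wphi0 w1 t)].
  - by apply: emeasurable_funD; [exact: (mwphi w0 id)|exact: (mwphi w1 t)].
  - by move=> z _; exact: (wphi0 w2 t').
  - exact: (mwphi w2 t').
  rewrite ge0_integralD//; last 4 first.
  - by move=> z _; exact: (wphi0 w0 id).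
  - exact: (mwphi w0 id).
  - by move=> z _; exact: (wphi0 w1 t).
  - exact: (mwphi w1 t).
  (* The balance is used twice: for [phi], the mass leaving along [t] is what arrives along [t'];
     for [phi \o t], the mass arriving along [t] is what leaves along [t'], since [t (t' x) = x]. *)
  have B1 := bal phi mphi phi0.
  have B2 := bal (phi \o t) (measurableT_comp mphi mt) (fun x => phi0 (t x)).
  rewrite /= in B2; rewrite B2 -B1.
  under [X in _ + X + _]eq_integral do rewrite tt'.
  rewrite -ge0_integralD//; last 4 first.
  - by move=> z _; exact: (wphi0 w0 id).
  - exact: (mwphi w0 id).
  - by move=> z _; exact: (wphi0 w2 id).
  - exact: (mwphi w2 id).
  rewrite -ge0_integralD//; last 4 first.
  - by move=> z _; apply: adde_ge0; [exact: (wphi0 w0 id)|exact: (wphi0 w2 id)].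
  - by apply: emeasurable_funD; [exact: (mwphi w0 id)|exact: (mwphi w2 id)].
  - by move=> z _; exact: (wphi0 w1 id).
  - exact: (mwphi w1 id).
  apply: eq_integral => -[x y] _ /=; rewrite IE /phi -!EFinM -!EFinD -!mulrDl /w0.
  by congr (_%:E); ring.
have [g' g'E] : exists g' : probability (T * T')%type R, forall A, g' A = m A.
  apply: exists_probability.
  have := fst_m setT measurableT.
  by rewrite (_ : [set z | setT z.1] = setT) ?probability_setT//; apply/seteqP.
exists g'; split.
- by move=> A mA'; rewrite g'E fst_m.
- by move=> A mA'; rewrite g'E snd_m.
- move=> f mf f0; rewrite -mE//; apply: eq_measure_integral => A _ _; exact: g'E.
Qed.

End SwapCoupling.


(** * Moving one point *)

Section MoveOnePoint.
Variables (R : realType) (k : nat).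
Local Notation X := (X R k).
Local Notation Gamma := (Gamma R k).
Implicit Types (e o : config R k).

Lemma tcostD1 (B : set (X * X)) p : B p ->
  tcost B = ((pcost p)%:E + tcost (B `\ p))%E.
Proof.
move=> Bp; rewrite /tcost (esumID [set p]); last by move=> q; rewrite lee_fin pcost_ge0.
congr (_ + _)%E.
rewrite (_ : B `&` [set p] = [set p]) ?esum_set1//; first by rewrite lee_fin pcost_ge0.
by apply/seteqP; split=> q; [case|move=> ->].
Qed.

(** The partner [y] is handed over from [x] to [x']. The costs are compared without subtraction
    because [tcost B] may be infinite. *)
Lemma move_point e e' o B x x' y : matching e o B -> B (x, y) ->
  cpts e' = (cpts e `\ x) `|` [set x'] -> ~ (cpts e `\ x) x' ->
  exists B', matching e' o B' /\
    (tcost B' + (pcost (x, y))%:E = tcost B + (pcost (x', y))%:E)%E.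
Proof.
move=> [m1 m2 m3 m4 m5] Bxy e'E nx'.
have [ex oy] := m1 _ Bxy.
pose B0 := B `\ (x, y).
have B0x u v : B0 (u, v) -> u <> x.
  move=> [Buv uv] ux; apply: uv; rewrite /= ux; congr pair.
  by rewrite ux in Buv; exact: m4 Buv Bxy.
have B0y u v : B0 (u, v) -> v <> y.
  move=> [Buv uv] vy; apply: uv; rewrite /= vy; congr pair.
  by rewrite vy in Buv; exact: m5 Buv Bxy.
have nB0 v : ~ B0 (x', v).
  by move=> h; apply: nx'; split; [have [/m1[]] := h|exact: B0x h].
have nB0' : B0 = (B0 `|` [set (x', y)]) `\ (x', y).
  apply/seteqP; split=> [p B0p|p [[//|->]]]; last by case.
  by split; [left|move=> pE; apply: (nB0 y); rewrite -pE].
exists (B0 `|` [set (x', y)]); split.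
  split.
  - move=> [u v] [B0uv|[-> ->]]; last by split; rewrite ?e'E //; right.
    have [/m1[eu ov] _] := B0uv; split=> //; rewrite e'E; left; split=> //.
    exact: B0x B0uv.
  - move=> u; rewrite e'E => -[[eu ux]|->]; last by exists y; right.
    have [v Buv] := m2 u eu; exists v; left; split=> // -[uE _].
    exact: ux.
  - move=> v ov; have [->|vy] := pselect (v = y); first by exists x'; right.
    by have [u Buv] := m3 v ov; exists u; left; split=> // -[_ vE]; exact: vy.
  - move=> u v v' [h|[uE vE]] [h'|[uE' vE']].
    + by case: h => h _; case: h' => h' _; exact: m4 h h'.
    + by rewrite uE' in h; case: (nB0 _ h).
    + by rewrite uE in h'; case: (nB0 _ h').
    + by rewrite vE vE'.
  - move=> u u' v [h|[uE vE]] [h'|[uE' vE']].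
    + by case: h => h _; case: h' => h' _; exact: m5 h h'.
    + by case: (B0y _ _ h).
    + by case: (B0y _ _ h').
    + by rewrite uE uE'.
rewrite (tcostD1 Bxy) (@tcostD1 (B0 `|` [set (x', y)]) (x', y)); last by right.
by rewrite -nB0' addeC [X in (_ + X = _)%E]addeC addeA.
Qed.

Lemma pcost_shift (x y : X) (j : 'I_k) (d : R) :
  pcost (x + d *: unitv R j, y) =
  pcost (x, y) + d * (x ord0 j - y ord0 j) + d ^+ 2 / 2.
Proof.
rewrite /pcost /sqnorm /= (bigD1 j)//= [in RHS](bigD1 j)//= !mxE !eqxx /= mulr1.
have -> : \sum_(i < k | i != j) (x + d *: unitv R j - y) ord0 i ^+ 2 =
    \sum_(i < k | i != j) (x - y) ord0 i ^+ 2.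
  apply: eq_bigr => i ij; rewrite !mxE /= (negbTE ij) ?andbF mulr0 addr0.
  by [].
by field.
Qed.

(** The competitor lets the moved point keep its partner [y]. *)
Lemma cost_shift e e' o B x y (j : 'I_k) (d : R) : matching e o B -> B (x, y) ->
  cpts e' = (cpts e `\ x) `|` [set x + d *: unitv R j] ->
  ~ (cpts e `\ x) (x + d *: unitv R j) ->
  (cost e' o <= tcost B + (d * (x ord0 j - y ord0 j) + d ^+ 2 / 2)%:E)%E.
Proof.
move=> mB Bxy e'E nx'; have [B' [mB' cB']] := move_point mB Bxy e'E nx'.
apply: le_trans (cost_le mB') _.
rewrite -(@leeD2rE _ (pcost (x, y))%:E)// cB' pcost_shift -addeA -EFinD.
by rewrite leeD2l// lee_fin; lra.
Qed.

End MoveOnePoint.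


(** * Constrained matchings and the change of cost *)

Section Constraints.
Variables (R : realType) (k : nat) (b : bidx k) (j : 'I_k).
Local Notation X := (X R k).
Local Notation Gamma := (Gamma R k).

Definition partner_ge (c : R) : set (X * X) := [set p : X * X | box b p.1 -> c <= p.2 ord0 j].

Definition partner_le (c : R) : set (X * X) := [set p : X * X | box b p.1 -> p.2 ord0 j <= c].

(** Since the box is open, the implication is a union of two closed conditions. *)
Lemma partner_closed (P : R -> Prop) : closed [set y : R | P y] ->
  closed [set p : X * X | box b p.1 -> P (p.2 ord0 j)].
Proof.
move=> cP.
rewrite (_ : [set _ | _] = (fst @^-1` (~` box b)) `|`
    ((fun p : X * X => p.2 ord0 j) @^-1` [set y : R | P y])); last first.
  apply/seteqP; split=> [p /= h|p [/= h|/= h]] //.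
  by have [bp|bp] := pselect (box b p.1); [right; exact: h|left].
apply: closedU.
  apply: preimage_closed; last by apply: open_closedC; exact: box_open.
  by move=> p _; exact: cvg_fst.
apply: preimage_closed => // p _.
apply: (@cvg_comp _ _ _ snd (fun y : X => y ord0 j) _ (nbhs p.2)); first exact: cvg_snd.
exact: coord_continuous.
Qed.

Lemma partner_ge_closed c : closed (partner_ge c).
Proof. by apply: (@partner_closed (fun y => c <= y)); exact: closed_ge. Qed.

Lemma partner_le_closed c : closed (partner_le c).
Proof. by apply: (@partner_closed (fun y => y <= c)); exact: closed_le. Qed.

(** The measurable form of: some optimal matching lies in [Z]. Finiteness of the cost makes the
    constrained infimum attained, and the inequality opposite to the last one always holds. *)
Definition tight (Z : set (X * X)) : set (Gamma * Gamma) :=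
  [set z | [/\ npts R (cpts z.1) (box b) = 1%:R%:E, (cost z.1 z.2 < +oo)%E &
               (costZ Z z.1 z.2 <= cost z.1 z.2)%E]].

Lemma measurable_tight Z : closed Z -> measurable (tight Z).
Proof.
move=> cZ.
have mc := @measurable_cost R k; have mcZ := measurable_costZ cZ.
rewrite (_ : tight Z = [set z | npts R (cpts z.1) (box b) = 1%:R%:E] `&`
    ([set z | (cost z.1 z.2 < +oo)%E] `&` [set z | (costZ Z z.1 z.2 <= cost z.1 z.2)%E])).
  apply: measurableI.
    have mB := measurable_count 1%:R%:E (box_borel (R := R) b).
    have mf : measurable_fun setT (fst : Gamma * Gamma -> Gamma) by exact: measurable_fst.
    by rewrite -[X in measurable X]setTI; exact: (mf measurableT _ mB).
  apply: measurableI.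
    rewrite -[X in measurable X]setTI.
    by apply: measurable_lte => //; exact: measurable_cst.
  by rewrite -[X in measurable X]setTI; exact: measurable_lee.
by apply/seteqP; split=> z; [move=> []|move=> [? []]].
Qed.

Lemma tight_matching Z z : closed Z -> tight Z z -> exists x y B,
  [/\ cpts z.1 `&` box b = [set x], matching z.1 z.2 B, B (x, y), Z (x, y) &
      tcost B = cost z.1 z.2].
Proof.
move=> cZ [/npts1P[x ebx] coo cZc].
have [|B [mB BZ cB]] := costZ_attained (e := z.1) (o := z.2) cZ; first exact: le_lt_trans coo.
have ex : cpts z.1 x by have : [set x] x by []; rewrite -ebx => -[].
have [_ /(_ x ex)[y Bxy] _ _ _] := mB.
exists x, y, B; split=> //; first exact: BZ.
apply/eqP; rewrite eq_le cB cZc /= -cB.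
exact: cost_le mB.
Qed.

(** Read off the digits, hence measurable; it has a meaning only when the box holds exactly one
    point. *)
Definition ucoord (e : Gamma) : R := dig_point R b (code e) ord0 j.

Lemma ucoordE e x : cpts e `&` box b = [set x] -> ucoord e = x ord0 j.
Proof. by move=> ebx; rewrite /ucoord (dig_pointE ebx). Qed.

Lemma measurable_ucoord : measurable_fun setT ucoord.
Proof.
apply: (measurableT_comp (@measurable_dig_point R k b j)).
exact: measurable_code.
Qed.

(** A function of the first configuration only: adding it to the cost changes neither the
    optimal couplings nor the comparison between two couplings, and makes the cost
    nonincreasing along the moves below. *)
Definition potential (a : R) (e : Gamma) : R :=
  let L : R := ratr (b.1 j) in let U : R := ratr (b.2 j) in
  if `[< npts R (cpts e) (box b) = 1%:R%:E >] then
    L ^+ 2 + U ^+ 2 + `|a| * (`|L| + `|U|) + a * ucoord e - ucoord e ^+ 2 / 2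
  else 0.

(** Explains the constant in [potential]: for [u] between [L] and [U], the square of [u] is at most
    [L ^+ 2 + U ^+ 2], and [a * u] is bounded by the remaining term. *)
Lemma potential_ge0 a e : 0 <= potential a e.
Proof.
rewrite /potential; case: asboolP => // /npts1P[x ebx].
have [_ bx] : (cpts e `&` box b) x by rewrite ebx.
rewrite (ucoordE ebx); have /andP[] := bx j.
set L := ratr _; set U := ratr _; set u := x ord0 j => Lu uU.
have h1 : u ^+ 2 <= L ^+ 2 + U ^+ 2.
  case: (leP 0 u) => u0.
    have : u ^+ 2 <= U ^+ 2 by rewrite lerXn2r ?nnegrE//; lra.
    by have := sqr_ge0 L; lra.
  have : (- u) ^+ 2 <= (- L) ^+ 2 by rewrite lerXn2r ?nnegrE//; lra.
  by rewrite !sqrrN; have := sqr_ge0 U; lra.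
have h2 : `|a * u| <= `|a| * (`|L| + `|U|).
  rewrite normrM ler_wpM2l// ler_norml; have := ler_norm U; have := ler_norm (- L).
  rewrite normrN => ? ?; have := normr_ge0 L; have := normr_ge0 U => ? ?.
  by apply/andP; split; lra.
have := ler_norm (- (a * u)); rewrite normrN => h3.
have := sqr_ge0 u; lra.
Qed.

Lemma measurable_potential a : measurable_fun setT (potential a).
Proof.
apply: measurable_fun_ifT.
- apply: (@measurable_fun_bool _ _ _ _ true).
  rewrite setTI (_ : _ @^-1` _ = [set e : Gamma | npts R (cpts e) (box b) = 1%:R%:E]).
    by apply: measurable_count; exact: box_borel.
  by apply/seteqP; split=> e /asboolP.
- have mu := measurable_ucoord; apply: measurable_funB.
    by apply: measurable_funD; [exact: measurable_cst|exact: measurable_funM].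
  by apply: measurable_funM; [exact: measurable_funX|exact: measurable_cst].
- exact: measurable_cst.
Qed.

Lemma move_notin (e : Gamma) (x x' : X) : cpts e `&` box b = [set x] -> box b x' ->
  ~ (cpts e `\ x) x'.
Proof.
move=> ebx bx' [ex' nx]; apply: nx.
by have : (cpts e `&` box b) x' by []; rewrite ebx.
Qed.

(** With [u] and [v] the levels of the point and of its partner, the cost grows by at most
    [d * (u - v) + d ^+ 2 / 2] and the potential by [a * d - u * d - d ^+ 2 / 2]. The sum is
    [(a - v) * d], and [v >= c]. *)
Lemma tight_ge_move a c z (x : X) (d : R) (e' : Gamma) : 0 <= d ->
  tight (partner_ge c) z -> cpts z.1 `&` box b = [set x] -> box b (x + d *: unitv R j) ->
  cpts e' = (cpts z.1 `\ x) `|` [set x + d *: unitv R j] ->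
  npts R (cpts e') (box b) = 1%:R%:E ->
  (cost e' z.2 + (potential a e')%:E + ((c - a) * d)%:E <=
   cost z.1 z.2 + (potential a z.1)%:E)%E.
Proof.
move=> d0 tz ebx bx' e'E e'1.
have [x0 [y [B [ebx0 mB Bxy Zxy cB]]]] := tight_matching (@partner_ge_closed c) tz.
have xx0 : x0 = x by have : [set x] x0 by rewrite -ebx ebx0.
subst x0.
have [ex bx] : (cpts z.1 `&` box b) x by rewrite ebx.
have nin := move_notin ebx bx'.
have h := cost_shift mB Bxy e'E nin; rewrite cB in h.
have cy : c <= y ord0 j by exact: Zxy bx.
have e'bx : cpts e' `&` box b = [set x + d *: unitv R j].
  have /npts1P[w e'w] := e'1.
  have : [set w] (x + d *: unitv R j) by rewrite -e'w; split=> //; rewrite e'E; right.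
  by rewrite e'w => ->.
have [z1 _ _] := tz.
rewrite /potential !asboolT// (ucoordE ebx) (ucoordE e'bx) !mxE !eqxx /= mulr1.
have [_ coo _] := tz.
have cfin : cost z.1 z.2 \is a fin_num by rewrite ge0_fin_numE// cost_ge0.
move: h; rewrite -(fineK cfin); set C := fine _ => h.
rewrite -addeA -EFinD.
apply: (le_trans (leeD2r _ h)); rewrite -!EFinD lee_fin.
have : d * c <= d * y ord0 j by rewrite ler_wpM2l.
set Q := _ + _ + `|a| * _; set u := x ord0 j; set v := y ord0 j => dc.
rewrite !expr2; nra.
Qed.

(** The same balance with [- d] instead of [d] leaves [(v - a) * d <= 0]. A wide inequality is
    enough, the strict gain coming from the forward move. *)
Lemma tight_le_move a z (x : X) (d : R) (e' : Gamma) : 0 <= d ->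
  tight (partner_le a) z -> cpts z.1 `&` box b = [set x] -> box b (x - d *: unitv R j) ->
  cpts e' = (cpts z.1 `\ x) `|` [set x - d *: unitv R j] ->
  npts R (cpts e') (box b) = 1%:R%:E ->
  (cost e' z.2 + (potential a e')%:E <= cost z.1 z.2 + (potential a z.1)%:E)%E.
Proof.
rewrite -scaleNr; move=> d0 tz ebx bx' e'E e'1.
have [x0 [y [B [ebx0 mB Bxy Zxy cB]]]] := tight_matching (@partner_le_closed a) tz.
have xx0 : x0 = x by have : [set x] x0 by rewrite -ebx ebx0.
subst x0.
have [ex bx] : (cpts z.1 `&` box b) x by rewrite ebx.
have nin := move_notin ebx bx'.
have h := cost_shift mB Bxy e'E nin; rewrite cB in h.
have cy : y ord0 j <= a by exact: Zxy bx.
have e'bx : cpts e' `&` box b = [set x + (- d) *: unitv R j].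
  have /npts1P[w e'w] := e'1.
  have : [set w] (x + (- d) *: unitv R j) by rewrite -e'w; split=> //; rewrite e'E; right.
  by rewrite e'w => ->.
have [z1 _ _] := tz.
rewrite /potential !asboolT// (ucoordE ebx) (ucoordE e'bx) !mxE !eqxx /= mulr1.
have [_ coo _] := tz.
have cfin : cost z.1 z.2 \is a fin_num by rewrite ge0_fin_numE// cost_ge0.
move: h; rewrite -(fineK cfin); set C := fine _ => h.
apply: (le_trans (leeD2r _ h)); rewrite -!EFinD lee_fin.
have : d * y ord0 j <= d * a by rewrite ler_wpM2l.
set Q := _ + _ + `|a| * _; set u := x ord0 j; set v := y ord0 j => dc.
rewrite !expr2; nra.
Qed.

End Constraints.


Lemma integral_fst_eq d d' (T : measurableType d) (T' : measurableType d') (R : realType)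
    (g g' : {measure set (T * T') -> \bar R}) (phi : T -> \bar R) :
  (forall A, measurable A -> g' [set z | A z.1] = g [set z | A z.1]) ->
  measurable_fun setT phi -> (forall x, (0 <= phi x)%E) ->
  (\int[g']_z phi z.1 = \int[g]_z phi z.1)%E.
Proof.
move=> gg' mphi phi0.
have E (m : {measure set (T * T') -> \bar R}) :
    (\int[m]_z phi z.1 = \int[pushforward m fst]_x phi x)%E.
  by rewrite (ge0_integral_pushforward (@measurable_fst _ _ T T') m measurableT mphi (fun x _ => phi0 x)).
by rewrite !E; apply: eq_measure_integral => A mA _; rewrite /pushforward; exact: gg'.
Qed.

(** The integral of the potential is thus finite and can be cancelled when two couplings are
    compared. *)
Lemma potential_bounded (R : realType) k (b : bidx k) j (a : R) :
  exists M, forall e : Gamma R k, potential b j a e <= M.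
Proof.
pose L : R := ratr (b.1 j); pose U : R := ratr (b.2 j).
exists (L ^+ 2 + U ^+ 2 + `|a| * (`|L| + `|U|) + `|a| * (`|L| + `|U|)) => e.
have L0 := sqr_ge0 L; have U0 := sqr_ge0 U.
have a0 : 0 <= `|a| * (`|L| + `|U|) by rewrite mulr_ge0 ?addr_ge0.
rewrite /potential; case: asboolP => [/npts1P[x ebx]|_]; last by lra.
have [_ bx] : (cpts e `&` box b) x by rewrite ebx.
rewrite (ucoordE j ebx); have /andP[] := bx j.
rewrite -/L -/U; set u := x ord0 j => Lu uU.
have h2 : `|a * u| <= `|a| * (`|L| + `|U|).
  rewrite normrM ler_wpM2l// ler_norml; have := ler_norm U; have := ler_norm (- L).
  rewrite normrN => ? ?; have := normr_ge0 L; have := normr_ge0 U => ? ?.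
  by apply/andP; split; lra.
have := ler_norm (a * u) => h3.
have := sqr_ge0 u; lra.
Qed.

(** * The swap and its consequence for the supports *)

Section Disjointness.
Variables (R : realType) (k : nat).
Local Notation X := (X R k).
Local Notation Gamma := (Gamma R k).
Variables (mu nu : probability Gamma R) (g : probability (Gamma * Gamma)%type R).
Hypothesis g_opt : optimal mu nu g.
Hypothesis g_fin : (mk_cost g < +oo)%E.
Variables (b : bidx k) (j : 'I_k).
Variables (a c : R) (ac : a < c).
Local Notation S1 := (tight b (@partner_ge R k b j c)).
Local Notation S2 := (tight b (@partner_le R k b j a)).

Variable W : R -> Gamma -> Gamma.
Hypothesis mW : forall t, measurable_fun setT (W t).
Hypothesis W0 : forall e, W 0 e = e.
Hypothesis WD : forall t s e, W (t + s) e = W t (W s e).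
Hypothesis W_box : forall t e x, cpts e `&` box b = [set x] ->
  exists x', cpts (W t e) `&` box b = [set x'].
Hypothesis W_move : forall t e x, 0 < t -> cpts e `&` box b = [set x] ->
  exists d, [/\ 0 < d, box b (x + d *: unitv R j) &
    cpts (W t e) = (cpts e `\ x) `|` [set x + d *: unitv R j]].
Hypothesis W_qi : forall t A, measurable A -> mu A = 0%E <-> mu (W t @^-1` A) = 0%E.

(** The displacement of the point in the box. The maximum keeps it nonnegative where the two
    coordinates have no meaning. *)
Definition shift_gain t (z : Gamma * Gamma) : R :=
  Num.max 0 (ucoord b j (W t z.1) - ucoord b j z.1).

Lemma shift_gainE t (z : Gamma * Gamma) x d : 0 < d -> cpts z.1 `&` box b = [set x] ->
  box b (x + d *: unitv R j) ->
  cpts (W t z.1) = (cpts z.1 `\ x) `|` [set x + d *: unitv R j] -> shift_gain t z = d.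
Proof.
move=> d0 ebx bx' WE; rewrite /shift_gain (ucoordE j ebx).
have e'bx : cpts (W t z.1) `&` box b = [set x + d *: unitv R j].
  have [w e'w] := W_box t ebx.
  have : [set w] (x + d *: unitv R j) by rewrite -e'w; split=> //; rewrite WE; right.
  by rewrite e'w => ->.
rewrite (ucoordE j e'bx) !mxE !eqxx /= mulr1 addrAC subrr add0r.
by apply/max_idPr; exact: ltW.
Qed.

Lemma S1_move t z : 0 < t -> S1 z -> 0 < shift_gain t z /\
  (cost (W t z.1) z.2 + (potential b j a (W t z.1))%:E + ((c - a) * shift_gain t z)%:E <=
   cost z.1 z.2 + (potential b j a z.1)%:E)%E.
Proof.
move=> t0 Sz; have [/npts1P[x ebx] _ _] := Sz.
have [d [d0 bx' WE]] := W_move t0 ebx.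
rewrite (shift_gainE d0 ebx bx' WE); split=> //.
apply: (tight_ge_move a (ltW d0) Sz ebx bx' WE).
by apply/npts1P; exact: W_box ebx.
Qed.

Lemma S2_move t z : 0 < t -> S2 z ->
  (cost (W (- t) z.1) z.2 + (potential b j a (W (- t) z.1))%:E <=
   cost z.1 z.2 + (potential b j a z.1)%:E)%E.
Proof.
move=> t0 Sz; have [/npts1P[x ebx] _ _] := Sz.
have [x' ebx'] := W_box (- t) ebx.
(* [W_move] speaks of positive times, so the backward move is read as the forward one that starts at
   [W (- t) z.1]. *)
have [d [d0 bx WE]] := W_move t0 ebx'.
rewrite -WD subrr W0 in WE.
have xE : x = x' + d *: unitv R j.
  have : [set x] (x' + d *: unitv R j) by rewrite -ebx; split=> //; rewrite WE; right.
  by move=> ->.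
have x'E : x' = x - d *: unitv R j by rewrite xE addrK.
have [ex'W bx'] : (cpts (W (- t) z.1) `&` box b) x' by rewrite ebx'.
apply: (tight_le_move (ltW d0) Sz ebx).
- by rewrite -x'E.
- rewrite -x'E WE -xE; apply/seteqP; split=> y.
    move=> ey; have [->|yx'] := pselect (y = x'); first by right.
    left; split; first by left.
    move=> /= yx; apply: yx'.
    have bxx : box b x by have [] : (cpts z.1 `&` box b) x by rewrite ebx.
    have : [set x'] y by rewrite -ebx'; split=> //; rewrite yx.
    by [].
  by move=> [[[[ey yx']|yx] nyx]|->] //; case: nyx.
- by apply/npts1P; exists x'.
Qed.

Let law1 (A : set Gamma) := g (S1 `&` [set z | A z.1]).
Let law2 (A : set Gamma) := g (S2 `&` [set z | A z.1]).
Variables (A1 A2 : set Gamma).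
Hypothesis mA1 : measurable A1.
Hypothesis mA2 : measurable A2.
Hypothesis A1P : forall B, measurable B -> law1 B = 0%E <-> mu (B `&` A1) = 0%E.
Hypothesis A2P : forall B, measurable B -> law2 B = 0%E <-> mu (B `&` A2) = 0%E.

(** On [E] the law [m1] of [z.1] on [S1] is dominated by the law [m2] of [W (- t) z.1] on [S2], and
    their common part supplies the weights of the swap. The new coupling cannot be cheaper, so the
    gain is null and [S1] does not charge [E]. *)
Lemma supports_disjoint t : 0 < t -> mu (A1 `&` W t @^-1` A2) = 0%E.
Proof.
move=> t0; set E := A1 `&` _.
have mpre s A : measurable A -> measurable (W s @^-1` A).
  by move=> mA; rewrite -[X in measurable X]setTI; exact: mW.
have mE : measurable E by apply: measurableI => //; exact: mpre.
have mS1 : measurable S1 by apply: measurable_tight; exact: partner_ge_closed.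
have mS2 : measurable S2 by apply: measurable_tight; exact: partner_le_closed.
have mfst A : measurable A -> measurable [set z : Gamma * Gamma | A z.1].
  move=> mA; have mf : measurable_fun setT (fst : Gamma * Gamma -> Gamma) by exact: measurable_fst.
  by rewrite -[X in measurable X]setTI; exact: (mf measurableT _ mA).
have mWfst s : measurable_fun setT (fun z : Gamma * Gamma => W s z.1).
  by apply: measurableT_comp => //; exact: measurable_fst.
have I10 z : 0 <= \1_S1 z :> R by rewrite indicE.
have I20 z : 0 <= \1_S2 z :> R by rewrite indicE.
have mI1 : measurable_fun setT (\1_S1 : Gamma * Gamma -> R) by exact: measurable_indic.
have mI2 : measurable_fun setT (\1_S2 : Gamma * Gamma -> R) by exact: measurable_indic.
have [m1 m1E] := exists_wimg g mI1 I10 (@measurable_fst _ _ Gamma Gamma).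
have [m2 m2E] := exists_wimg g mI2 I20 (mWfst (- t)).
have law_int (B : set (Gamma * Gamma)) (C : set (Gamma * Gamma)) : measurable B -> measurable C ->
    g (B `&` C) = (\int[g]_z ((\1_B z)%:E * (\1_C z)%:E))%E.
  move=> mB mC; rewrite -[X in g X]setIT -integral_indic//; last exact: measurableI.
  by apply: eq_integral => z _; rewrite !indicE -EFinM -natrM mulnb in_setI.
have indE (A : set Gamma) (e : Gamma) (C : set (Gamma * Gamma)) z : (A e <-> C z) ->
    \1_A e = \1_C z :> R.
  by move=> AC; rewrite !indicE; congr (_%:R); congr nat_of_bool; apply/idP/idP; rewrite !inE => /AC.
have mindic (A : set Gamma) : measurable A -> measurable_fun setT (fun x => (\1_A x)%:E : \bar R).
  by move=> mA; exact/measurable_EFinP/measurable_indic.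
have m1A A : measurable A -> m1 A = law1 A.
  move=> mA; rewrite /law1 law_int//; last exact: mfst.
  rewrite -[X in m1 X](setIT A) -integral_indic// (m1E _ (mindic A mA)); last first.
    by move=> x; rewrite lee_fin indicE.
  by apply: eq_integral => z _; congr (_ * _%:E)%E; exact: indE.
have m2A A : measurable A -> m2 A = law2 (W (- t) @^-1` A).
  move=> mA; rewrite /law2 law_int//; last by apply: mfst; exact: mpre.
  rewrite -[X in m2 X](setIT A) -integral_indic// (m2E _ (mindic A mA)); last first.
    by move=> x; rewrite lee_fin indicE.
  by apply: eq_integral => z _; congr (_ * _%:E)%E; exact: indE.
have g_le A : measurable A -> (g A < +oo)%E.
  by move=> mA; apply: le_lt_trans (probability_le1 g mA) _; exact: ltry.
have m1oo : (m1 setT < +oo)%E.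
  by rewrite m1A//; apply: g_le; apply: measurableI => //; exact: mfst.
have m2oo : (m2 setT < +oo)%E.
  by rewrite m2A//; apply: g_le; apply: measurableI => //; apply: mfst; exact: mpre.
have [h1 [h2 [[mh1 mh2] h1b h2b h1pos h12]]] : exists h1 h2 : Gamma -> R,
  [/\ measurable_fun setT h1 /\ measurable_fun setT h2,
    forall x, 0 <= h1 x <= 2^-1, forall x, 0 <= h2 x <= 2^-1,
    forall x, E x -> 0 < h1 x &
    forall phi : Gamma -> \bar R, measurable_fun setT phi -> (forall x, (0 <= phi x)%E) ->
      (\int[m1]_x ((h1 x)%:E * phi x) = \int[m2]_x ((h2 x)%:E * phi x))%E].
  (* If [m2 A] vanishes, the preimage of [A] under [W (- t)] meets [A2] in a [mu]-null set; pulling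
     back by [W t] preserves null sets and shows that [A], being inside [E], is [mu]-null. *)
  apply: common_part => // A mA AE; rewrite m2A// m1A//.
  move=> /(A2P (mpre _ _ mA)) /(W_qi t (measurableI _ _ (mpre _ _ mA) mA2)) h.
  apply/A1P => //; rewrite -h; congr (mu _); apply/seteqP; split=> e.
    move=> [Ae _]; have [A1e A2e] := AE e Ae.
    by split=> //=; rewrite /preimage /= -WD addNr W0.
  move=> [/=]; rewrite /preimage /= -WD addNr W0 => Ae A2e; split=> //.
  by have [] := AE e Ae.
pose w1 (z : Gamma * Gamma) : R := \1_S1 z * h1 z.1.
pose w2 (z : Gamma * Gamma) : R := \1_S2 z * h2 (W (- t) z.1).
have mw1 : measurable_fun setT w1.
  apply: measurable_funM => //.
  exact: (measurableT_comp mh1 (@measurable_fst _ _ Gamma Gamma)).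
have mw2 : measurable_fun setT w2.
  by apply: measurable_funM => //; exact: (measurableT_comp mh2 (mWfst (- t))).
have w1b z : 0 <= w1 z <= 2^-1.
  by rewrite /w1 indicE; case: (z \in _); rewrite /= ?mul1r ?mul0r ?lexx ?invr_ge0 ?ler0n//; exact: h1b.
have w2b z : 0 <= w2 z <= 2^-1.
  by rewrite /w2 indicE; case: (z \in _); rewrite /= ?mul1r ?mul0r ?lexx ?invr_ge0 ?ler0n//; exact: h2b.
have bal phi : measurable_fun setT phi -> (forall x, (0 <= phi x)%E) ->
    (\int[g]_z ((w1 z)%:E * phi z.1) = \int[g]_z ((w2 z)%:E * phi (W (- t) z.1)))%E.
  move=> mphi phi0.
  have mp (h : Gamma -> R) : measurable_fun setT h ->
      measurable_fun setT (fun x => (h x)%:E * phi x)%E.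
    by move=> ?; apply: emeasurable_funM => //; exact/measurable_EFinP.
  transitivity (\int[m1]_x ((h1 x)%:E * phi x))%E.
    rewrite m1E; last 2 first.
    - exact: mp.
    - by move=> x; rewrite mule_ge0// lee_fin; have /andP[] := h1b x.
    by apply: eq_integral => z _; rewrite /w1 EFinM muleA.
  rewrite h12// m2E; last 2 first.
  - exact: mp.
  - by move=> x; rewrite mule_ge0// lee_fin; have /andP[] := h2b x.
  by apply: eq_integral => z _; rewrite /w2 EFinM muleA.
have WK x : W t (W (- t) x) = x by rewrite -WD subrr W0.
have [g' [g'1 g'2 g'E]] := swap_coupling (mW t) (mW (- t)) WK mw1 mw2 w1b w2b bal.
have [cg gmin] := g_opt.
have cg' : couplings mu nu g'.
  move=> A mA; have [gA1 gA2] := cg A mA.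
  by rewrite -gA1 -gA2; split; [exact: g'1|exact: g'2].
pose f := potential (R := R) b j a.
have f0 e : (0 <= (f e)%:E)%E by rewrite lee_fin potential_ge0.
have mf : measurable_fun setT (fun e => (f e)%:E).
  by apply/measurable_EFinP; exact: measurable_potential.
have mf1 : measurable_fun setT (fun z : Gamma * Gamma => (f z.1)%:E).
  exact: (measurableT_comp mf (@measurable_fst _ _ Gamma Gamma)).
(* Both couplings have the same first marginal, so adding [f] shifts their costs by the same amount,
   while [ch] does not increase along either move. *)
pose ch (z : Gamma * Gamma) : \bar R := (cost z.1 z.2 + (f z.1)%:E)%E.
have ch0 z : (0 <= ch z)%E by rewrite adde_ge0// cost_ge0.
have mcost := @measurable_cost R k.
have mch : measurable_fun setT ch by exact: emeasurable_funD.
have chE (m : probability (Gamma * Gamma)%type R) :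
    (\int[m]_z ch z = mk_cost m + \int[m]_z (f z.1)%:E)%E.
  by rewrite ge0_integralD// => z _; exact: cost_ge0.
have fE : (\int[g']_z (f z.1)%:E = \int[g]_z (f z.1)%:E)%E.
  exact: (integral_fst_eq (phi := fun e => (f e)%:E)).
pose G (z : Gamma * Gamma) : \bar R := (w1 z * ((c - a) * shift_gain t z))%:E.
have G0 z : (0 <= G z)%E.
  rewrite lee_fin mulr_ge0//; first by have /andP[] := w1b z.
  by rewrite mulr_ge0 ?subr_ge0 ?(ltW ac)// /shift_gain le_max lexx.
have mG : measurable_fun setT G.
  apply/measurable_EFinP; apply: measurable_funM => //.
  apply: measurable_funM; first exact: measurable_cst.
  apply: measurable_maxr; first exact: measurable_cst.
  apply: measurable_funB.
    exact: (measurableT_comp (@measurable_ucoord R k b j) (mWfst t)).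
  exact: (measurableT_comp (@measurable_ucoord R k b j) (@measurable_fst _ _ Gamma Gamma)).
pose H (z : Gamma * Gamma) : \bar R := ((1 - w1 z - w2 z)%:E * ch z +
  (w1 z)%:E * ch (W t z.1, z.2) + (w2 z)%:E * ch (W (- t) z.1, z.2))%E.
have w00 z : 0 <= 1 - w1 z - w2 z.
  by have /andP[_] := w1b z; have /andP[_] := w2b z; lra.
have w10 z : 0 <= w1 z by have /andP[] := w1b z.
have w20 z : 0 <= w2 z by have /andP[] := w2b z.
have H0 z : (0 <= H z)%E.
  by rewrite !adde_ge0// mule_ge0// lee_fin.
have mchs s : measurable_fun setT (fun z : Gamma * Gamma => ch (W s z.1, z.2)).
  apply: (measurableT_comp mch); apply: measurable_fun_pair; first exact: mWfst.
  exact: measurable_snd.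
have mH : measurable_fun setT H.
  apply: emeasurable_funD; last by apply: emeasurable_funM => //; exact/measurable_EFinP.
  apply: emeasurable_funD; last by apply: emeasurable_funM => //; exact/measurable_EFinP.
  apply: emeasurable_funM => //; apply/measurable_EFinP.
  by apply: measurable_funB => //; apply: measurable_funB => //; exact: measurable_cst.
have HG z : (H z + G z <= ch z)%E.
  have le1 : ((w1 z)%:E * ch (W t z.1, z.2) + G z <= (w1 z)%:E * ch z)%E.
    have [S1z|S1z] := pselect (S1 z); last first.
      by rewrite /G /w1 indicE memNset//= !mul0r !mul0e adde0.
    have [gain0 gainle] := S1_move t0 S1z.
    have gain1 : (0 <= ((c - a) * shift_gain t z)%:E)%E.
      by rewrite lee_fin mulr_ge0 ?(ltW gain0)// subr_ge0 ltW.
    rewrite /G (EFinM (w1 z)) -(ge0_muleDr _ (ch0 _) gain1).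
    by apply: lee_wpmul2l => //; exact: w10.
  have le2 : ((w2 z)%:E * ch (W (- t) z.1, z.2) <= (w2 z)%:E * ch z)%E.
    have [S2z|S2z] := pselect (S2 z); last by rewrite /w2 indicE memNset//= !mul0r !mul0e.
    by apply: lee_wpmul2l; [exact: w20|exact: S2_move].
  have -> : ch z = ((1 - w1 z - w2 z)%:E * ch z + (w1 z)%:E * ch z + (w2 z)%:E * ch z)%E.
    rewrite -ge0_muleDl ?lee_fin// -ge0_muleDl ?lee_fin//; last by rewrite addr_ge0.
    by rewrite -!EFinD (_ : 1 - w1 z - w2 z + w1 z + w2 z = 1) ?mul1e//; ring.
  by rewrite /H addeAC; apply: leeD => //; rewrite -addeA; apply: leeD2l.
have int_ineq : (\int[g']_z ch z + \int[g]_z G z <= \int[g]_z ch z)%E.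
  rewrite g'E// -ge0_integralD//; last by move=> z _; exact: H0.
  apply: ge0_le_integral => //.
  - by move=> z _; apply: adde_ge0; [exact: H0|exact: G0].
  - exact: emeasurable_funD.
  - by move=> z _; exact: HG.
have fint : (\int[g]_z (f z.1)%:E < +oo)%E.
  have [M fM] := potential_bounded b j a.
  apply: (@le_lt_trans _ _ (\int[g]_z M%:E)%E).
    by apply: ge0_le_integral => // z _; rewrite lee_fin; exact: fM.
  by rewrite integral_cst//= probability_setT mule1 ltry.
(* Under [g] the integral of [ch] is finite and no larger than under [g'], which leaves no room for
   a gain. *)
have intG0 : (\int[g]_z G z = 0)%E.
  have gfin : (mk_cost g + \int[g]_z (f z.1)%:E)%E \is a fin_num.
    rewrite ge0_fin_numE; first exact: lte_add_pinfty.
    by rewrite adde_ge0 ?mk_cost_ge0// integral_ge0.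
  apply/eqP; rewrite eq_le integral_ge0// andbT.
  move: int_ineq; rewrite !chE fE => int_ineq.
  rewrite -(leeD2lE _ _ gfin) adde0; apply: le_trans int_ineq.
  by apply: leeD2r; apply: leeD2r; exact: gmin.
have /(ae_eq_integral_abs _ measurableT mG) [N [mN N0 GN]] : (\int[g]_z `|G z| = 0)%E.
  by rewrite -intG0; apply: eq_integral => z _; rewrite gee0_abs.
(* Over [E] the weight [h1] is positive, so [G] is positive on the part of [S1] above [E], which is
   therefore [g]-null; [A1P] turns this into a statement on [mu]. *)
rewrite (_ : E = E `&` A1); last by rewrite setIAC setIid.
apply/A1P => //; apply/eqP; rewrite -measure_le0 -N0; apply: le_measure.
- by rewrite inE; apply: measurableI => //; exact: mfst.
- by rewrite inE.
move=> z [S1z Ez]; apply: GN => /= /(_ I) /eqP; rewrite eqe => /eqP Gz.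
have [gain0 _] := S1_move t0 S1z.
have : 0 < w1 z * ((c - a) * shift_gain t z).
  by rewrite !mulr_gt0 ?subr_gt0// ?h1pos// indicE mem_set.
by rewrite Gz ltxx.
Qed.

End Disjointness.


Lemma infinite_seq (T : pointedType) (A : set T) : infinite_set A ->
  exists2 f : nat -> T, injective f & forall i, A (f i).
Proof.
move=> /infiniteP/pcard_leP[f]; exists f.
  by move=> i j; apply: (@inj _ _ [set: nat] f); rewrite inE.
by move=> i; exact: funS.
Qed.

Lemma uncountable_real (R : realType) : ~ countable [set: R].
Proof.
move=> /countable_lebesgue_measure0 h.
have : (lebesgue_measure `[0%R, 1%R]%classic <= lebesgue_measure [set: R])%E.
  by apply: le_measure; rewrite ?inE.
by rewrite h lebesgue_measure_itv/= lte_fin ltr01 oppr0 adde0 lee_fin ler10.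
Qed.

(** * Optimal couplings are carried by graphs *)

Section Recurrence.
Context d (T : measurableType d) (R : realType) (mu : probability T R).
Local Open Scope ereal_scope.

(** Removing the earlier sets from [A i] loses no mass and makes the family disjoint; more than
    [1/e] sets of mass at least [e] would then exceed total mass one. *)
Lemma disjoint_seq_small (A : nat -> set T) (e : R) : (0 < e)%R ->
  (forall i, measurable (A i)) ->
  (forall i j, (i < j)%N -> mu (A i `&` A j) = 0) ->
  exists i, mu (A i) < e%:E.
Proof.
move=> e0 mA dA; apply: contrapT => /forallNP Ae.
have eA i : e%:E <= mu (seqDU A i).
  have mU : measurable (\big[setU/set0]_(j < i) A j) by apply: bigsetU_measurable.
  have {}Ae : e%:E <= mu (A i) by rewrite leNgt; apply/negP.
  apply: (le_trans Ae); rewrite (measureDI mu (mA i) mU).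
  rewrite [X in _ + X](_ : _ = 0) ?adde0//.
  rewrite big_distrr/=; apply: measure_negligible.
    by apply: bigsetU_measurable => l _; exact: measurableI.
  elim/big_ind: _ => [|B C|l _]; [exact: negligible_set0|exact: negligibleU|].
  by apply/negligibleP; [exact: measurableI|rewrite setIC; exact: (dA l i)].
have : mu (\bigcup_i seqDU A i) <= 1.
  by apply: probability_le1; apply: bigcup_measurable => i _; exact: seqDU_measurable.
rewrite measure_semi_bigcup//; last 2 first.
- exact: seqDU_measurable.
- by apply: bigcup_measurable => i _; exact: seqDU_measurable.
pose n := (Num.truncn e^-1).+1.
have := @nneseries_lim_ge R (fun i => mu (seqDU A i)) xpredT 0 n (fun _ _ _ => measure_ge0 _ _).
move=> /le_trans h /h; apply/negP; rewrite -ltNge.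
apply: (@lt_le_trans _ _ (\sum_(0 <= i < n) e%:E)); last first.
  by apply: lee_sum => i _; exact: eA.
rewrite sumEFin lte_fin big_const_nat subn0 iter_addr addr0 -mulr_natl.
by rewrite -ltr_pdivrMr// div1r -Num.Theory.truncn_lt_nat// invr_ge0 ltW.
Qed.

(** If [mu A > 0], the sets [W t @^-1` A] for [t] real would be uncountably many almost disjoint
    sets of positive measure. *)
Lemma flow_wandering_null (W : R -> T -> T) (A : set T) :
  (forall t, measurable_fun setT (W t)) -> (forall e, W 0%R e = e) ->
  (forall t s e, W (t + s)%R e = W t (W s e)) ->
  (forall t B, measurable B -> mu B = 0 <-> mu (W t @^-1` B) = 0) ->
  measurable A -> (forall t, (0 < t)%R -> mu (A `&` W t @^-1` A) = 0) ->
  mu A = 0.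
Proof.
move=> mW W0 WD qi mA wA; apply: contrapT => A0.
have mWA t B : measurable B -> measurable (W t @^-1` B).
  by move=> mB; rewrite -[X in measurable X]setTI; exact: mW.
have meet s t : (s < t)%R -> mu (W s @^-1` A `&` W t @^-1` A) = 0.
  move=> st; rewrite (_ : _ `&` _ = W s @^-1` (A `&` W (t - s)%R @^-1` A)).
    apply: (qi s _ (measurableI _ _ mA (mWA _ _ mA))).1.
    by apply: wA; rewrite subr_gt0.
  by apply/seteqP; split=> e; rewrite /preimage /= -WD subrK.
pose S n := [set t | (n.+1%:R^-1)%:E <= mu (W t @^-1` A)].
have SR : \bigcup_n S n = setT.
  apply/seteqP; split=> // t _.
  have : 0 < mu (W t @^-1` A).
    rewrite lt0e measure_ge0 andbT; apply/eqP => /(qi t A mA).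
    exact: A0.
  move=> h; have fn : mu (W t @^-1` A) \is a fin_num by apply: fin_num_measure; exact: mWA.
  move: h; rewrite -(fineK fn) lte_fin => /ltr_add_invr[n]; rewrite add0r => hn.
  by exists n => //; rewrite /S /= -(fineK fn) lee_fin ltW.
(* The uncountable real line is the countable union of the [S n], which cannot all be finite. *)
have [n Sn] : exists n, infinite_set (S n).
  apply: contrapT => /forallNP fS; apply: (@uncountable_real R).
  rewrite -SR; apply: bigcup_countable => // n _.
  by apply: finite_set_countable; apply: contrapT => /(fS n).
have [f finj fS] := infinite_seq Sn.
have [||i j ij|i] := @disjoint_seq_small (fun i => W (f i) @^-1` A) (n.+1%:R^-1)%R.
- by rewrite invr_gt0.
- by move=> i; exact: mWA.
- have : f i != f j by apply/eqP => /finj ij'; rewrite ij' ltnn in ij.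
  by rewrite neq_lt => /orP[|] /meet //; rewrite setIC.
by apply/negP; rewrite -leNgt; exact: fS.
Qed.

End Recurrence.

Lemma ae_forall_count d (T : measurableType d) (R : realType) (I : countType)
    (m : {measure set T -> \bar R}) (P : I -> T -> Prop) :
  (forall i, {ae m, forall x, P i x}) -> {ae m, forall x, forall i, P i x}.
Proof.
move=> aeP.
have h : {ae m, forall x, forall n,
    (fun n x => if unpickle n is Some i then P i x else True) n x}.
  apply: ae_foralln => n; case: (unpickle n) => [i|]; first exact: aeP.
  exact: aeW.
by apply: filterS h => x h i; have := h (pickle i); rewrite pickleK.
Qed.

(** * From disjoint supports to a transport map *)

Section OptimalIsGraph.
Variables (R : realType) (k : nat).
Local Notation X := (X R k).
Local Notation Gamma := (Gamma R k).
Variables (mu nu : probability Gamma R) (g : probability (Gamma * Gamma)%type R).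
Hypothesis muH : hypH mu.
Hypothesis g_opt : optimal mu nu g.
Hypothesis g_fin : (mk_cost g < +oo)%E.

Let mfst A : measurable A -> measurable [set z : Gamma * Gamma | A z.1].
Proof.
move=> mA; have mf : measurable_fun setT (fst : Gamma * Gamma -> Gamma) by exact: measurable_fst.
by rewrite -[X in measurable X]setTI; exact: (mf measurableT _ mA).
Qed.

(** The law of [z.1] on [S] is dominated by [mu], the first marginal of [g], so it has a support in
    the sense of [exists_support]. *)
Lemma exists_law_support (S : set (Gamma * Gamma)) : measurable S ->
  exists A, measurable A /\ forall B, measurable B ->
    g (S `&` [set z | B z.1]) = 0%E <-> mu (B `&` A) = 0%E.
Proof.
move=> mS; have mf : measurable_fun setT (fst : Gamma * Gamma -> Gamma) by exact: measurable_fst.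
have [m mE] := exists_pushforward (mrestr g mS : {measure set _ -> \bar R}) mf.
have {}mE B : m B = g (S `&` [set z | B z.1]) by rewrite mE setIC.
have [||A mA mAP|A [mA AP]] := @exists_support _ _ _ m mu.
- rewrite mE; apply: le_lt_trans (ltry 1); apply: probability_le1.
  by apply: measurableI => //; exact: mfst.
- by apply: le_lt_trans (ltry 1); exact: probability_le1.
- rewrite mE; have [gA _] := g_opt.1 A mA.
  apply/eqP; rewrite -measure_le0 -[leRHS]mAP -[leRHS]gA; apply: le_measure; rewrite ?inE.
  + by apply: measurableI => //; exact: mfst.
  + exact: mfst.
  + by move=> z [].
by exists A; split=> // B mB; rewrite -mE; exact: AP.
Qed.

(** The intersection lies in both supports, so for each positive time it almost surely misses its
    own preimage under the flow: it is a wandering set, hence null. *)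
Lemma supports_null (b : bidx k) (j : 'I_k) (a c : R) (A1 A2 : set Gamma) :
  (forall i, b.1 i < b.2 i) -> a < c -> measurable A1 -> measurable A2 ->
  (forall B, measurable B ->
    g (tight b (partner_ge b j c) `&` [set z | B z.1]) = 0%E <-> mu (B `&` A1) = 0%E) ->
  (forall B, measurable B ->
    g (tight b (partner_le b j a) `&` [set z | B z.1]) = 0%E <-> mu (B `&` A2) = 0%E) ->
  mu (A1 `&` A2) = 0%E.
Proof.
move=> b_ne ac mA1 mA2 A1P A2P.
have [W [[mW W0 WD] W_box W_move W_qi]] := exists_config_flow R j b_ne.
have mWA t B : measurable B -> measurable (W t @^-1` B).
  by move=> mB; rewrite -[X in measurable X]setTI; exact: mW.
have mA : measurable (A1 `&` A2) by exact: measurableI.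
apply: (flow_wandering_null mW W0 WD (W_qi mu muH) mA) => t t0.
have h := supports_disjoint g_opt g_fin ac mW W0 WD W_box W_move (W_qi mu muH) mA1 mA2 A1P A2P t0.
apply/eqP; rewrite -measure_le0 -h; apply: le_measure; rewrite ?inE.
- by apply: measurableI => //; exact: mWA.
- by apply: measurableI => //; exact: mWA.
- by move=> e [[A1e _] [_ A2e]].
Qed.

Lemma cost_fin_ae : {ae g, forall z, (cost z.1 z.2 < +oo)%E}.
Proof.
have mc := @measurable_cost R k.
have ig : g.-integrable setT (fun z => cost z.1 z.2).
  apply/integrableP; split=> //; rewrite (eq_integral (fun z => cost z.1 z.2))// => z _.
  by rewrite gee0_abs// cost_ge0.
have := integrable_ae measurableT ig; apply: filterS => z /(_ Logic.I).
by rewrite ge0_fin_numE// cost_ge0.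
Qed.

(** [Ag] and [Al] collect the first configurations that allow a partner above, respectively below, a
    rational level. Above [q] and below [r < q] are almost surely incompatible, so these sets form a
    Dedekind cut of each coordinate of the partner. *)
Lemma optimal_graph : exists T : Gamma -> Gamma,
  measurable_fun setT T /\ {ae g, forall z, z.2 = T z.1}.
Proof.
pose I := (bidx k * 'I_k * rat)%type.
have /choice[Ag AgP] : forall i : I, exists A, measurable A /\ forall B, measurable B ->
    g (tight i.1.1 (partner_ge i.1.1 i.1.2 (ratr i.2)) `&` [set z | B z.1]) = 0%E <->
    mu (B `&` A) = 0%E.
  by move=> i; apply: exists_law_support; apply: measurable_tight; exact: partner_ge_closed.
have /choice[Al AlP] : forall i : I, exists A, measurable A /\ forall B, measurable B ->
    g (tight i.1.1 (partner_le i.1.1 i.1.2 (ratr i.2)) `&` [set z | B z.1]) = 0%E <->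
    mu (B `&` A) = 0%E.
  by move=> i; apply: exists_law_support; apply: measurable_tight; exact: partner_le_closed.
have ae_support (S : set (Gamma * Gamma)) A : measurable S -> measurable A ->
    (forall B, measurable B -> g (S `&` [set z | B z.1]) = 0%E <-> mu (B `&` A) = 0%E) ->
    {ae g, forall z, S z -> A z.1}.
  move=> mS mA AP; exists (S `&` [set z | (~` A) z.1]); split.
  - by apply: measurableI => //; apply: mfst; exact: measurableC.
  - by apply/AP; [exact: measurableC|rewrite setICl measure0].
  - by move=> z /= /not_implyP.
have aeg : {ae g, forall z, forall i : I,
    tight i.1.1 (partner_ge i.1.1 i.1.2 (ratr i.2)) z -> Ag i z.1}.
  apply: ae_forall_count => i; apply: ae_support (AgP i).1 (AgP i).2.
  by apply: measurable_tight; exact: partner_ge_closed.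
have ael : {ae g, forall z, forall i : I,
    tight i.1.1 (partner_le i.1.1 i.1.2 (ratr i.2)) z -> Al i z.1}.
  apply: ae_forall_count => i; apply: ae_support (AlP i).1 (AlP i).2.
  by apply: measurable_tight; exact: partner_le_closed.
have aen : {ae g, forall z, forall u : bidx k * 'I_k * rat * rat,
    (forall i, u.1.1.1.1 i < u.1.1.1.2 i) -> u.1.2 < u.2 ->
    ~ (Ag (u.1.1, u.2) z.1 /\ Al (u.1.1, u.1.2) z.1)}.
  apply: ae_forall_count => -[[[b j] r] q] /=.
  have [b_ne|] := pselect (forall i, b.1 i < b.2 i); last by move=> nb; apply: aeW => z /nb.
  have [rq|] := boolP (r < q); last by move=> _; apply: aeW.
  have [mAg AgP'] := AgP (b, j, q); have [mAl AlP'] := AlP (b, j, r).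
  have mA : measurable (Ag (b, j, q) `&` Al (b, j, r)) by exact: measurableI.
  exists [set z | (Ag (b, j, q) `&` Al (b, j, r)) z.1]; split.
  - exact: mfst.
  - have [-> _] := g_opt.1 _ mA.
    apply: (supports_null b_ne _ mAg mAl AgP' AlP').
    by rewrite ltr_rat.
  - move=> z /= h; apply: contrapT => h'; apply: h => _ _ h''; exact: h'.
(* The candidate for the partner of the only point in [b], computed from the first configuration
   alone. *)
pose F (b : bidx k) (e : Gamma) : X := \row_j rat_sup R (fun q => Ag (b, j, q) e).
pose E (b : bidx k) : set Gamma := [set e | npts R (cpts e) (box b) = 1%:R%:E].
have mE b : measurable (E b) by apply: measurable_count; exact: box_borel.
have mF b j : measurable_fun setT (fun e => F b e ord0 j).
  rewrite (_ : (fun _ => _) = fun e => rat_sup R (fun q => Ag (b, j, q) e)).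
    by apply: measurable_rat_sup => q; exact: (AgP (b, j, q)).1.
  by apply/funext => e; rewrite mxE.
exists (atoms_config E F); split; first exact: measurable_atoms_config.
have aec := cost_fin_ae.
near=> z.
have zc : (cost z.1 z.2 < +oo)%E by near: z.
have zg : forall i : I, tight i.1.1 (partner_ge i.1.1 i.1.2 (ratr i.2)) z -> Ag i z.1 by near: z.
have zl : forall i : I, tight i.1.1 (partner_le i.1.1 i.1.2 (ratr i.2)) z -> Al i z.1 by near: z.
have zn : forall u : bidx k * 'I_k * rat * rat,
    (forall i, u.1.1.1.1 i < u.1.1.1.2 i) -> u.1.2 < u.2 ->
    ~ (Ag (u.1.1, u.2) z.1 /\ Al (u.1.1, u.1.2) z.1) by near: z.
have [B [mB cB]] := cost_attained zc.
have [Bsub Bl Br Bfun _] := mB.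
have FE b x y : cpts z.1 `&` box b = [set x] -> B (x, y) -> F b z.1 = y.
  move=> ebx Bxy; apply/rowP => j; rewrite mxE.
  have [ex bx] : (cpts z.1 `&` box b) x by rewrite ebx.
  have b_ne i : b.1 i < b.2 i.
    by have /andP[] := bx i => /lt_trans h /h; rewrite ltr_rat.
  (* [x] is alone in the box, so a constraint on the partners of points of the box only concerns
     [y], and the optimal matching [B] witnesses tightness. *)
  have tightZ (Z : set (X * X)) : (forall p, B p -> box b p.1 -> p.2 = y -> Z p) ->
      (forall p, ~ box b p.1 -> Z p) -> tight b Z z.
    move=> Z1 Z2; split=> //; first by apply/npts1P; exists x.
    rewrite -cB; apply: costZ_le => // p Bp.
    have [bp|/Z2//] := pselect (box b p.1); apply: Z1 => //.
    have p1x : [set x] p.1 by rewrite -ebx; split=> //; have [] := Bsub p Bp.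
    apply: (Bfun x) => //; rewrite -p1x; by case: p Bp {bp p1x}.
  apply: rat_sup_eq => q qy.
    apply: (zg (b, j, q)); apply: tightZ => p; last by move=> np /np.
    by move=> _ _ py _; rewrite py ltW.
  (* A rational [r] between the coordinate of [y] and [q] separates the two events: [B] puts the
     partner below [r], which is incompatible with a partner allowed above [q]. *)
  move=> Agq; have /rat_in_itvoo[r] := qy; rewrite in_itv/= => /andP[yr rq].
  apply: (zn (b, j, r, q)) => //=; first by rewrite -(ltr_rat R).
  split=> //; apply: (zl (b, j, r)); apply: tightZ => p; last by move=> np /np.
  by move=> _ _ py _; rewrite py ltW.
have atE : atoms E F z.1 = cpts z.2.
  apply/seteqP; split=> o.
    move=> [b /npts1P[x ebx] <-].
    have [ex bx] : (cpts z.1 `&` box b) x by rewrite ebx.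
    have [y Bxy] := Bl x ex; rewrite (FE b x y ebx Bxy).
    by have [] := Bsub _ Bxy.
  move=> zo; have [x Bxo] := Br o zo; have [ex _] := Bsub _ Bxo.
  have [b [bx _ ebx]] := locfin_iso (@cpts_locfin _ _ z.1) ex (@filterT _ (nbhs x) _).
  by exists b; [apply/npts1P; exists x|exact: FE Bxo].
apply: config_ext; rewrite atoms_configE atE//.
exact: cpts_locfin.
Unshelve. all: by end_near.
Qed.

End OptimalIsGraph.

(** * Uniqueness *)

Lemma exists_average d (T : measurableType d) (R : realType) (g g' : probability T R) :
  exists h : probability T R,
    (forall A, h A = (2^-1%:E * g A + 2^-1%:E * g' A)%E) /\
    forall f : T -> \bar R, measurable_fun setT f -> (forall x, (0 <= f x)%E) ->
      (\int[h]_x f x = 2^-1%:E * \int[g]_x f x + 2^-1%:E * \int[g']_x f x)%E.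
Proof.
have h2 : 0 <= 2^-1 :> R by rewrite invr_ge0.
pose m := measure_add (mscale (NngNum h2) g) (mscale (NngNum h2) g').
have mE A : m A = (2^-1%:E * g A + 2^-1%:E * g' A)%E.
  by rewrite /m measure_addE /= /mscale/=.
have [|h hE] := @exists_probability _ _ _ m.
  by rewrite [LHS](mE setT) !probability_setT !mule1 -EFinD -[2^-1]div1r -splitr.
exists h; split=> [A|f mf f0]; first by rewrite hE; exact: mE.
rewrite (eq_measure_integral m); last by move=> A mA _; exact: hE.
by rewrite ge0_integral_measure_add// !ge0_integral_mscale.
Qed.

Section Uniqueness.
Variables (R : realType) (k : nat).
Local Notation Gamma := (Gamma R k).
Variables (mu nu : probability Gamma R).

Lemma optimal_average (g g' : probability (Gamma * Gamma)%type R) :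
  optimal mu nu g -> optimal mu nu g' ->
  exists h, optimal mu nu h /\ forall A, h A = (2^-1%:E * g A + 2^-1%:E * g' A)%E.
Proof.
move=> [cg og] [cg' og']; have [h [hE hint]] := exists_average g g'.
have half (x : \bar R) : (2^-1%:E * x + 2^-1%:E * x = x)%E.
  rewrite -ge0_muleDl ?lee_fin ?invr_ge0// -EFinD -[2^-1]div1r -splitr.
  exact: mul1e.
exists h; split=> //; split=> [A mA|g'' cg''].
  have [g1 g2] := cg A mA; have [g1' g2'] := cg' A mA.
  by rewrite !hE g1 g2 g1' g2' !half.
rewrite /mk_cost hint; last 2 first.
- exact: measurable_cost.
- by move=> z; exact: cost_ge0.
rewrite -[leRHS]half; apply: leeD; apply: lee_wpmul2l => //.
- exact: og.
- exact: og'.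
Qed.

Lemma graph_image_ae (g : probability (Gamma * Gamma)%type R) (T : Gamma -> Gamma) :
  couplings mu nu g -> measurable_fun setT T -> {ae g, forall z, z.2 = T z.1} ->
  graph_image mu T g.
Proof.
move=> cg mT [N [mN N0 TN]] S mS.
have mS' : measurable [set e | S (e, T e)].
  have mg : measurable_fun setT (fun e : Gamma => (e, T e)) by exact: measurable_fun_pair.
  by rewrite -[X in measurable X]setTI; exact: (mg measurableT _ mS).
have [gS' _] := cg _ mS'.
have mS'' : measurable [set z : Gamma * Gamma | [set e | S (e, T e)] z.1].
  have mf : measurable_fun setT (fst : Gamma * Gamma -> Gamma) by exact: measurable_fst.
  by rewrite -[X in measurable X]setTI; exact: (mf measurableT _ mS').
rewrite -gS' -(measureU0 mS mN N0) -(measureU0 mS'' mN N0); congr (g _).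
apply/seteqP; split=> -[e o] /= [] h; try by right.
- have [eo|eo] := pselect (o = T e); first by left; rewrite -eo.
  by right; exact: TN.
- have [eo|eo] := pselect (o = T e); first by left; rewrite eo.
  by right; exact: TN.
Qed.

Lemma graph_image_inj (g : probability (Gamma * Gamma)%type R) (T T' : Gamma -> Gamma) :
  {ae g, forall z, z.2 = T z.1} -> measurable_fun setT T' -> graph_image mu T' g ->
  {ae mu, forall e, T' e = T e}.
Proof.
move=> [N [mN N0 TN]] mT' gT'; exists [set e | N (e, T' e)]; split.
- have mg : measurable_fun setT (fun e : Gamma => (e, T' e)) by exact: measurable_fun_pair.
  by rewrite -[X in measurable X]setTI; exact: (mg measurableT _ mN).
- by rewrite -gT'.
- by move=> e Te; apply: TN.
Qed.

End Uniqueness.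

Theorem theorem5p4 (R : realType) (k : nat)
    (mu nu : probability (Gamma R k) R) (Lam : nat -> set (X R k)) :
  hypH mu -> hypH nu ->
  mu [set eta : Gamma R k | @npts R _ (cpts eta) setT = +oo%E] = 1%E ->
  regular mu ->
  (ereal_inf [set mk_cost g | g in couplings mu nu] < +oo)%E ->
  (forall n, compact (Lam n)) ->
  (forall n, Lam n `<=` Lam n.+1) ->
  \bigcup_n Lam n = setT ->
  exists (g : probability (Gamma R k * Gamma R k)%type R)
         (T : Gamma R k -> Gamma R k),
    [/\ optimal mu nu g,
        (forall g', optimal mu nu g' ->
           forall S : set (Gamma R k * Gamma R k), measurable S -> g' S = g S),
        measurable_fun setT T,
        graph_image mu T g &
        (forall T' : Gamma R k -> Gamma R k, measurable_fun setT T' ->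
           graph_image mu T' g -> {ae mu, forall eta, T' eta = T eta})].
Proof.
move=> muH _ _ _ inf_fin _ _ _.
have opt_fin g : optimal mu nu g -> (mk_cost g < +oo)%E.
  move=> [_ og]; have [_ [g' cg' <-] g'_fin] := ereal_inf_lt inf_fin.
  by apply: le_lt_trans g'_fin; exact: og.
have graph g g' : optimal mu nu g -> optimal mu nu g' ->
    exists T, [/\ measurable_fun setT T, {ae g, forall z, z.2 = T z.1} &
      {ae g', forall z, z.2 = T z.1}].
  move=> og og'; have [h [oh hE]] := optimal_average og og'.
  have [T [mT [N [mN N0 TN]]]] := optimal_graph muH oh (opt_fin h oh).
  (* An exceptional set of the average is null for each of the two couplings, so both are carried by
     the graph of one map and are the same image of [mu]. *)
  have [gN g'N] : g N = 0%E /\ g' N = 0%E.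
    have half0 (x : \bar R) : (0 <= x -> 2^-1%:E * x <= 0 -> x = 0)%E.
      by move=> x0; rewrite pmule_rle0 ?lte_fin ?invr_gt0// => ?; apply/eqP; rewrite eq_le x0 andbT.
    have s0 : (2^-1%:E * g N + 2^-1%:E * g' N = 0)%E by rewrite -hE.
    split; apply: half0 => //; rewrite -[leRHS]s0.
      by rewrite leeDl// mule_ge0// lee_fin invr_ge0.
    by rewrite leeDr// mule_ge0// lee_fin invr_ge0.
  by exists T; split=> //; exists N.
have [g og] := exists_optimal inf_fin.
have [T [mT gT _]] := graph g g og og.
exists g, T; split=> //.
- move=> g' og' S mS; have [T' [mT' gT' g'T']] := graph g g' og og'.
  by rewrite (graph_image_ae og.1 mT' gT' mS) (graph_image_ae og'.1 mT' g'T' mS).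
- exact: graph_image_ae og.1 mT gT.
- by move=> T' mT' gT'; exact: graph_image_inj gT mT' gT'.
Qed.
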